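(* Let $I$ be a finite set, $X=\{X_i;\ i\in I\}$, let $\mathcal{B}$ be a Hall basis of $\mathcal{L}(X)$ and $(\xi_b)_{b\in\mathcal{B}}$ the associated coordinates of the second kind. For every $M\in\mathbb{N}^*$ there exist $C_M,\eta_M>0$ such that the following holds. Let $T,\delta>0$, and for $i\in I$ let $f_i\in\mathcal{C}^{2M}(B_{3\delta};\mathbb{K}^d)$ and $u_i\in L^1((0,T);\mathbb{K})$. Assume that $$\|u\|_{L^1(0,T)}\|f\|_{\mathcal{C}^M}\le\eta_M\min\{1,\delta\}.$$ Then, for each $t\in[0,T]$ and $p\in B_\delta$, $$\Big|x(t;f,u,p)-\overset{\rightarrow}{\prod_{b\in\mathcal{B},\,|b|\le M}}e^{\xi_b(t,u)f_b}\,p\Big|\le C_M\,\|u\|_{L^1(0,t)}^{M+1}\,\|f\|_{\mathcal{C}^{2M}}^{M+1}\big(1+\|f\|_{\mathcal{C}^{2M}}^{M-1}\big),$$ where, if $b_1<b_2<\dots<b_{k+1}$ are the elements of $\mathcal{B}$ of length at most $M$, the product denotes the composition $e^{\xi_{b_1}(t,u)f_{b_1}}\cdots e^{\xi_{b_{k+1}}(t,u)f_{b_{k+1}}}$.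
   Context: $\mathbb{K}=\mathbb{R}$ or $\mathbb{C}$, $d\ge1$, $\mathbb{N}=\{0,1,\dots\}$, $\mathbb{N}^*=\mathbb{N}\setminus\{0\}$. $B_\rho$ is the closed ball of centre $0$ and radius $\rho$ in $\mathbb{K}^d$. $\mathcal{C}^k(B_\rho;\mathbb{K}^d)$ is the space of functions whose real derivatives are well defined and continuous up to order $k$ on an open neighbourhood of $B_\rho$, with norm $\|f\|_{\mathcal{C}^k}=\sum_{j=1}^d\sum_{|\alpha|\le k}\frac1{\alpha!}\|\partial^\alpha f_j\|_{L^\infty(B_\rho)}$, $\alpha\in\mathbb{N}^d$. For a family $f=(f_i)_{i\in I}$, $\|f\|=\sum_{i\in I}\|f_i\|$; similarly $\|u\|_{L^1}=\sum_i\|u_i\|_{L^1}$. $e^gp$ is the value at time $1$ of the solution of $\dot x=g(x)$, $x(0)=p$; products are compositions (rightmost applied first). $x(t;f,u,p)$ is the solution of $\dot x(t)=\sum_{i\in I}u_i(t)f_i(x(t))$, $x(0)=p$. $\mathcal{L}(X)$ is the free Lie algebra over $\mathbb{K}$ on $X$. $\mathrm{Br}(X)$ is the free magma on $X$ (formal iterated brackets): it contains $X$ and all ordered pairs $(b_1,b_2)$ of its elements; $|b|$ is the number of leaves; for $b=(b_1,b_2)$, $\lambda(b)=b_1$, $\mu(b)=b_2$; $\mathrm{ad}_{b_1}(b_2)=(b_1,b_2)$. The evaluation map $\mathrm{Br}(X)\to\mathcal{L}(X)$ replaces formal brackets by Lie brackets. A Hall set is a totally ordered subset $B\subset\mathrm{Br}(X)$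 such that: $X\subset B$; for $b=(b_1,b_2)\in\mathrm{Br}(X)$, $b\in B$ iff $b_1,b_2\in B$, $b_1<b_2$ and either $b_2\in X$ or $\lambda(b_2)\le b_1$; and $b_1<(b_1,b_2)$ whenever $b_1,b_2,(b_1,b_2)\in B$. The evaluation map is injective on $B$ and its image $\mathcal{B}$ is a basis of $\mathcal{L}(X)$, called a Hall basis; elements of $\mathcal{B}$ are identified with those of $B$ (hence have a length, factors and an order). Coordinates of the second kind: $\xi_{X_i}(t,u)=\int_0^tu_i$; for $b\in\mathcal{B}\setminus X$ there are unique $b_1<b_2$ in $\mathcal{B}$ and a unique maximal $m\in\mathbb{N}^*$ with $b=\mathrm{ad}_{b_1}^m(b_2)$, and $\xi_b(t,u)=\frac1{m!}\int_0^t\xi_{b_1}(\tau,u)^m\,\dot\xi_{b_2}(\tau,u)\,\mathrm{d}\tau$. $f_b$ is the vector field obtained by replacing each $X_i$ by $f_i$ in the bracket $b$, with $[f,g]=(Dg)f-(Df)g$.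
   Formalization: For K = C the derivatives in C^k, in its norm and in the brackets are complex, so the f_i are holomorphic near B_{3δ}; with only real derivatives the claim is false (d=1, M=2, one field f(z)=1+conj z, p=0, ∫u=0). For K = R nothing changes. *)

(* Defs.v *)
From HB Require Import structures.
From mathcomp Require Import all_boot all_order all_algebra.
From mathcomp Require Import all_classical all_reals all_analysis.
From mathcomp Require Import complex.
Set Implicit Arguments.
Unset Strict Implicit.
Unset Printing Implicit Defensive.
Import Order.TTheory GRing.Theory Num.Theory.
Import numFieldNormedType.Exports.
Local Open Scope classical_set_scope.
Local Open Scope ring_scope.

(* The two possible scalar fields over [R : realType], with their real and
   imaginary parts (the library has integration and differentiation of
   functions of a real variable for real values only). The norm of a numFieldType
   is valued in that field, whence [abs]. *)
Record scalar_field (R : realType) := ScalarField {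
  scalar :> numFieldType;
  re : scalar -> R;
  im : scalar -> R;
  re_im : R -> R -> scalar }.
Arguments re {R s}.
Arguments im {R s}.
Arguments re_im {R} s.

Definition real_scalars (R : realType) : scalar_field R :=
  @ScalarField R R id (fun=> 0) (fun x _ => x).

Definition complex_scalars (R : realType) : scalar_field R :=
  @ScalarField R R[i] (@complex.Re R) (@complex.Im R) (@Complex R).

Section Scalars.
Context {R : realType} {K : scalar_field R}.
Local Notation mu := (@lebesgue_measure R).

Definition abs (z : K) : R := re `|z|.

Definition integral0 (g : R -> K) (t : R) : K :=
  re_im K (\int[mu]_(s in `[0, t]) re (g s)) (\int[mu]_(s in `[0, t]) im (g s)).

Definition tderive (g : R -> K) (t : R) : K :=
  re_im K (derive1 (re \o g) t) (derive1 (im \o g) t).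

Definition L1 (T : R) (g : R -> K) : Prop :=
  mu.-integrable `]0, T[ (EFin \o (re \o g)) /\
  mu.-integrable `]0, T[ (EFin \o (im \o g)).

Definition normL1 (I : finType) (t : R) (u : I -> R -> K) : R :=
  \sum_i \int[mu]_(s in `]0, t[) abs (u i s).

End Scalars.

Section VectorFields.
Context {R : realType} {K : scalar_field R} {d : nat}.
Local Notation V := 'rV[K]_d.

Definition norm2 (x : V) : R := Num.sqrt (\sum_j abs (x 0 j) ^+ 2).

Definition cball (rho : R) : set V := [set x | norm2 x <= rho].

(* Derivatives are taken over K. For K = C this makes the fields holomorphic,
   without which neither is b |-> f_b compatible with the C-Lie algebra structure,
   nor can complex controls be allowed: for d = 1, one field f(z) = 1 + conj z and
   int_0^T u = 0, the state reached from 0 is of second order in u in general,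
   while the product of exponentials is the identity. *)
Definition pderive (j : 'I_d) (f : V -> V) : V -> V :=
  fun x => 'D_(delta_mx 0 j) f x.

Fixpoint C_on (k : nat) (U : set V) (f : V -> V) : Prop :=
  {in U, continuous f} /\
  if k is k'.+1 then forall j : 'I_d,
    (forall x, U x -> derivable f x (delta_mx 0 j)) /\ C_on k' U (pderive j f)
  else True.

Definition C_ball (k : nat) (rho : R) (f : V -> V) : Prop :=
  exists U : set V, [/\ open U, cball rho `<=` U & C_on k U f].

Definition mderive (alpha : 'I_d -> nat) (f : V -> V) : V -> V :=
  foldr (fun j g => iter (alpha j) (pderive j) g) f (enum 'I_d).

(* The L^oo norm of a continuous function on a ball is its supremum. *)
Definition normCk (k : nat) (rho : R) (f : V -> V) : R :=
  \sum_(j < d) \sum_(alpha : {ffun 'I_d -> 'I_k.+1} | (\sum_i alpha i <= k)%N)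
    (\prod_i (alpha i)`!)%:R^-1 *
    sup [set abs (mderive (fun i => alpha i) f x 0 j) | x in cball rho].

Definition normCks (I : finType) (k : nat) (rho : R) (f : I -> V -> V) : R :=
  \sum_i normCk k rho (f i).

Definition lie (f g : V -> V) : V -> V :=
  fun x => 'd g x (f x) - 'd f x (g x).

(* Caratheodory solution on [0, T] of x' = F(t, x), x(0) = p, staying in the closed
   ball of radius rho, outside of which the values of the fields are irrelevant. *)
Definition solution (rho T : R) (F : R -> V -> V) (p : V) (x : R -> V) : Prop :=
  [/\ {within `[0, T], continuous x},
      forall t, t \in `[0, T] -> cball rho (x t) &
      forall t, t \in `[0, T] -> forall j,
        x t 0 j = p 0 j + integral0 (fun s => F s (x s) 0 j) t].

Definition control_field (I : finType) (f : I -> V -> V) (u : I -> R -> K) :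
  R -> V -> V := fun s y => \sum_i u i s *: f i y.

(* q = e^g p, as a relation: the flow may leave the domain before time 1. *)
Definition is_exp (rho : R) (g : V -> V) (p q : V) : Prop :=
  exists2 x, solution rho 1 (fun=> g) p x & x 1 = q.

(* q = e^(g_1) ... e^(g_k) p, the exponential of g_k being applied first. *)
Fixpoint is_exp_prod (rho : R) (gs : seq (V -> V)) (p q : V) : Prop :=
  if gs is g :: gs' then
    exists2 r, is_exp_prod rho gs' p r & is_exp rho g r q
  else q = p.

End VectorFields.

(* Br(X) for X = {X_i; i in I}; an element of the Hall basis of the free Lie
   algebra is represented by the bracket of the Hall set it is the evaluation of. *)
Inductive br (I : Type) := Leaf (i : I) | Node (b1 b2 : br I).
Arguments Leaf {I}.

HB.instance Definition _ (I : Type) := gen_eqMixin (br I).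

Section Brackets.
Context {I : finType}.

Fixpoint blen (b : br I) : nat :=
  if b is Node b1 b2 then (blen b1 + blen b2)%N else 1%N.

Definition blt (le : rel (br I)) : rel (br I) :=
  fun b1 b2 => (b1 != b2) && le b1 b2.

Record hall_set (B : {pred br I}) (le : rel (br I)) : Prop := HallSet {
  hall_anti : {in B &, antisymmetric le};
  hall_trans : {in B & &, transitive le};
  hall_total : {in B &, total le};
  hall_leaf : forall i, Leaf i \in B;
  hall_node : forall b1 b2, Node b1 b2 \in B <->
    [/\ b1 \in B, b2 \in B, blt le b1 b2 &
        if b2 is Node c _ then le c b1 else True];
  hall_lt : forall b1 b2, b1 \in B -> b2 \in B -> Node b1 b2 \in B ->
    blt le b1 (Node b1 b2) }.

Fixpoint bfield (R : realType) (K : scalar_field R) (d : nat)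
    (f : I -> 'rV[K]_d -> 'rV[K]_d) (b : br I) : 'rV[K]_d -> 'rV[K]_d :=
  match b with
  | Leaf i => f i
  | Node b1 b2 => lie (bfield f b1) (bfield f b2)
  end.

(* In the branch of [Node b1 b2], [peel m c] is reached with
   Node b1 b2 = ad_b1^m c, and peels off b1 until m is maximal; see [xi_ad].
   [tderive (xi u c)] is defined almost everywhere. *)
Fixpoint xi (R : realType) (K : scalar_field R) (u : I -> R -> K) (b : br I) :
    R -> K :=
  match b with
  | Leaf i => integral0 (u i)
  | Node b1 b2 =>
    let xi1 := xi u b1 in
    let fix peel (m : nat) (c : br I) : R -> K :=
      let coord := fun t => (m`!)%:R^-1 *
        integral0 (fun s => xi1 s ^+ m * tderive (xi u c) s) t in
      match c with
      | Node c1 c2 => if c1 == b1 then peel m.+1 c2 else coord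
      | Leaf _ => coord
      end in
    peel 1%N b2
  end.

Lemma xi_ad (R : realType) (K : scalar_field R) (u : I -> R -> K)
    (b1 b2 : br I) (m : nat) (t : R) :
  (0 < m)%N -> (forall c, b2 != Node b1 c) ->
  xi u (iter m (Node b1) b2) t =
  (m`!)%:R^-1 * integral0 (fun s => xi u b1 s ^+ m * tderive (xi u b2) s) t.
Proof.
case: m => // m _ b2N; rewrite /=.
set peel := (fix peel (m : nat) (c : br I) {struct c} : R -> K := _).
suff -> : forall n, peel n.+1 (iter m (Node b1) b2) = peel (n + m).+1 b2.
  case: b2 b2N @peel => [i|c1 c2] //= b2N.
  by case: eqP => // c1b1; have := b2N c2; rewrite c1b1 eqxx.
elim: m => [|m IHm] n /=; first by rewrite addn0.
by rewrite eqxx IHm addnS addSn.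
Qed.

End Brackets.

(* Main.v *)
Require Import Defs.
From HB Require Import structures.
From mathcomp Require Import all_boot all_order all_algebra.
From mathcomp Require Import all_classical all_reals all_analysis.
From mathcomp Require Import complex measurable_realfun.
From mathcomp Require Import ring lra zify.
Set Implicit Arguments.
Unset Strict Implicit.
Unset Printing Implicit Defensive.
Import Order.TTheory GRing.Theory Num.Theory.
Import numFieldNormedType.Exports.
Local Open Scope classical_set_scope.
Local Open Scope ring_scope.

(** Let [z(t)] be the product of the [e^(xi_b(t,u) f_b)], [|b| <= M], applied to [p], and
  [V(t)] the L^1 norm of [u] on [(0, t)]. Both [x] and [z] start from [p], and the point
  is that [z] solves the control system of [x] up to an error of order [V^M dV]; the
  Gronwall lemma then gives the distance [V^(M+1)].

  The equation of [z] is found by adding its factors one at a time, from the last,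
  which acts first, to the first ([suffix_incr]). If [y] is the product of the elements
  of a suffix of the Hall set, and [g] is the element before it, multiplying by
  [e^(xi_g g)] adds [dxi_g g] to the differential of [y] and transforms the rest by the
  adjoint action of this flow, a field [h] being replaced by the sum of the
  [(-xi_g)^m / m! ad_g^m h]. Conversely [h_0] is the transform of the sum of the [xi_g^m / m! h_m], where [h_m] is the [m]-th bracket of
  [h_0] by [g] ([conjugation_step]). Now [xi_(ad_g^m v)] has the differential
  [xi_g^m / m! dxi_v] ([xi_ad_incr]), so that the [dxi_b f_b] over the brackets
  [b = ad_g^m v] recombine into [dxi_v f_v]. By Lazard elimination the generators for
  the suffix are precisely these brackets, when [v] runs over the generators for the
  longer suffix other than [g] ([letters_perm]). At the end the generators for the
  whole Hall set are the leaves, and the differential of [z] is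
  the sum of the [u_i f_i].

  The series are cut at the length [M]. What is lost are brackets [b] with
  [M < |b| <= 2 M]: their coefficient is [O(V^(|b| - 1)) dV] ([xi_incr], [xi_bound]),
  and their field is bounded by the norm of class C^(2M) times the [|b| - 1]-st power of
  the norm of class C^M ([norm2_pd_bfield_le]); since [V] times the latter is small,
  only the power [M] remains ([remainder_le]).

  The coordinates are absolutely continuous functions of time, and the fields are only
  of finite class. The differential of a curve therefore stands for its increments, known
  up to [O(dV^2)], and these errors disappear when the partition of the interval
  is refined ([discrete_gronwall]). That lemma serves twice, with the time of the flow of
  [g] in [conjugation_step] and with the time of the system in [solution_prod_dist]. *)

Local Notation int0 := Defs.integral0.

(** * The scalar fields *)

(** The intervals of centre [a n] whose radius is the remainder of the geometric series
  are nested. *)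
Lemma geometric_limit (R : realType) (a : nat -> R) (c q : R) :
  0 <= q < 1 -> 0 <= c -> (forall n, `|a n.+1 - a n| <= c * q ^+ n) ->
  exists l, forall n, `|a n - l| <= c * q ^+ n / (1 - q).
Proof.
move=> /andP[q0 q1] c0 h.
pose e n := c * q ^+ n / (1 - q).
have q1' : 0 < 1 - q by rewrite subr_gt0.
have eS n : e n - e n.+1 = c * q ^+ n.
  rewrite /e exprS -mulrBl; apply: (canLR (mulfK (lt0r_neq0 q1'))).
  by ring.
have e0 n : 0 <= e n by rewrite /e divr_ge0 ?mulr_ge0 ?exprn_ge0// ltW.
have lo n m : (n <= m)%N -> a n - e n <= a m - e m.
  move=> /subnK <-; elim: (m - n)%N => [//|k IH].
  apply: (le_trans IH); rewrite addSn.
  by have := h (k + n)%N; rewrite ler_norml -eS => /andP[]; lra.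
have hi n m : (n <= m)%N -> a m + e m <= a n + e n.
  move=> /subnK <-; elim: (m - n)%N => [//|k IH].
  apply: le_trans IH; rewrite addSn.
  by have := h (k + n)%N; rewrite ler_norml -eS => /andP[]; lra.
have lh n m : a n - e n <= a m + e m.
  have [nm|mn] := leqP n m.
    by have := lo _ _ nm; have := e0 m; lra.
  by have := hi _ _ (ltnW mn); have := e0 n; lra.
exists (sup (range (fun n => a n - e n))) => n.
rewrite ler_norml; apply/andP; split.
  rewrite -/(e n) lerNl opprB lerBlDr addrC.
  by apply: ge_sup; [exists (a 0%N - e 0%N), 0%N|move=> _ [m _ <-]].
rewrite lerBlDr -lerBlDl -/(e n); apply: ub_le_sup; last by exists n.
by exists (a 0%N + e 0%N) => _ [m _ <-].
Qed.

Section ScalarTheory.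
Context {R : realType} {K : scalar_field R}.
Hypothesis hK : K = real_scalars R \/ K = complex_scalars R.
Implicit Types (x y z : K) (a b : R).

Definition inj a : K := re_im K a 0.

Lemma reD x y : re (x + y) = re x + re y.
Proof. by move: x y; case: hK => -> //= [? ?] [? ?]. Qed.

Lemma imD x y : im (x + y) = im x + im y.
Proof. by move: x y; case: hK => -> //=; [rewrite addr0|move=> [? ?] [? ?]]. Qed.

Lemma reN x : re (- x) = - re x.
Proof. by move: x; case: hK => -> //= [? ?]. Qed.

Lemma imN x : im (- x) = - im x.
Proof. by move: x; case: hK => -> //=; [rewrite oppr0|move=> [? ?]]. Qed.

Lemma reB x y : re (x - y) = re x - re y. Proof. by rewrite reD reN. Qed.
Lemma imB x y : im (x - y) = im x - im y. Proof. by rewrite imD imN. Qed.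

Lemma re0 : re (0 : K) = 0.
Proof. by have := reB 0 0; rewrite !subrr. Qed.

Lemma im0 : im (0 : K) = 0.
Proof. by have := imB 0 0; rewrite !subrr. Qed.

Lemma reM x y : re (x * y) = re x * re y - im x * im y.
Proof. by move: x y; case: hK => -> //=; [move=> x y; rewrite mul0r subr0|move=> [? ?] [? ?]]. Qed.

Lemma imM x y : im (x * y) = re x * im y + im x * re y.
Proof.
by move: x y; case: hK => -> //=;
  [move=> x y; rewrite mul0r mulr0 addr0|move=> [? ?] [? ?]].
Qed.

Lemma re_im_eta z : re_im K (re z) (im z) = z.
Proof. by move: z; case: hK => -> //= [? ?]. Qed.

Lemma re_im_inj x y : re x = re y -> im x = im y -> x = y.
Proof. by move=> e1 e2; rewrite -[x]re_im_eta -[y]re_im_eta e1 e2. Qed.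

Lemma re_inj a : re (inj a) = a.
Proof. by rewrite /inj; case: hK => ->. Qed.

Lemma im_inj a : im (inj a) = 0.
Proof. by rewrite /inj; case: hK => ->. Qed.

Lemma injD : {morph inj : a b / a + b}.
Proof. by move=> a b; apply: re_im_inj; rewrite ?(reD, imD, re_inj, im_inj, addr0). Qed.

Lemma injN : {morph inj : a / - a}.
Proof. by move=> a; apply: re_im_inj; rewrite ?(reN, imN, re_inj, im_inj, oppr0). Qed.

Lemma injM : {morph inj : a b / a * b}.
Proof.
by move=> a b; apply: re_im_inj; rewrite ?(reM, imM, re_inj, im_inj);
  rewrite ?(mul0r, mulr0, subr0, addr0).
Qed.

Lemma inj0 : inj 0 = 0.
Proof. by apply: re_im_inj; rewrite ?(re_inj, im_inj, re0, im0). Qed.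

Lemma inj1 : inj 1 = 1.
Proof. by rewrite /inj; case: hK => ->. Qed.

Lemma inj_nat n : inj n%:R = n%:R.
Proof. by elim: n => [|n IH]; rewrite ?inj0// -!natr1 injD IH inj1. Qed.

Lemma norm_inj_abs z : `|z| = inj (abs z).
Proof.
by rewrite /inj /abs; move: z; case: hK => -> //= z; rewrite normc_def.
Qed.

Lemma le_inj a b : (inj a <= inj b) = (a <= b).
Proof. by rewrite /inj; case: hK => -> //=; rewrite lecE /= eqxx. Qed.

Lemma eq_inj a b : (inj a == inj b) = (a == b).
Proof. by apply/eqP/eqP => [/(congr1 re)|->//]; rewrite !re_inj. Qed.

Lemma lt_inj a b : (inj a < inj b) = (a < b).
Proof. by rewrite !lt_neqAle eq_inj le_inj. Qed.

Lemma gt0_injE z : 0 < z -> 0 < re z /\ z = inj (re z).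
Proof.
move=> z0; have e : z = inj (re z).
  by rewrite -{1}(ger0_norm (ltW z0)) norm_inj_abs /abs (ger0_norm (ltW z0)).
by split => //; rewrite -lt_inj -e inj0.
Qed.

Lemma abs_ge0 z : 0 <= abs z.
Proof. by rewrite -le_inj -norm_inj_abs inj0. Qed.
Hint Resolve abs_ge0 : core.

Lemma abs0 : abs (0 : K) = 0.
Proof. by rewrite /abs normr0 re0. Qed.

Lemma absM x y : abs (x * y) = abs x * abs y.
Proof.
by apply/eqP; rewrite -eq_inj injM -!norm_inj_abs normrM.
Qed.

Lemma absD x y : abs (x + y) <= abs x + abs y.
Proof. by rewrite -le_inj injD -!norm_inj_abs ler_normD. Qed.

Lemma absN x : abs (- x) = abs x.
Proof. by rewrite /abs normrN. Qed.

Lemma absB x y : abs (x - y) <= abs x + abs y.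
Proof. by rewrite -(absN y) absD. Qed.

Lemma abs_distC x y : abs (x - y) = abs (y - x).
Proof. by rewrite -absN opprB. Qed.

Lemma abs_inj a : abs (inj a) = `|a|.
Proof. rewrite /inj /abs; case: hK => -> //; rewrite normc_def /=.
by rewrite expr0n addr0 sqrtr_sqr. Qed.

Lemma abs1 : abs (1 : K) = 1.
Proof. by rewrite -inj1 abs_inj normr1. Qed.

Lemma abs_nat n : abs (n%:R : K) = n%:R.
Proof. by rewrite -inj_nat abs_inj normr_nat. Qed.

Lemma absX z n : abs (z ^+ n) = abs z ^+ n.
Proof. by elim: n => [|n IH]; rewrite ?expr0 ?abs1// !exprS absM IH. Qed.

Lemma abs_eq0 z : (abs z == 0) = (z == 0).
Proof. by rewrite -eq_inj -norm_inj_abs inj0 normr_eq0. Qed.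

Lemma absV z : abs z^-1 = (abs z)^-1.
Proof.
have [->|z0] := eqVneq z 0; first by rewrite invr0 abs0 invr0.
have a0 : abs z != 0 by rewrite abs_eq0.
by apply: (mulfI a0); rewrite -absM divff// divff// abs1.
Qed.

Lemma abs_re z : `|re z| <= abs z.
Proof.
rewrite /abs; move: z; case: hK => -> // -[a b] /=.
by rewrite -sqrtr_sqr ler_wsqrtr // lerDl sqr_ge0.
Qed.

Lemma abs_im z : `|im z| <= abs z.
Proof.
rewrite /abs; move: z; case: hK => -> z; [|case: z => a b] => /=; first by rewrite normr0.
by rewrite -sqrtr_sqr ler_wsqrtr // lerDr sqr_ge0.
Qed.

Lemma abs_le_re_im z : abs z <= `|re z| + `|im z|.
Proof.
have e : re_im K (re z) (im z) = inj (re z) + (z - inj (re z)) by rewrite addrC subrK re_im_eta.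
rewrite -{1}[z]re_im_eta e; apply: (le_trans (absD _ _)); rewrite abs_inj lerD2l.
rewrite /inj /abs; move: z {e}; case: hK => -> z; [|case: z => a b] => /=.
  by rewrite subrr !normr0.
by rewrite subrr expr0n /= add0r subr0 sqrtr_sqr.
Qed.

Lemma abs_sum (J : Type) (s : seq J) (P : pred J) (F : J -> K) :
  abs (\sum_(j <- s | P j) F j) <= \sum_(j <- s | P j) abs (F j).
Proof.
elim/big_ind2 : _ => //; first by rewrite abs0.
by move=> x a y b h1 h2; apply: le_trans (absD _ _) (lerD h1 h2).
Qed.

Lemma re_integral0 (g : R -> K) t :
  re (int0 g t) = \int[lebesgue_measure]_(s in `[0, t]) re (g s).
Proof. by rewrite /Defs.integral0; case: hK g => ->. Qed.

Lemma im_integral0 (g : R -> K) t :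
  im (int0 g t) = \int[lebesgue_measure]_(s in `[0, t]) im (g s).
Proof.
rewrite /Defs.integral0; case: hK g => -> // g /=.
by rewrite /Rintegral integral0.
Qed.

Lemma re_tderive (g : R -> K) t : re (tderive g t) = derive1 (re \o g) t.
Proof. by rewrite /tderive; case: hK g => ->. Qed.

Lemma im_tderive (g : R -> K) t : im (tderive g t) = derive1 (im \o g) t.
Proof.
rewrite /tderive; case: hK g => -> // g /=.
by rewrite [_ \o _](_ : _ = cst 0)// derive1_cst.
Qed.

Lemma abs_complete (z : nat -> K) (c q : R) : 0 <= q < 1 -> 0 <= c ->
  (forall n, abs (z n.+1 - z n) <= c * q ^+ n) ->
  exists l : K, forall n, abs (z n - l) <= 2 * (c * q ^+ n / (1 - q)).
Proof.
move=> hq c0 h.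
have [a ha] : exists a, forall n, `|re (z n) - a| <= c * q ^+ n / (1 - q).
  by apply: geometric_limit => // n; rewrite -reB; exact: le_trans (abs_re _) (h n).
(* Real scalars have no imaginary part: the limit of this part is then 0. *)
have [b [hb ab]] : exists b, (forall n, `|im (z n) - b| <= c * q ^+ n / (1 - q)) /\
    im (re_im K a b) = b.
  have [b hb] : exists b, forall n, `|im (z n) - b| <= c * q ^+ n / (1 - q).
    by apply: geometric_limit => // n; rewrite -imB; exact: le_trans (abs_im _) (h n).
  have [e|b0] := eqVneq (im (re_im K a b)) b; first by exists b.
  exists 0; move: z h ha hb b0; case: hK => -> z h ha hb //=; last by rewrite eqxx.
  by move=> _; split => // n; have := hb n; rewrite /= subrr normr0 => /(le_trans (normr_ge0 _)).
exists (re_im K a b) => n; apply: (le_trans (abs_le_re_im _)).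
have -> : 2 * (c * q ^+ n / (1 - q)) = c * q ^+ n / (1 - q) + c * q ^+ n / (1 - q) by ring.
rewrite reB imB ab lerD//.
by have -> : re (re_im K a b) = a by case: hK => ->.
Qed.

End ScalarTheory.
#[global] Hint Extern 0 (is_true (0 <= abs _)) => (apply: abs_ge0; eassumption) : core.

(** * The Euclidean norm and the topology *)

Section Norm2Theory.
Context {R : realType} {K : scalar_field R}.
Hypothesis hK : K = real_scalars R \/ K = complex_scalars R.
Context {d : nat}.
Local Notation V := 'rV[K]_d.
Implicit Types (x y z : V) (a b : R).

Lemma norm2_ge0 x : 0 <= norm2 x.
Proof. exact: sqrtr_ge0. Qed.

Lemma sqr_norm2 x : norm2 x ^+ 2 = \sum_j abs (x 0 j) ^+ 2.
Proof. by rewrite sqr_sqrtr// sumr_ge0// => j _; rewrite sqr_ge0. Qed.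

Lemma norm2_0 : norm2 (0 : V) = 0.
Proof.
rewrite /norm2 big1 ?sqrtr0// => j _.
by rewrite mxE (abs0 hK) expr0n.
Qed.

Lemma norm2Z (c : K) x : norm2 (c *: x) = abs c * norm2 x.
Proof.
rewrite /norm2 (eq_bigr (fun j => abs c ^+ 2 * abs (x 0 j) ^+ 2)) => [|j _].
  by rewrite -mulr_sumr sqrtrM ?sqr_ge0// sqrtr_sqr ger0_norm// (abs_ge0 hK).
by rewrite mxE (absM hK) exprMn.
Qed.

Lemma norm2N x : norm2 (- x) = norm2 x.
Proof. by rewrite -scaleN1r norm2Z (absN _) (abs1 hK) mul1r. Qed.

(** The Cauchy-Schwarz inequality, by expanding the sum of the squares of [a j * B - b j * A]. *)
Lemma sum_mul_le_sqrt (J : finType) (a b : J -> R) : (forall j, 0 <= a j) ->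
  (forall j, 0 <= b j) ->
  \sum_j a j * b j <= Num.sqrt (\sum_j a j ^+ 2) * Num.sqrt (\sum_j b j ^+ 2).
Proof.
move=> a0 b0; set A := Num.sqrt _; set B := Num.sqrt _.
have A0 : 0 <= A := sqrtr_ge0 _; have B0 : 0 <= B := sqrtr_ge0 _.
have A2 : A ^+ 2 = \sum_j a j ^+ 2.
  by rewrite sqr_sqrtr// sumr_ge0// => j _; rewrite sqr_ge0.
have B2 : B ^+ 2 = \sum_j b j ^+ 2.
  by rewrite sqr_sqrtr// sumr_ge0// => j _; rewrite sqr_ge0.
have zero (c : J -> R) : \sum_j c j ^+ 2 = 0 -> forall j, c j = 0.
  move=> /eqP; rewrite psumr_eq0 => [/allP h j|j _]; last exact: sqr_ge0.
  by have := h j (mem_index_enum _); rewrite sqrf_eq0 => /eqP.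
have [Az|Az] := eqVneq A 0.
  rewrite Az mul0r big1// => j _; rewrite (zero a) ?mul0r//.
  by rewrite -A2 Az expr0n.
have [Bz|Bz] := eqVneq B 0.
  rewrite Bz mulr0 big1// => j _; rewrite (zero b) ?mulr0//.
  by rewrite -B2 Bz expr0n.
have AB : 0 < A * B by rewrite lt_neqAle mulr_ge0// eq_sym mulf_eq0 negb_or Az Bz.
have : 0 <= \sum_j (a j * B - b j * A) ^+ 2 by apply: sumr_ge0 => j _; exact: sqr_ge0.
rewrite (eq_bigr (fun j => B ^+ 2 * a j ^+ 2 + A ^+ 2 * b j ^+ 2 - 2 * (A * B) * (a j * b j)));
  last by move=> j _; ring.
rewrite sumrB big_split /= -!mulr_sumr -A2 -B2 => h.
rewrite -(ler_pM2l AB); lra.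
Qed.

Lemma norm2D x y : norm2 (x + y) <= norm2 x + norm2 y.
Proof.
rewrite -(ler_pXn2r (_ : 0 < 2)%N) ?nnegrE ?addr_ge0 ?norm2_ge0//.
rewrite sqrrD !sqr_norm2.
have h : \sum_j abs (x 0 j) * abs (y 0 j) <= norm2 x * norm2 y.
  by apply: sum_mul_le_sqrt => j; exact: (abs_ge0 hK).
apply: (@le_trans _ _ (\sum_j (abs (x 0 j) ^+ 2 + abs (y 0 j) ^+ 2 +
   2 * (abs (x 0 j) * abs (y 0 j))))).
  apply: ler_sum => j _; rewrite mxE.
  have := absD hK (x 0 j) (y 0 j); have := abs_ge0 hK (x 0 j + y 0 j).
  have := abs_ge0 hK (x 0 j); have := abs_ge0 hK (y 0 j); nra.
rewrite big_split big_split /= -mulr_sumr -mulr_natl; lra.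
Qed.

Lemma norm2B x y : norm2 (x - y) <= norm2 x + norm2 y.
Proof. by rewrite -(norm2N y) norm2D. Qed.

Lemma norm2_distC x y : norm2 (x - y) = norm2 (y - x).
Proof. by rewrite -norm2N opprB. Qed.

Lemma norm2_triangle z x y : norm2 (x - y) <= norm2 (x - z) + norm2 (z - y).
Proof. by have := norm2D (x - z) (z - y); rewrite addrA subrK. Qed.

Lemma norm2_sum (J : Type) (s : seq J) (P : pred J) (F : J -> V) :
  norm2 (\sum_(j <- s | P j) F j) <= \sum_(j <- s | P j) norm2 (F j).
Proof.
elim/big_ind2 : _ => //; first by rewrite norm2_0.
by move=> x a y b h1 h2; apply: le_trans (norm2D _ _) (lerD h1 h2).
Qed.

Lemma abs_le_norm2 x j : abs (x 0 j) <= norm2 x.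
Proof.
rewrite -(ler_pXn2r (_ : 0 < 2)%N) ?nnegrE ?norm2_ge0 ?(abs_ge0 hK)//.
rewrite sqr_norm2 (bigD1 j)//= lerDl sumr_ge0// => i _; exact: sqr_ge0.
Qed.

Lemma norm2_le_sum x : norm2 x <= \sum_j abs (x 0 j).
Proof.
have e : x = \sum_j x 0 j *: delta_mx 0 j by rewrite {1}(row_sum_delta x).
rewrite {1}e; apply: (le_trans (norm2_sum _ _ _)); apply: ler_sum => j _.
rewrite norm2Z /norm2 (bigD1 j)//= big1 => [|i ij]; last first.
  by rewrite mxE (negbTE ij) andbF (abs0 hK) expr0n.
by rewrite mxE !eqxx (abs1 hK) expr1n addr0 sqrtr1 mulr1.
Qed.

Lemma norm2_le x a : (forall j, abs (x 0 j) <= a) -> norm2 x <= d%:R * a.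
Proof.
move=> h; apply: (le_trans (norm2_le_sum x)).
apply: (@le_trans _ _ (\sum_(j < d) a)); first exact: ler_sum.
by rewrite sumr_const card_ord mulr_natl.
Qed.

Lemma norm2_le0 x : norm2 x <= 0 -> x = 0.
Proof.
move=> h; apply/rowP => j; rewrite mxE; apply/eqP.
rewrite -(abs_eq0 hK) eq_le (abs_ge0 hK) andbT.
exact: le_trans (abs_le_norm2 x j) h.
Qed.

Lemma cball_segment rho x y s : 0 <= s <= 1 -> cball rho x -> cball rho y ->
  cball rho (x + inj s *: (y - x)).
Proof.
rewrite /cball /= => /andP[s0 s1] hx hy.
have -> : x + inj s *: (y - x) = inj (1 - s) *: x + inj s *: y :> V.
  by rewrite (injD hK) (injN hK) (inj1 hK) scalerBr scalerBl scale1r addrA addrAC.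
apply: (le_trans (norm2D _ _)); rewrite !norm2Z !(abs_inj hK) ger0_norm ?subr_ge0// ger0_norm//.
by have := norm2_ge0 x; have := norm2_ge0 y; nra.
Qed.

Lemma nbhs_absP (z : K) (P : set K) :
  nbhs z P <-> exists2 e : R, 0 < e & forall y : K, abs (y - z) < e -> P y.
Proof.
split => [/nbhs_ballP[e e0 eP]|[e e0 eP]].
  have [re0 ee] := gt0_injE hK e0.
  exists (re e) => // y yz; apply: eP; rewrite /ball /= ee norm_inj_abs// lt_inj//.
  by rewrite abs_distC.
apply/nbhs_ballP; exists (inj e); first by rewrite /= -(inj0 hK) lt_inj.
move=> y; rewrite /ball /= norm_inj_abs// lt_inj// => yz; apply: eP.
by rewrite abs_distC.
Qed.

Lemma nbhs_norm2P x (P : set V) :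
  nbhs x P <-> exists2 e : R, 0 < e & forall y, norm2 (y - x) < e -> P y.
Proof.
split => [/nbhs_ballP[e e0 eP]|[e e0 eP]].
  have [re0 ee] := gt0_injE hK e0.
  exists (re e) => // y yz; apply: eP; split => // i j; rewrite /ball /= ee norm_inj_abs// lt_inj//.
  rewrite abs_distC// (ord1 i); apply: le_lt_trans yz.
  by have := abs_le_norm2 (y - x) j; rewrite !mxE.
apply/nbhs_ballP; exists (inj (e / d.+1%:R)).
  by rewrite /= -(inj0 hK) lt_inj// divr_gt0.
move=> y [_ xy]; apply: eP.
apply: (@le_lt_trans _ _ (d%:R * (e / d.+1%:R))).
  apply: norm2_le => j; have := xy 0 j; rewrite /ball /= norm_inj_abs// lt_inj// => /ltW.
  by rewrite !mxE abs_distC.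
rewrite mulrCA -[X in _ < X]mulr1 ltr_pM2l// ltr_pdivrMr// mul1r ltr_nat.
by [].
Qed.

Lemma norm_le_norm2 x : `|x| <= inj (norm2 x).
Proof.
change (mx_norm x <= inj (norm2 x)).
have [->|x0] := eqVneq (mx_norm x) 0; first by rewrite -(inj0 hK) le_inj// norm2_ge0.
have [[i j] /= ->] := mx_norm_neq0 x0.
by rewrite (ord1 i) norm_inj_abs// le_inj// abs_le_norm2.
Qed.

Lemma norm2_le_norm x : inj (norm2 x) <= inj d%:R * `|x|.
Proof.
change (inj (norm2 x) <= inj d%:R * mx_norm x).
have [a xa] : exists a : R, mx_norm x = inj a.
  have [x0|x0] := eqVneq (mx_norm x) 0; first by exists 0; rewrite x0 inj0.
  have [[i j] /= e] := mx_norm_neq0 x0.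
  by exists (abs (x i j)); rewrite e norm_inj_abs.
rewrite xa -(injM hK) le_inj//; apply: norm2_le => j.
rewrite -(le_inj hK) -norm_inj_abs// -xa.
by rewrite mx_normE -[leLHS]nngE num_le; exact: (le_bigmax _ _ (0, j)).
Qed.

End Norm2Theory.

(** * Directional derivatives and the mean value inequality *)

(** A first order expansion rather than the limit of a quotient: it includes the zero
  increment, and can be summed. *)
Lemma is_derive_incrP (F : numFieldType) (V W : normedModType F) (f : V -> W)
    (x v : V) (D : W) :
  is_derive x v f D <->
  (forall e, 0 < e -> \forall h \near (0 : F),
     `|f (h *: v + x) - f x - h *: D| <= e * `|h|).
Proof.
pose q h := h^-1 *: (f (h *: v + x) - f x).
have main : (q h @[h --> 0^'] --> D) <->
  (forall e, 0 < e -> \forall h \near (0 : F),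
     `|f (h *: v + x) - f x - h *: D| <= e * `|h|).
  have eq h : h != 0 -> f (h *: v + x) - f x - h *: D = - (h *: (D - q h)).
    by move=> h0; rewrite scalerBr /q scalerA divff// scale1r opprB.
  split => [/cvgrPdist_le qD e e0|h].
    have := qD e e0; rewrite /nbhs /= /dnbhs /within /= => H.
    near=> h.
    have [->|h0] := eqVneq h 0.
      by rewrite !scale0r add0r subrr subr0 !normr0 mulr0.
    rewrite eq// normrN normrZ mulrC ler_pM2r ?normr_gt0//.
    by move: h0; near: h.
  apply/cvgrPdist_le => e e0; rewrite /dnbhs /within /= near_withinE.
  near=> k; move=> k0.
  rewrite -(ler_pM2r (_ : 0 < `|k|)) ?normr_gt0// mulrC -normrZ -normrN -eq//.
  by near: k; exact: h.
split => [[dv ev]|h].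
  by apply/main; rewrite -ev; exact: dv.
have /main qD := h; split; first by apply/cvg_ex; exists D.
by apply: cvg_lim => //; exact: norm_hausdorff.
Unshelve. all: by end_near. Qed.

Section Derivatives.
Context {R : realType} {K : scalar_field R}.
Hypothesis hK : K = real_scalars R \/ K = complex_scalars R.
Context {d : nat}.
Local Notation V := 'rV[K]_d.
Implicit Types (x y z v : V) (f g : V -> V).

Lemma is_derive_norm2P f x v (D : V) :
  is_derive x v f D <->
  (forall e : R, 0 < e -> exists2 r : R, 0 < r & forall h : K, abs h < r ->
     norm2 (f (h *: v + x) - f x - h *: D) <= e * abs h).
Proof.
rewrite is_derive_incrP; split => [H e e0|H e e0].
  have d0 : 0 < e / d.+1%:R by rewrite divr_gt0.
  have /H : 0 < inj (e / d.+1%:R) :> K by rewrite -(inj0 hK) lt_inj.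
  move=> /nbhs_absP -/(_ hK)[r r0 rH]; exists r => // h hr.
  have {}rH : `|f (h *: v + x) - f x - h *: D| <= inj (e / d.+1%:R) * `|h|.
    by apply: rH; rewrite subr0.
  rewrite -(le_inj hK); apply: (le_trans (norm2_le_norm hK _)).
  have d1 : 0 <= inj d%:R :> K by rewrite -(inj0 hK) le_inj.
  apply: (le_trans (ler_wpM2l d1 rH)).
  rewrite norm_inj_abs// -!(injM hK) le_inj// mulrA ler_wpM2r ?(abs_ge0 hK)//.
  rewrite mulrCA -[leRHS]mulr1 ler_pM2l// ler_pdivrMr// mul1r ler_nat.
  exact: leqnSn.
have [e0' ee] := gt0_injE hK e0.
have [r r0 rH] := H _ e0'.
apply/nbhs_absP => //; exists r => // h; rewrite subr0 => hr.
rewrite ee norm_inj_abs// -(injM hK); apply: (le_trans (norm_le_norm2 hK _)).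
by rewrite le_inj// rH.
Qed.

Lemma is_derive_realP (phi : R -> R) (s D : R) :
  (forall e : R, 0 < e -> exists2 r : R, 0 < r & forall h : R, `|h| < r ->
     `|phi (s + h) - phi s - h * D| <= e * `|h|) -> is_derive s 1 phi D.
Proof.
move=> H; apply/is_derive_incrP => e e0.
have [r r0 rH] := H _ e0; apply/nbhs_ballP; exists r => //= h.
rewrite /ball /= sub0r normrN => /rH.
by rewrite (addrC (h *: 1)) [h *: 1]mulr1.
Qed.

Lemma is_derive_scale_dir f x v (D : V) (a : K) :
  is_derive x v f D -> is_derive x (a *: v) f (a *: D).
Proof.
have [->|a0] := eqVneq a 0.
  move=> _; apply/is_derive_norm2P => e e0; exists 1 => // h _.
  by rewrite !scale0r !scaler0 add0r subrr subr0 (norm2_0 hK) mulr_ge0// ?ltW// (abs_ge0 hK).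
have aa : 0 < abs a by rewrite lt_neqAle eq_sym (abs_eq0 hK) a0 (abs_ge0 hK).
move=> /is_derive_norm2P H; apply/is_derive_norm2P => e e0.
have ea : 0 < e / abs a by rewrite divr_gt0.
have [r r0 rH] := H _ ea; exists (r / abs a); first by rewrite divr_gt0.
move=> h hr; rewrite !scalerA; apply: (le_trans (rH _ _)).
  by rewrite (absM hK) -ltr_pdivlMr.
by rewrite (absM hK) (mulrC (abs h)) mulrA divfK// lt0r_neq0.
Qed.

(** Only real multiples of the direction are used, so that the mean value theorem
  applies to the real and imaginary parts of the components. *)
Lemma mean_value_incr f x v (c : V) (e : R) :
  (forall s : R, 0 <= s <= 1 -> exists2 D, is_derive (x + inj s *: v) v f D &
     norm2 (D - c) <= e) ->
  norm2 (f (x + v) - f x - c) <= d%:R * (2 * e).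
Proof.
move=> H; apply: norm2_le => // j.
have part (p : K -> R) : (forall y z : K, p (y - z) = p y - p z) ->
    (forall (a : R) (y : K), p (inj a * y) = a * p y) ->
    (forall y : K, `|p y| <= abs y) ->
    `|p ((f (x + v) - f x - c) 0 j)| <= e.
  move=> pB pZ pabs.
  have [D HD] : {D : R -> V | forall s, 0 <= s <= 1 ->
      is_derive (x + inj s *: v) v f (D s) /\ norm2 (D s - c) <= e}.
    have ch s : exists D, 0 <= s <= 1 ->
      is_derive (x + inj s *: v) v f D /\ norm2 (D - c) <= e.
      by case: (boolP (0 <= s <= 1)) => [/H[D ? ?]|_]; [exists D|exists 0].
    by exists (fun s => projT1 (cid (ch s))) => s; exact: (projT2 (cid (ch s))).
  pose phi s := p (f (x + inj s *: v) 0 j).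
  have dphi (s : R) : 0 <= s <= 1 -> is_derive s 1 phi (p (D s 0 j)).
    move=> s01; apply: is_derive_realP => eps e0.
    have [/is_derive_norm2P Ds _] := HD s s01.
    have [r r0 rH] := Ds _ e0; exists r => // h hr.
    have ah : abs (inj h : K) = `|h| := abs_inj hK h.
    have := rH (inj h); rewrite ah => /(_ hr).
    apply: le_trans; apply: le_trans (abs_le_norm2 hK _ j).
    rewrite !mxE; apply: le_trans (pabs _).
    rewrite /phi -pZ -!pB le_eqVlt; apply/orP; left; apply/eqP.
    by rewrite (injD hK) scalerDl addrA [_ + (x + _)]addrC.
  have [s s01] : exists2 s, s \in `[(0 : R), 1] & phi 1 - phi 0 = p (D s 0 j) * (1 - 0).
    apply: (@MVT_segment _ phi (fun s => p (D s 0 j))) => //.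
      by move=> s; rewrite in_itv /= => /andP[s0 s1]; apply: dphi; rewrite !ltW.
    apply: derivable_within_continuous => s; rewrite in_itv /= => /dphi[].
    by [].
  rewrite in_itv /= in s01.
  rewrite subr0 mulr1 /phi (inj0 hK) (inj1 hK) scale0r scale1r addr0 => E.
  rewrite !mxE !pB E -pB; apply: (le_trans (pabs _)).
  have [_] := HD s s01; apply: le_trans.
  by have := abs_le_norm2 hK (D s - c) j; rewrite !mxE.
have -> : 2 * e = e + e by ring.
apply: (le_trans (abs_le_re_im hK _)); apply: lerD; apply: part.
- exact: reB.
- by move=> a y; rewrite reM// re_inj// im_inj// mul0r subr0.
- exact: abs_re.
- exact: imB.
- by move=> a y; rewrite imM// re_inj// im_inj// mul0r addr0.
- exact: abs_im.
Qed.

End Derivatives.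

(** * Functions with continuous iterated partial derivatives *)

Section ProductRule.
Context {R : realType} {K : scalar_field R}.
Hypothesis hK : K = real_scalars R \/ K = complex_scalars R.
Context {d : nat}.
Local Notation V := 'rV[K]_d.
Implicit Types (x y z v : V) (f g : V -> V) (i j : 'I_d) (l : seq 'I_d).
Definition cmul j f g : V -> V := fun x => f x 0 j *: g x.

Lemma continuous_norm2P f x : {for x, continuous f} <->
  (forall e : R, 0 < e -> exists2 r : R, 0 < r &
    forall y, norm2 (y - x) < r -> norm2 (f y - f x) < e).
Proof.
split => [H e e0|H P /= /nbhs_norm2P -/(_ hK)[e e0 eP]].
  have /H : nbhs (f x) [set z | norm2 (z - f x) < e].
    by apply/nbhs_norm2P => //; exists e.
  by move=> /nbhs_norm2P -/(_ hK)[r r0 rH]; exists r.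
have [r r0 rH] := H e e0.
by apply/nbhs_norm2P => //; exists r => // y /rH; exact: eP.
Qed.

Lemma is_derive_cmul j f g x v (Df Dg : V) : is_derive x v f Df -> is_derive x v g Dg ->
  is_derive x v (cmul j f g) (Df 0 j *: g x + f x 0 j *: Dg).
Proof.
move=> /is_derive_norm2P -/(_ hK) Hf /is_derive_norm2P -/(_ hK) Hg.
apply/is_derive_norm2P => // e e0.
pose a := norm2 Df + 1; pose b := norm2 (f x) + a.
have a1 : 1 <= a by rewrite /a lerDr norm2_ge0.
have b1 : 1 <= b by rewrite /b; have := norm2_ge0 (f x); lra.
pose c := norm2 (g x) + norm2 Dg + 1.
have c1 : 1 <= c by rewrite /c; have := norm2_ge0 (g x); have := norm2_ge0 Dg; lra.
have e3 : 0 < e / 3 / b by rewrite !divr_gt0//; lra.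
have e4 : 0 < e / 3 / c by rewrite !divr_gt0//; lra.
have [r1 r10 h1] := Hf _ ltr01; have [r2 r20 h2] := Hf _ e4; have [r3 r30 h3] := Hg _ e3.
have r4 : 0 < e / 3 / (a * c) by rewrite !divr_gt0// mulr_gt0//; lra.
exists (Num.min (Num.min 1 r1) (Num.min (Num.min r2 r3) (e / 3 / (a * c)))).
  by rewrite !lt_min ltr01 r10 r20 r30 r4.
move=> h; rewrite !lt_min => /andP[/andP[hr0 /h1 k1] /andP[/andP[/h2 k2 /h3 k3] hr4]].
have h0 := abs_ge0 hK h.
have fh : norm2 (f (h *: v + x) - f x) <= a * abs h.
  have := norm2D hK (f (h *: v + x) - f x - h *: Df) (h *: Df).
  by rewrite subrK norm2Z// /a; lra.
set y := h *: v + x in k1 k2 k3 fh *.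
have -> : cmul j f g y - cmul j f g x - h *: (Df 0 j *: g x + f x 0 j *: Dg) =
    f y 0 j *: (g y - g x - h *: Dg) + (f y - f x - h *: Df) 0 j *: g x
    + (h * (f y - f x) 0 j) *: Dg.
  rewrite /cmul !mxE; apply/rowP => k; rewrite !mxE; ring.
have n1 : abs (f y 0 j) <= b.
  have := abs_le_norm2 hK (f y) j; have := norm2D hK (f y - f x) (f x).
  rewrite subrK /b; have : a * abs h <= a by rewrite ler_piMr//; lra.
  by lra.
have n2 : abs ((f y - f x - h *: Df) 0 j) <= e / 3 / c * abs h.
  exact: le_trans (abs_le_norm2 hK _ j) k2.
have n3 : abs ((f y - f x) 0 j) <= a * abs h.
  exact: le_trans (abs_le_norm2 hK _ j) fh.
apply: (le_trans (norm2D hK _ _)); apply: (le_trans (lerD (norm2D hK _ _) (lexx _))).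
rewrite !(norm2Z hK) (absM hK).
have t1 : abs (f y 0 j) * norm2 (g y - g x - h *: Dg) <= e / 3 * abs h.
  apply: (@le_trans _ _ (b * (e / 3 / b * abs h))).
    by apply: ler_pM; rewrite ?(abs_ge0 hK) ?norm2_ge0.
  by rewrite mulrA mulrCA divff ?mulr1// lt0r_neq0//; lra.
have t2 : abs ((f y - f x - h *: Df) 0 j) * norm2 (g x) <= e / 3 * abs h.
  apply: (@le_trans _ _ ((e / 3 / c * abs h) * c)).
    apply: ler_pM; rewrite ?(abs_ge0 hK) ?norm2_ge0//.
    by rewrite /c; have := norm2_ge0 Dg; lra.
  by rewrite mulrAC divfK// lt0r_neq0//; lra.
have t3 : abs h * abs ((f y - f x) 0 j) * norm2 Dg <= e / 3 * abs h.
  apply: (@le_trans _ _ (abs h * (a * abs h) * c)).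
    apply: ler_pM; [by rewrite mulr_ge0 ?(abs_ge0 hK)|exact: norm2_ge0| |].
      by apply: ler_wpM2l.
    by rewrite /c; have := norm2_ge0 (g x); lra.
  move: hr4; rewrite ltr_pdivlMr; last by rewrite mulr_gt0//; lra.
  move=> /ltW; rewrite -subr_ge0 => /(mulr_ge0 h0); rewrite -(subr_ge0 (_ * c)).
  by congr (0 <= _); ring.
lra.
Qed.

End ProductRule.

Arguments C_on {R K d} k U f : simpl never.

Section Smooth.
Context {R : realType} {K : scalar_field R}.
Hypothesis hK : K = real_scalars R \/ K = complex_scalars R.
Context {d : nat}.
Local Notation V := 'rV[K]_d.
Implicit Types (x y z v : V) (f g : V -> V) (i j : 'I_d) (l : seq 'I_d).
Context {U : set V}.
Hypothesis oU : open U.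

(** The indices are listed in the order of differentiation instead of being counted, as
  the derivatives of a bracket come in any order. *)
Definition pd l f : V -> V := foldl (fun g i => pderive i g) f l.

Lemma is_derive_eq_on f g x v (D : V) : U x -> (forall y, U y -> f y = g y) ->
  is_derive x v f D -> is_derive x v g D.
Proof.
move=> Ux fg; apply: near_eq_is_derive.
by apply: filterS (open_nbhs_nbhs (conj oU Ux)) => y Uy; exact: fg.
Qed.

Lemma pderive_eq_on j f g x : U x -> (forall y, U y -> f y = g y) ->
  pderive j f x = pderive j g x.
Proof.
move=> Ux fg; apply: near_eq_derive.
by apply: filterS (open_nbhs_nbhs (conj oU Ux)) => y Uy; exact: fg.
Qed.

Lemma pd_eq_on l f g x : U x -> (forall y, U y -> f y = g y) ->
  pd l f x = pd l g x.
Proof.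
move=> Ux; elim: l f g => [|i l IH] f g fg /=; first exact: fg.
by apply: IH => y Uy; apply: pderive_eq_on.
Qed.

Lemma C_on_continuous k f x : C_on k U f -> U x -> {for x, continuous f}.
Proof. by case: k => [|k] [H _] Ux; apply: H; rewrite inE. Qed.

Lemma C_on_derive k f j x : C_on k.+1 U f -> U x ->
  is_derive x (delta_mx 0 j) f (pderive j f x).
Proof. by move=> [_ /(_ j)[H _]] Ux; apply: derivableP; exact: H. Qed.

Lemma C_on_pderive k f j : C_on k.+1 U f -> C_on k U (pderive j f).
Proof. by move=> [_ /(_ j)[]]. Qed.

Lemma C_on_eq_on k f g : (forall y, U y -> f y = g y) -> C_on k U f -> C_on k U g.
Proof.
elim: k f g => [|k IH] f g fg fC; (split; [move=> x; rewrite inE => Ux|]).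
- have /(continuous_norm2P hK) H := C_on_continuous fC Ux; apply/(continuous_norm2P hK) => e e0.
  have [r r0 rH] := H e e0; have /nbhs_norm2P -/(_ hK)[r' r'0 rU] := open_nbhs_nbhs (conj oU Ux).
  exists (Num.min r r'); first by rewrite lt_min r0 r'0.
  by move=> y; rewrite lt_min => /andP[yr /rU Uy]; rewrite -!fg//; exact: rH.
- by [].
- have /(continuous_norm2P hK) H := C_on_continuous fC Ux; apply/(continuous_norm2P hK) => e e0.
  have [r r0 rH] := H e e0; have /nbhs_norm2P -/(_ hK)[r' r'0 rU] := open_nbhs_nbhs (conj oU Ux).
  exists (Num.min r r'); first by rewrite lt_min r0 r'0.
  by move=> y; rewrite lt_min => /andP[yr /rU Uy]; rewrite -!fg//; exact: rH.
- move=> j; split => [x Ux|].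
    by have [] := is_derive_eq_on Ux fg (C_on_derive j fC Ux).
  apply: IH (C_on_pderive j fC) => y Uy; exact: pderive_eq_on.
Qed.

Lemma C_onS k f : C_on k.+1 U f -> C_on k U f.
Proof.
elim: k f => [|k IH] f fC.
  by split => // x; rewrite inE => Ux; exact: C_on_continuous fC Ux.
split => [x|j]; first by rewrite inE => Ux; exact: C_on_continuous fC Ux.
split => [x Ux|]; first by have [] := C_on_derive j fC Ux.
by apply: IH; exact: C_on_pderive fC.
Qed.

Lemma C_on_le k k' f : (k' <= k)%N -> C_on k U f -> C_on k' U f.
Proof.
move=> /subnK <-; elim: (k - k')%N => // n IH; rewrite addSn => /C_onS; exact: IH.
Qed.

Lemma C_on_sub k f g : C_on k U f -> C_on k U g -> C_on k U (f - g).
Proof.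
elim: k f g => [|k IH] f g fC gC; (split; [move=> x; rewrite inE => Ux|]).
- exact: continuousB (C_on_continuous fC Ux) (C_on_continuous gC Ux).
- by [].
- exact: continuousB (C_on_continuous fC Ux) (C_on_continuous gC Ux).
- move=> j; have D x : U x -> is_derive x (delta_mx 0 j) (f - g) (pderive j f x - pderive j g x).
    by move=> Ux; apply: is_deriveB; [exact: C_on_derive fC Ux|exact: C_on_derive gC Ux].
  split => [x /D[]//|].
  apply: C_on_eq_on (IH _ _ (C_on_pderive j fC) (C_on_pderive j gC)) => y /D Dy.
  by rewrite /pderive (@derive_val _ _ _ _ _ _ _ Dy).
Qed.

Lemma pderive_sub k j f g x : C_on k.+1 U f -> C_on k.+1 U g -> U x ->
  pderive j (f - g) x = pderive j f x - pderive j g x.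
Proof.
move=> fC gC Ux.
by have D := is_deriveB (C_on_derive j fC Ux) (C_on_derive j gC Ux); exact: derive_val.
Qed.

Lemma C_on_cst k (c : V) : C_on k U (cst c).
Proof.
elim: k c => [|k IH] c; (split; [by move=> x _; exact: cst_continuous|]); first by [].
move=> j; split => [x Ux|]; first exact: ex_derive.
by apply: C_on_eq_on (IH 0) => y _; rewrite /pderive derive_cst.
Qed.

Lemma C_on_add k f g : C_on k U f -> C_on k U g -> C_on k U (f + g).
Proof.
move=> fC gC; rewrite -[g]opprK; apply: C_on_sub => //.
rewrite -sub0r; apply: C_on_sub => //; exact: (C_on_cst k 0).
Qed.

Lemma pderive_cmul k i j f g x : C_on k.+1 U f -> C_on k.+1 U g -> U x ->
  pderive i (cmul j f g) x = (cmul j (pderive i f) g + cmul j f (pderive i g)) x.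
Proof.
move=> fC gC Ux.
by have D := is_derive_cmul hK j (C_on_derive i fC Ux) (C_on_derive i gC Ux); exact: derive_val.
Qed.

Lemma C_on_cmul k j f g : C_on k U f -> C_on k U g -> C_on k U (cmul j f g).
Proof.
elim: k f g => [|k IH] f g fC gC.
  split => // x; rewrite inE => Ux.
  have /(continuous_norm2P hK) Hf := C_on_continuous fC Ux.
  have /(continuous_norm2P hK) Hg := C_on_continuous gC Ux.
  apply/(continuous_norm2P hK) => e e0.
  pose a := norm2 (f x) + norm2 (g x) + 1.
  have a0 : 0 < a by rewrite /a; have := norm2_ge0 (f x); have := norm2_ge0 (g x); lra.
  have e3 : 0 < e / (2 * a) by rewrite divr_gt0// mulr_gt0.
  have [r1 r10 h1] := Hf _ e3; have [r2 r20 h2] := Hg _ e3; have [r3 r30 h3] := Hf _ ltr01.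
  exists (Num.min r1 (Num.min r2 r3)); first by rewrite !lt_min r10 r20.
  move=> y; rewrite !lt_min => /and3P[/h1 k1 /h2 k2 /h3 k3].
  have -> : cmul j f g y - cmul j f g x = f y 0 j *: (g y - g x) + (f y - f x) 0 j *: g x.
    by rewrite /cmul !mxE; apply/rowP => k; rewrite !mxE; ring.
  apply: (le_lt_trans (norm2D hK _ _)); rewrite !(norm2Z hK).
  have n1 : abs (f y 0 j) <= a.
    have := abs_le_norm2 hK (f y) j; have := norm2D hK (f y - f x) (f x).
    by rewrite subrK /a; have := norm2_ge0 (g x); lra.
  have n2 := abs_le_norm2 hK (f y - f x) j.
  have ga : norm2 (g x) < a by rewrite /a; have := norm2_ge0 (f x); lra.
  have ee : e = a * (e / (2 * a)) + (e / (2 * a)) * a by field; exact: lt0r_neq0.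
  rewrite [X in _ < X]ee; apply: ler_ltD.
    by apply: ler_pM; [exact: abs_ge0|exact: norm2_ge0|exact: n1|exact: ltW].
  apply: (@le_lt_trans _ _ (norm2 (f y - f x) * a)).
    by apply: ler_pM; [exact: abs_ge0|exact: norm2_ge0|exact: n2|exact: ltW].
  by rewrite ltr_pM2r.
split => [x|i].
  by rewrite inE => Ux; apply: (@C_on_continuous 0 _ _ _ Ux); apply: (C_on_le (leq0n k));
    apply: IH; exact: C_onS.
split => [x Ux|].
  by have [] := is_derive_cmul hK j (C_on_derive i fC Ux) (C_on_derive i gC Ux).
apply: (@C_on_eq_on _ (cmul j (pderive i f) g + cmul j f (pderive i g))).
  by move=> y Uy; rewrite (pderive_cmul _ _ fC gC).
by apply: C_on_add; apply: IH; rewrite ?(C_onS fC) ?(C_onS gC)//;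
  [exact: C_on_pderive fC|exact: C_onS|exact: C_onS|exact: C_on_pderive gC].
Qed.

End Smooth.

Opaque C_on.

(** * Differentials, the symmetry of partial derivatives, Taylor estimates *)

Section Differential.
Context {R : realType} {K : scalar_field R}.
Hypothesis hK : K = real_scalars R \/ K = complex_scalars R.
Context {d : nat}.
Local Notation V := 'rV[K]_d.
Implicit Types (x y z v : V) (f g : V -> V) (i j : 'I_d) (l : seq 'I_d).
Context {U : set V}.
Hypothesis oU : open U.

Lemma norm2_mono x y : (forall j, abs (x 0 j) <= abs (y 0 j)) -> norm2 x <= norm2 y.
Proof.
move=> h; rewrite /norm2 ler_wsqrtr//; apply: ler_sum => j _.
by rewrite ler_pXn2r// ?nnegrE (abs_ge0 hK).
Qed.

Lemma pderive_near f x (e : R) : C_on 1 U f -> U x -> 0 < e -> exists2 r : R, 0 < r &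
  forall y, norm2 (y - x) < r -> U y /\ forall j, norm2 (pderive j f y - pderive j f x) <= e.
Proof.
move=> fC Ux e0.
have : \forall y \near x, U y /\ forall j, norm2 (pderive j f y - pderive j f x) <= e.
  apply: filter_app (open_nbhs_nbhs (conj oU Ux)).
  have near1 j : \forall y \near x, norm2 (pderive j f y - pderive j f x) <= e.
    have /(continuous_norm2P hK) H := C_on_continuous (C_on_pderive j fC) Ux.
    have [r r0 rH] := H e e0; apply/nbhs_norm2P => //; exists r => // y /rH; exact: ltW.
  by apply: filterS (@filter_forall _ _ _ _ (nbhs_filter x) near1) => y ? ?; split.
by move=> /nbhs_norm2P -/(_ hK).
Qed.

Definition jac f x v : V := \sum_j v 0 j *: pderive j f x.

Lemma jac_is_linear f x : linear (jac f x).
Proof.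
move=> a u v; rewrite /jac scaler_sumr -big_split; apply: eq_bigr => j _ /=.
by rewrite !mxE scalerDl scalerA.
Qed.

HB.instance Definition _ f x := GRing.isLinear.Build K V V _ (jac f x) (jac_is_linear f x).

(** The increment is cut into increments along the axes, which the mean value
  inequality handles one by one. *)
Lemma frechet f x (e : R) : C_on 1 U f -> U x -> 0 < e -> exists2 r : R, 0 < r &
  forall v, norm2 v < r -> norm2 (f (x + v) - f x - jac f x v) <= e * norm2 v.
Proof.
move=> fC Ux e0.
pose c : R := (d * d * 2).+1%:R; have c0 : 0 < c by rewrite ltr0n.
have [r r0 rH] := pderive_near fC Ux (divr_gt0 e0 c0).
exists r => // v vr.
pose w (m : nat) : V := \row_j (if (j < m)%N then v 0 j else 0).
have w0 : w 0%N = 0 by apply/rowP => j; rewrite !mxE.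
have wd : w d = v by apply/rowP => j; rewrite !mxE ltn_ord.
have wS (m : 'I_d) : w m.+1 = w m + v 0 m *: delta_mx 0 m.
  apply/rowP => j; rewrite !mxE eqxx /= ltnS leq_eqVlt -val_eqE.
  by case: eqVneq => [/val_inj ->|_] /=; rewrite ?ltnn ?add0r ?mulr1// mulr0 addr0.
have -> : f (x + v) - f x - jac f x v =
    \sum_(m < d) (f (x + w m.+1) - f (x + w m) - v 0 m *: pderive m f x).
  rewrite sumrB -(big_mkord xpredT (fun m => f (x + w m.+1) - f (x + w m))).
  by rewrite telescope_sumr// wd w0 addr0.
apply: (le_trans (norm2_sum hK _ _ _)).
apply: (@le_trans _ _ (\sum_(m < d) d%:R * (2 * (e / c * norm2 v)))).
  apply: ler_sum => m _; rewrite wS addrA.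
  apply: mean_value_incr => // s s01.
  have [Uy Hy] : U (x + w m + inj s *: (v 0 m *: 'e_m)) /\ forall j,
      norm2 (pderive j f (x + w m + inj s *: (v 0 m *: 'e_m)) - pderive j f x) <= e / c.
    apply: rH; apply: le_lt_trans vr; rewrite addrC !addrA addNr add0r.
    apply: norm2_mono => j; rewrite !mxE eqxx /= -val_eqE.
    case: ltngtP => jm /=; rewrite ?(mulr0, addr0, add0r, (abs0 hK), (abs_ge0 hK))//.
    rewrite mulr1 (absM hK) (abs_inj hK) (val_inj jm).
    by case/andP: s01 => s0 s1; rewrite ger0_norm// ler_piMl// (abs_ge0 hK).
  exists (v 0 m *: pderive m f (x + w m + inj s *: (v 0 m *: 'e_m))).
    apply: is_derive_scale_dir => //; exact: C_on_derive fC Uy.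
  rewrite -scalerBr (norm2Z hK) mulrC; apply: ler_pM; rewrite ?norm2_ge0 ?(abs_ge0 hK)//.
  exact: abs_le_norm2.
rewrite sumr_const card_ord -[_ *+ d]mulr_natl.
have -> : d%:R * (d%:R * (2 * (e / c * norm2 v))) = (d * d * 2)%:R / c * (e * norm2 v).
  by rewrite !natrM; ring.
rewrite ler_piMl ?mulr_ge0 ?norm2_ge0 ?(ltW e0)//.
by rewrite ler_pdivrMr// mul1r /c ler_nat.
Qed.

Lemma is_derive_jac f x v : C_on 1 U f -> U x -> is_derive x v f (jac f x v).
Proof.
move=> fC Ux; apply/(is_derive_norm2P hK) => e e0.
have nv : 0 < norm2 v + 1 by have := norm2_ge0 v; lra.
have [r r0 rH] := frechet fC Ux (divr_gt0 e0 nv).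
exists (r / (norm2 v + 1)); first by rewrite divr_gt0.
move=> h; rewrite ltr_pdivlMr// => hr.
have hv : norm2 (h *: v) <= abs h * (norm2 v + 1).
  by rewrite (norm2Z hK) ler_wpM2l ?(abs_ge0 hK)// lerDl.
have := rH (h *: v) (le_lt_trans hv hr).
rewrite (addrC x) [jac f x (h *: v)]linearZ /= => H; apply: (le_trans H).
apply: (@le_trans _ _ (e / (norm2 v + 1) * (abs h * (norm2 v + 1)))).
  by apply: ler_wpM2l hv; rewrite ltW// divr_gt0.
by rewrite [abs h * _]mulrC mulrA divfK// lt0r_neq0.
Qed.

Lemma jac_continuous f x : continuous (jac f x).
Proof.
move=> v; apply/(continuous_norm2P hK) => e e0.
pose c := \sum_j norm2 (pderive j f x).
have c1 : 0 < c + 1 by rewrite ltr_wpDl// sumr_ge0// => j _; exact: norm2_ge0.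
exists (e / (c + 1)); first by rewrite divr_gt0.
move=> y; rewrite ltr_pdivlMr// => yv; rewrite -linearB /=.
apply: le_lt_trans yv; apply: (le_trans (norm2_sum hK _ _ _)).
apply: (@le_trans _ _ (\sum_j norm2 (y - v) * norm2 (pderive j f x))).
  apply: ler_sum => j _; rewrite (norm2Z hK) ler_wpM2r ?norm2_ge0//.
  exact: abs_le_norm2.
by rewrite -mulr_sumr ler_wpM2l ?norm2_ge0// lerDl.
Qed.

Lemma diff_jac f x v : C_on 1 U f -> U x -> 'd f x v = jac f x v.
Proof.
move=> fC Ux; rewrite (@diff_unique _ _ _ f (jac f x) x)//; first exact: jac_continuous.
apply/eqaddoP => e e0.
have [e0' ee] := gt0_injE hK e0.
have c0 : 0 < d%:R + 1 :> R by rewrite natr1 ltr0n.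
have [r r0 rH] := frechet fC Ux (divr_gt0 e0' c0).
apply/(nbhs_norm2P hK); exists r => // y; rewrite subr0 => /rH H.
have -> : (f \o shift x - (cst (f x) + jac f x)) y = f (x + y) - f x - jac f x y.
  by rewrite !fctE /= opprD addrA (addrC y).
apply: (le_trans (norm_le_norm2 hK _)).
have H1 : inj (norm2 (f (x + y) - f x - jac f x y)) <= inj (re e / (d%:R + 1) * norm2 y) :> K.
  by rewrite le_inj.
apply: (le_trans H1).
have c1 : 0 <= inj (re e / (d%:R + 1)) :> K.
  by rewrite -(inj0 hK) le_inj// divr_ge0// ltW.
rewrite (injM hK); apply: (le_trans (ler_wpM2l c1 (norm2_le_norm hK _))).
rewrite mulrA; apply: ler_wpM2r; first exact: normr_ge0.
rewrite {2}ee -(injM hK) le_inj// -mulrA ler_piMr// ?(ltW e0')//.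
by rewrite mulrC ler_pdivrMr// mul1r lerDl.
Qed.

(** Both iterated derivatives are limits of one second difference of [f] on a small
  square. *)
Lemma pderive_sym f i j x : C_on 2 U f -> U x ->
  pderive i (pderive j f) x = pderive j (pderive i f) x.
Proof.
move=> fC Ux.
pose D (y w w' : V) := f (y + w + w') - f (y + w) - (f (y + w') - f y).
have key a b (e : R) : 0 < e -> exists2 r : R, 0 < r & forall h : R, 0 < h -> h < r ->
  norm2 (D x (inj h *: 'e_a) (inj h *: 'e_b) -
    (inj h * inj h) *: pderive b (pderive a f) x) <= d%:R * (2 * (d%:R * (2 * (h * (h * e))))).
  move=> e0.
  have [r r0 rH] := pderive_near (C_on_pderive a fC) Ux e0.
  exists (r / 2); first by rewrite divr_gt0.
  move=> h h0 hr.
  have small (s t : R) : 0 <= s <= 1 -> 0 <= t <= 1 ->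
      norm2 (x + inj s *: (inj h *: 'e_a) + inj t *: (inj h *: 'e_b) - x : V) < r.
    move=> /andP[s0 s1] /andP[t0 t1].
    rewrite addrC !addrA addNr add0r.
    apply: (le_lt_trans (norm2D hK _ _)).
    have e1 c : norm2 ('e_c : V) <= 1.
      rewrite /norm2 (bigD1 c)//= big1 => [|k kc]; last first.
        by rewrite mxE (negbTE kc) andbF (abs0 hK) expr0n.
      by rewrite mxE !eqxx (abs1 hK) expr1n addr0 sqrtr1.
    have bd (s' : R) c : 0 <= s' -> s' <= 1 -> norm2 (inj s' *: (inj h *: 'e_c : V)) <= h.
      move=> s'0 s'1; rewrite !(norm2Z hK) !(abs_inj hK) !ger0_norm ?(ltW h0)//.
      rewrite -[leRHS]mul1r; apply: ler_pM => //.
        by rewrite mulr_ge0 ?norm2_ge0// ltW.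
      by rewrite -[leRHS]mulr1; apply: ler_wpM2l (e1 c); exact: ltW.
    have := bd s a s0 s1; have := bd t b t0 t1; lra.
  pose g y := f (y + inj h *: 'e_b) - f y.
  have -> : D x (inj h *: 'e_a) (inj h *: 'e_b) = g (x + inj h *: 'e_a) - g x by [].
  apply: mean_value_incr => // s s01.
  have [U0 _] := rH _ (small s 0 s01 (introT andP (conj (lexx _) ler01))).
  have [U1 _] := rH _ (small s 1 s01 (introT andP (conj ler01 (lexx _)))).
  rewrite (inj0 hK) scale0r addr0 in U0; rewrite (inj1 hK) scale1r in U1.
  set y := x + inj s *: (inj h *: 'e_a) in U0 U1 *.
  exists (inj h *: (pderive a f (y + inj h *: 'e_b) - pderive a f y)).
    apply: is_derive_scale_dir => //.
    apply: is_deriveB; last exact: C_on_derive fC U0.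
    have /(is_derive_norm2P hK) H := C_on_derive a fC U1.
    apply/(is_derive_norm2P hK) => eps eps0; have [r' r'0 r'H] := H _ eps0.
    by exists r' => // k /r'H; rewrite !addrA.
  rewrite -scalerA -scalerBr (norm2Z hK) (abs_inj hK) (gtr0_norm h0).
  have -> : d%:R * (2 * (h * (h * e))) = h * (d%:R * (2 * (h * e))) by ring.
  rewrite ler_pM2l//; apply: mean_value_incr => // t t01.
  have [Ut Ht] := rH _ (small s t s01 t01).
  exists (inj h *: pderive b (pderive a f) (y + inj t *: (inj h *: 'e_b))).
    apply: is_derive_scale_dir => //; exact: C_on_derive (C_on_pderive a fC) Ut.
  rewrite -scalerBr (norm2Z hK) (abs_inj hK) (gtr0_norm h0) ler_pM2l//.
apply/eqP; rewrite -subr_eq0; apply/eqP; apply: norm2_le0 => //.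
apply/ler_addgt0Pr => eps eps0; rewrite add0r.
pose c : R := (d * d * 8).+1%:R; have c0 : 0 < c by rewrite ltr0n.
have [r1 r10 H1] := key i j _ (divr_gt0 eps0 c0).
have [r2 r20 H2] := key j i _ (divr_gt0 eps0 c0).
pose h := Num.min r1 r2 / 2.
have m0 : 0 < Num.min r1 r2 by rewrite lt_min r10.
have h0 : 0 < h by rewrite divr_gt0.
have hm : h < Num.min r1 r2 by rewrite /h ltr_pdivrMr// mulr_natr mulr2n ltrDl.
have := hm; rewrite lt_min => /andP[hr1 hr2].
have Ds : D x (inj h *: 'e_i) (inj h *: 'e_j) = D x (inj h *: 'e_j) (inj h *: 'e_i).
  by rewrite /D [x + _ + _ in RHS]addrAC; apply/rowP => k; rewrite !mxE; ring.
move: (H1 h h0 hr1) (H2 h h0 hr2); rewrite Ds.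
move: (D _ _ _) (pderive i _ _) (pderive j _ _) => X A B k1 k2.
have hh : 0 < h * h by rewrite mulr_gt0.
rewrite -(ler_pM2l hh).
have <- : norm2 ((X - (inj h * inj h) *: B) - (X - (inj h * inj h) *: A)) = h * h * norm2 (A - B).
  rewrite (_ : _ - _ = (inj h * inj h) *: (A - B)).
    by rewrite (norm2Z hK) (absM hK) (abs_inj hK) (gtr0_norm h0).
  by apply/rowP => k; rewrite !mxE; ring.
apply: (le_trans (norm2B hK _ _)); apply: (le_trans (lerD k1 k2)).
have -> : d%:R * (2 * (d%:R * (2 * (h * (h * (eps / c)))))) +
    d%:R * (2 * (d%:R * (2 * (h * (h * (eps / c)))))) = (d * d * 8)%:R / c * (h * h * eps).
  by rewrite !natrM; ring.
rewrite ler_piMl//; first by rewrite ltW// mulr_gt0.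
by rewrite ler_pdivrMr// mul1r /c ler_nat.
Qed.

End Differential.

(** * Iterated partial derivatives are bounded by the norms *)

Section PermutedDerivatives.
Context {R : realType} {K : scalar_field R}.
Hypothesis hK : K = real_scalars R \/ K = complex_scalars R.
Context {d : nat}.
Local Notation V := 'rV[K]_d.
Implicit Types (x y z v : V) (f g : V -> V) (i j : 'I_d) (l : seq 'I_d).

Lemma term_le_sum (J : finType) (P : pred J) (F : J -> R) (i : J) :
  (forall j : J, P j -> 0 <= F j) -> P i -> F i <= \sum_(j | P j) F j.
Proof.
by move=> F0 Pi; rewrite (bigD1 i)//= lerDl sumr_ge0// => j /andP[/F0].
Qed.

Section OpenSet.
Context {U : set V}.
Hypothesis oU : open U.

Lemma pd_cat l l' f : pd (l ++ l') f = pd l' (pd l f).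
Proof. by rewrite /pd foldl_cat. Qed.

Lemma C_on_pd k l f : C_on (size l + k) U f -> C_on k U (pd l f).
Proof.
by elim: l f => [//|i l IH] f fC; apply: (IH (pderive i f)); exact: C_on_pderive fC.
Qed.

Lemma pd_move i l l' f x : C_on (size l).+1 U f -> U x ->
  pd (l ++ i :: l') f x = pd (i :: l ++ l') f x.
Proof.
elim: l f x => [//|a l IH] f x fC Ux.
rewrite cat_cons [LHS]/= (IH _ _ (C_on_pderive a fC) Ux) /=.
have fC2 : C_on 2 U f by apply: (@C_on_le _ _ _ _ (size (a :: l)).+1) fC.
apply: (pd_eq_on oU _ Ux) => y Uy; exact: (pderive_sym hK oU i a fC2 Uy).
Qed.

Lemma pd_perm l l' f x : C_on (size l) U f -> U x -> perm_eq l l' ->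
  pd l f x = pd l' f x.
Proof.
elim: l l' f x => [|i l IH] l' f x fC Ux ll'.
  by rewrite perm_sym in ll'; rewrite (perm_nilP ll').
have il' : i \in l' by rewrite -(perm_mem ll') mem_head.
case/path.splitPr: il' ll' => l1 l2 ll'.
have pl : perm_eq l (l1 ++ l2).
  by rewrite -(perm_cons i) (permPl ll') -cat1s perm_catCA.
rewrite pd_move//=; first by apply: IH => //; exact: C_on_pderive fC.
apply: C_on_le fC; rewrite /= ltnS (perm_size pl) size_cat; exact: leq_addr.
Qed.

End OpenSet.

Lemma re_im_abs_sub (a b a' b' : R) :
  abs (re_im K a b - re_im K a' b') <= `|a - a'| + `|b - b'|.
Proof.
apply: (le_trans (abs_le_re_im hK _)); rewrite reB// imB//.
by case: hK => -> /=; rewrite ?subrr ?normr0 ?addr0 ?lerDl.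
Qed.

Lemma closed_cball rho : closed (cball rho : set V).
Proof.
have -> : cball rho = norm2 @^-1` [set r | r <= rho] :> set V by [].
apply: preimage_closed; last exact: closed_le.
move=> x _ P /nbhs_ballP[e e0 eP]; apply/(nbhs_norm2P hK); exists e => // y yx.
apply: eP; rewrite /ball /= ltr_norml.
have := norm2D hK (y - x) x; have := norm2D hK (x - y) y; rewrite !subrK norm2_distC//.
by move: yx; lra.
Qed.

(** The ball is a closed subset of the image of a real box. *)
Lemma compact_cball rho : compact (cball rho : set V).
Proof.
pose psi (w : 'rV[R]_(d + d)) : V :=
  \row_j re_im K (w 0 (lshift d j)) (w 0 (rshift d j)).
pose box := [set w : 'rV[R]_(d + d) | forall i : 'I_(d + d), w ord0 i \in `[- rho, rho]].
have cbox : compact box.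
  apply: (@rV_compact _  _ (fun=> `[- rho, rho]%classic)) => k; exact: segment_compact.
have cpsi : continuous psi.
  move=> w P /nbhs_ballP[e e0 eP].
  have [e0' ee] := gt0_injE hK e0.
  apply/nbhs_ballP; exists (re e / 2); first by rewrite /= divr_gt0.
  move=> w' [_ ww']; apply: eP; split=> // i j; rewrite (ord1 i) /ball /= !mxE.
  rewrite ee norm_inj_abs// lt_inj//; apply: (le_lt_trans (re_im_abs_sub _ _ _ _)).
  rewrite (splitr (re e)); apply: ltrD; exact: ww'.
apply: (@subclosed_compact _ _ (psi @` box)); first exact: closed_cball.
  apply: continuous_compact => //; exact: continuous_subspaceT.
move=> x xr; exists (row_mx (map_mx re x) (map_mx im x)).
  move=> k; rewrite mxE in_itv /= -ler_norml.
  by case: (fintype.split k) => j; rewrite mxE; [apply: (le_trans (abs_re hK _))|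
    apply: (le_trans (abs_im hK _))]; apply: (le_trans (abs_le_norm2 hK _ _)).
by apply/rowP => j; rewrite mxE row_mxEl row_mxEr !mxE; exact: re_im_eta.
Qed.

Lemma bounded_on_cball f rho : (forall x, cball rho x -> {for x, continuous f}) ->
  exists c : R, forall x, cball rho x -> norm2 (f x) <= c.
Proof.
move=> fc.
have : compact ((norm2 \o f) @` (cball rho : set V)).
  apply: continuous_compact; last exact: compact_cball.
  apply: continuous_in_subspaceT => x; rewrite inE => /fc /(continuous_norm2P hK) H.
  move=> P /nbhs_ballP[e e0 eP]; have [r r0 rH] := H e e0.
  apply/(nbhs_norm2P hK); exists r => // y /rH yx; apply: eP; rewrite /ball /= ltr_norml.
  have := norm2D hK (f y - f x) (f x); have := norm2D hK (f x - f y) (f y).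
  by rewrite !subrK (norm2_distC hK (f x)); move: yx; lra.
move=> /compact_bounded [M [_ HM]]; exists (M + 1) => x xr.
apply: le_trans (ler_norm _) _; apply: (HM (M + 1)); first by rewrite ltrDl.
by exists x.
Qed.

Definition indices (alpha : 'I_d -> nat) : seq 'I_d :=
  foldr (fun j s => s ++ nseq (alpha j) j) [::] (enum 'I_d).

Lemma mderive_pd alpha f : mderive alpha f = pd (indices alpha) f.
Proof.
rewrite /mderive /indices; elim: (enum _) => //= j s ->.
rewrite pd_cat; elim: (alpha j) (pd _ f) => //= n IH g.
by rewrite -IH -iterS iterSr.
Qed.

Lemma count_indices alpha i : count_mem i (indices alpha) = alpha i.
Proof.
rewrite /indices.
have -> (s : seq 'I_d) : count_mem i (foldr (fun j s' => s' ++ nseq (alpha j) j) [::] s)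
    = (count_mem i s * alpha i)%N.
  elim: s => //= j s IH; rewrite count_cat IH count_nseq /= addnC mulnDl.
  by case: eqVneq => [->|_].
by rewrite count_uniq_mem ?enum_uniq// mem_enum inE mul1n.
Qed.

Lemma has_sup_mderive k rho f j alpha : 0 <= rho -> C_ball k rho f ->
  (size (indices alpha) <= k)%N ->
  has_sup [set abs (mderive alpha f x 0 j) | x in cball rho].
Proof.
move=> rho0 [U [oU BU fC]] sk; split.
  by exists (abs (mderive alpha f 0 0 j)), 0 => //; rewrite /cball /= (norm2_0 hK).
have [c Hc] : exists c : R, forall x, cball rho x -> norm2 (mderive alpha f x) <= c.
  apply: bounded_on_cball => x xr; rewrite mderive_pd.
  apply: (C_on_continuous (k := 0) (U := U)); last exact: BU.
  by apply: C_on_pd; rewrite addn0; apply: C_on_le fC.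
by exists c => _ [x xr <-]; exact: le_trans (abs_le_norm2 hK _ _) (Hc x xr).
Qed.

(** By the symmetry of the derivatives, those along [l] are among the terms of the norm;
  the weight of a term is at least [(k!)^-d]. *)
Lemma pd_le_normCk k k' rho f l x : 0 <= rho -> (k <= k')%N -> C_ball k' rho f ->
  (size l <= k)%N -> cball rho x ->
  norm2 (pd l f x) <= d%:R * ((k`! ^ d)%:R * normCk k rho f).
Proof.
move=> rho0 kk' fC lk xr; apply: norm2_le => // j.
have cl i : (count_mem i l < k.+1)%N by rewrite ltnS; apply: leq_trans (count_size _ _) lk.
pose al : {ffun 'I_d -> 'I_k.+1} := [ffun i => Ordinal (cl i)].
have pl : perm_eq l (indices (fun i => al i)).
  by apply/allP => i _; apply/eqP; rewrite count_indices ffunE.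
have sal (be : {ffun 'I_d -> 'I_k.+1}) :
    size (indices (fun i => be i)) = (\sum_i be i)%N.
  rewrite -[RHS](eq_bigr _ (fun i _ => count_indices (fun i => be i) i)).
  elim: (indices _) => [|a s IH] /=; first by rewrite big1.
  rewrite big_split /= -IH (bigD1 a)//= eqxx big1 ?addn0// => b ba.
  by rewrite eq_sym (negbTE ba).
have fCk : C_ball k rho f.
  by case: fC => U [oU BU fC]; exists U; split=> //; exact: C_on_le fC.
have sle (be : {ffun 'I_d -> 'I_k.+1}) i : (\sum_i be i <= k)%N ->
    0 <= sup [set abs (mderive (fun i => be i) f y 0 i) | y in cball rho].
  move=> bk; have hs : has_sup [set abs (mderive (fun i => be i) f y 0 i) | y in cball rho].
    by apply: (@has_sup_mderive k) => //; rewrite sal.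
  apply: le_trans (_ : abs (mderive (fun i => be i) f 0 0 i) <= _).
    exact: abs_ge0.
  apply: ub_le_sup; first by case: hs.
  by exists 0 => //; rewrite /cball /= (norm2_0 hK).
have [U [oU BU fCU]] := fC.
rewrite (pd_perm oU (C_on_le (leq_trans lk kk') fCU) (BU _ xr) pl) -mderive_pd.
have alk : (\sum_i al i <= k)%N by rewrite -sal -(perm_size pl).
set S := [set abs (mderive (fun i => al i) f y 0 j) | y in cball rho].
have s1 : abs (mderive (fun i => al i) f x 0 j) <= sup S.
  have hs : has_sup S by apply: (@has_sup_mderive k) => //; rewrite sal.
  by apply: ub_le_sup; [case: hs|exists x].
have s2 : (\prod_i (al i)`!)%:R^-1 * sup S <= normCk k rho f.
  rewrite /normCk; apply: le_trans (term_le_sum (i := j) _ _) => //.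
    by apply: (term_le_sum (i := al)) => // be bk; rewrite mulr_ge0 ?sle.
  by move=> i _; apply: sumr_ge0 => be bk; rewrite mulr_ge0 ?sle.
have p0 : (0 < \prod_i (al i)`!)%N by apply: prodn_gt0 => i; exact: fact_gt0.
apply: (le_trans s1); rewrite ler_pdivrMl ?ltr0n// in s2.
apply: (le_trans s2); apply: ler_wpM2r.
  apply: sumr_ge0 => i _; apply: sumr_ge0 => be bk; rewrite mulr_ge0 ?sle//.
rewrite ler_nat; have -> : (k`! ^ d = \prod_(i < d) k`!)%N by rewrite prod_nat_const card_ord.
apply: leq_prod => i _; apply: leq_fact; rewrite -ltnS; exact: ltn_ord.
Qed.

End PermutedDerivatives.

(** * Iterated Lie brackets of vector fields *)

Section LieBrackets.
Context {R : realType} {K : scalar_field R}.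
Hypothesis hK : K = real_scalars R \/ K = complex_scalars R.
Context {d : nat}.
Local Notation V := 'rV[K]_d.
Implicit Types (x y z v : V) (f g : V -> V) (i j : 'I_d) (l : seq 'I_d).
Context {U : set V}.
Hypothesis oU : open U.

Lemma C_on_sum k (J : Type) (s : seq J) (F : J -> V -> V) :
  (forall a, C_on k U (F a)) -> C_on k U (\sum_(a <- s) F a).
Proof.
move=> FC; elim/big_ind : _ => //; first exact: (C_on_cst hK oU k 0).
by move=> f g; exact: C_on_add.
Qed.

Definition coord_lie f g : V -> V :=
  \sum_(j < d) (cmul j f (pderive j g) - cmul j g (pderive j f)).

Lemma lie_coord f g x : C_on 1 U f -> C_on 1 U g -> U x -> lie f g x = coord_lie f g x.
Proof.
move=> fC gC Ux; rewrite /lie.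
have dg := diff_jac hK oU (f x) gC Ux.
have df := diff_jac hK oU (g x) fC Ux.
apply: (etrans (f_equal2 (fun a b : V => a - b) dg df)).
rewrite /jac /coord_lie.
by rewrite fct_sumE -sumrB.
Qed.

Lemma C_on_coord_lie k f g : C_on k.+1 U f -> C_on k.+1 U g -> C_on k U (coord_lie f g).
Proof.
move=> fC gC; apply: C_on_sum => j.
have f' := C_on_pderive j fC; have g' := C_on_pderive j gC.
exact: (C_on_sub hK oU (C_on_cmul hK oU _ (C_onS fC) g') (C_on_cmul hK oU _ (C_onS gC) f')).
Qed.

Lemma C_on_lie k f g : C_on k.+1 U f -> C_on k.+1 U g -> C_on k U (lie f g).
Proof.
move=> fC gC; apply: (C_on_eq_on hK oU) (C_on_coord_lie fC gC) => x Ux.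
by rewrite lie_coord//; [exact: C_on_le fC|exact: C_on_le gC].
Qed.

Lemma pd_sub l f g x : C_on (size l) U f -> C_on (size l) U g -> U x ->
  pd l (f - g) x = pd l f x - pd l g x.
Proof.
elim: l f g => [//|i l IH] f g fC gC Ux; rewrite /= -IH//.
- by apply: (pd_eq_on oU) => // y Uy; exact: pderive_sub fC gC Uy.
- exact: C_on_pderive fC.
- exact: C_on_pderive gC.
Qed.

Lemma pd_add l f g x : C_on (size l) U f -> C_on (size l) U g -> U x ->
  pd l (f + g) x = pd l f x + pd l g x.
Proof.
elim: l f g => [//|i l IH] f g fC gC Ux; rewrite /= -IH//.
- apply: (pd_eq_on oU) => // y Uy.
  by have D := is_deriveD (C_on_derive i fC Uy) (C_on_derive i gC Uy); exact: derive_val.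
- exact: C_on_pderive fC.
- exact: C_on_pderive gC.
Qed.

Lemma norm2_pd_sum_le l (J : Type) (s : seq J) (F : J -> V -> V) (c : R) x : U x ->
  (forall a, C_on (size l) U (F a)) -> (forall a, norm2 (pd l (F a) x) <= c) ->
  norm2 (pd l (\sum_(a <- s) F a) x) <= (size s)%:R * c.
Proof.
move=> Ux FC Fc; elim: s => [|a s IH].
  rewrite big_nil mul0r; have -> : pd l (0 : V -> V) x = 0.
    have := @pd_sub l 0 0 x (C_on_cst hK oU _ 0) (C_on_cst hK oU _ 0) Ux.
    by rewrite !subrr.
  by rewrite (norm2_0 hK).
rewrite big_cons pd_add//; last by apply: C_on_sum.
apply: (le_trans (norm2D hK _ _)).
by rewrite /= -natr1 mulrDl mul1r [leRHS]addrC lerD.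
Qed.

Lemma norm2_pd_cmul_le l j f g (c : R) x : C_on (size l) U f -> C_on (size l) U g -> U x ->
  (forall l1 l2, (size l1 + size l2)%N = size l ->
    norm2 (pd l1 f x) * norm2 (pd l2 g x) <= c) ->
  norm2 (pd l (cmul j f g) x) <= 2 ^+ size l * c.
Proof.
move=> + + Ux; elim: l f g => [|i l IH] f g fC gC h.
  rewrite expr0 mul1r /= /cmul (norm2Z hK).
  apply: le_trans (h [::] [::] erefl); apply: ler_wpM2r; first exact: norm2_ge0.
  exact: abs_le_norm2.
have -> : pd (i :: l) (cmul j f g) x =
    pd l (cmul j (pderive i f) g + cmul j f (pderive i g)) x.
  apply: (pd_eq_on oU l Ux) => y Uy.
  exact: (pderive_cmul hK i j fC gC Uy).
have f' := C_on_pderive i fC; have g' := C_on_pderive i gC.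
have fS := C_onS fC; have gS := C_onS gC.
rewrite pd_add//; try exact: C_on_cmul.
apply: (le_trans (norm2D hK _ _)); rewrite exprS -mulrA mulr_natl mulr2n; apply: lerD.
  by apply: IH => // l1 l2 ll; apply: (h (i :: l1) l2); rewrite /= addSn ll.
by apply: IH => // l1 l2 ll; apply: (h l1 (i :: l2)); rewrite /= addnS ll.
Qed.

Lemma norm2_pd_lie_le l f g (c : R) x : C_on (size l).+1 U f -> C_on (size l).+1 U g -> U x ->
  (forall l1 l2, (size l1 + size l2)%N = (size l).+1 -> (0 < size l2)%N ->
    norm2 (pd l1 f x) * norm2 (pd l2 g x) <= c /\
    norm2 (pd l1 g x) * norm2 (pd l2 f x) <= c) ->
  norm2 (pd l (lie f g) x) <= d%:R * (2 ^+ (size l).+1 * c).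
Proof.
move=> fC gC Ux h.
have -> : pd l (lie f g) x = pd l (coord_lie f g) x.
  apply: (pd_eq_on oU) => // y Uy; apply: lie_coord => //;
    [exact: C_on_le fC|exact: C_on_le gC].
have f' j := C_on_pderive j fC; have g' j := C_on_pderive j gC.
have fS := C_onS fC; have gS := C_onS gC.
have sd : size (index_enum 'I_d) = d by rewrite [index_enum _]unlock -enumT size_enum_ord.
rewrite /coord_lie -[d in d%:R]sd.
apply: norm2_pd_sum_le => // j.
  by apply: (C_on_sub hK oU); apply: (C_on_cmul hK oU).
rewrite pd_sub//; try by apply: (C_on_cmul hK oU).
apply: (le_trans (norm2B hK _ _)); rewrite exprS -mulrA mulr_natl mulr2n; apply: lerD.
  by apply: norm2_pd_cmul_le => // l1 l2 ll; apply: (h l1 (j :: l2) _ isT).1; rewrite /= addnS ll.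
by apply: norm2_pd_cmul_le => // l1 l2 ll; apply: (h l1 (j :: l2) _ isT).2; rewrite /= addnS ll.
Qed.

Section Brackets.
Context {I : finType} (M : nat) (f : I -> V -> V).
Hypothesis fC : forall i : I, C_on (2 * M) U (f i).

Lemma blen_gt0 (b : br I) : (0 < blen b)%N.
Proof. by elim: b => //= b1 h1 b2 h2; rewrite addn_gt0 h1. Qed.

Lemma C_on_bfield k (b : br I) : (k + blen b <= (2 * M).+1)%N -> C_on k U (bfield f b).
Proof.
elim: b k => [i|b1 h1 b2 h2] k /=; first by rewrite addn1 ltnS => kM; apply: C_on_le (fC i).
move=> kb; have := blen_gt0 b1; have := blen_gt0 b2 => p1 p2.
by apply: C_on_lie; [apply: h1|apply: h2]; lia.
Qed.

(** A bracket of length [n] differentiated [k] times involves [n + k - 1]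
  derivatives in each of its terms. If [n + k <= 2 * M + 1], at most one factor of a
  term is differentiated more than [M] times. *)
Definition profile (A A' : R) (n k : nat) : R :=
  if (k + n <= M.+1)%N then A ^+ n else A ^+ n.-1 * A'.

Lemma profile_ge0 A A' n k : 0 <= A -> A <= A' -> 0 <= profile A A' n k.
Proof.
move=> A0 AA; rewrite /profile; case: ifP => _; first exact: exprn_ge0.
by rewrite mulr_ge0 ?exprn_ge0//; exact: le_trans AA.
Qed.

Lemma profile_mul A A' n1 n2 k1 k2 k : 0 <= A -> A <= A' -> (0 < n1)%N -> (0 < n2)%N ->
  (k1 + k2 = k.+1)%N -> (k + (n1 + n2) <= (2 * M).+1)%N -> (0 < k2)%N ->
  profile A A' n1 k1 * profile A A' n2 k2 <= profile A A' (n1 + n2) k.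
Proof.
move=> A0 AA n10 n20 kk kn k20; rewrite /profile.
have A'0 : 0 <= A' by exact: le_trans AA.
have step : A ^+ (n1 + n2) <= A ^+ (n1 + n2).-1 * A'.
  rewrite -[in leLHS](prednK (_ : 0 < n1 + n2)%N) ?addn_gt0 ?n10// exprSr.
  by rewrite ler_wpM2l ?exprn_ge0.
have e1 : (n1 + n2).-1 = (n1.-1 + n2)%N by lia.
have e2 : (n1 + n2).-1 = (n1 + n2.-1)%N by lia.
case: ifP => c1; case: ifP => c2; case: ifP => c3; try lia.
- by rewrite exprD.
- by rewrite -exprD.
- by rewrite e2 exprD mulrA.
- by rewrite e1 exprD mulrAC.
Qed.

(** Hence the asymmetry of the final estimate: one factor of class C^(2M), all the others of
  class C^M. *)
Lemma norm2_pd_bfield_le A A' x : U x -> 0 <= A -> A <= A' ->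
  (forall (i : I) l, (size l <= M)%N -> norm2 (pd l (f i) x) <= A) ->
  (forall (i : I) l, (size l <= 2 * M)%N -> norm2 (pd l (f i) x) <= A') ->
  forall (b : br I) l, (size l + blen b <= (2 * M).+1)%N ->
  norm2 (pd l (bfield f b) x) <=
    (d * 2 ^ (2 * M).+1)%:R ^+ (blen b).-1 * profile A A' (blen b) (size l).
Proof.
move=> Ux A0 AA hA hA'; elim => [i|b1 h1 b2 h2] l lb.
  rewrite /= expr0 mul1r /profile expr1 expr0 mul1r addn1 ltnS.
  by case: ifP => lM; [exact: hA|apply: hA'; move: lb; rewrite /= addn1].
rewrite [blen _]/= in lb *; have p1 := blen_gt0 b1; have p2 := blen_gt0 b2.
set C0 : R := (d * 2 ^ (2 * M).+1)%:R.
have C00 : 0 <= C0 by exact: ler0n.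
set n1 := blen b1 in lb p1 h1 *; set n2 := blen b2 in lb p2 h2 *.
pose c := C0 ^+ (n1 + n2).-2 * profile A A' (n1 + n2) (size l).
have c0 : 0 <= c by rewrite mulr_ge0 ?exprn_ge0// profile_ge0.
have key (a b : br I) : (forall l, (size l + blen a <= (2 * M).+1)%N ->
    norm2 (pd l (bfield f a) x) <= C0 ^+ (blen a).-1 * profile A A' (blen a) (size l)) ->
  (forall l, (size l + blen b <= (2 * M).+1)%N ->
    norm2 (pd l (bfield f b) x) <= C0 ^+ (blen b).-1 * profile A A' (blen b) (size l)) ->
  (0 < blen a)%N -> (0 < blen b)%N -> (blen a + blen b = n1 + n2)%N ->
  forall l1 l2 : seq 'I_d, (size l1 + size l2)%N = (size l).+1 -> (0 < size l2)%N ->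
  norm2 (pd l1 (bfield f a) x) * norm2 (pd l2 (bfield f b) x) <= c.
  move=> ha hb a0 b0 ab l1 l2 ll l20.
  have e : (n1 + n2).-2 = ((blen a).-1 + (blen b).-1)%N by lia.
  apply: (@le_trans _ _ ((C0 ^+ (blen a).-1 * profile A A' (blen a) (size l1)) *
      (C0 ^+ (blen b).-1 * profile A A' (blen b) (size l2)))).
    by apply: ler_pM; rewrite ?norm2_ge0//; [apply: ha|apply: hb]; lia.
  rewrite mulrACA -exprD -e; apply: ler_wpM2l; first exact: exprn_ge0.
  by rewrite -ab; apply: profile_mul => //; rewrite ab.
apply: (@le_trans _ _ (d%:R * (2 ^+ (size l).+1 * c))).
  apply: norm2_pd_lie_le => //; try by apply: C_on_bfield; rewrite -/n1 -/n2; lia.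
  move=> l1 l2 ll l20; split; first exact: key.
  by apply: key => //; rewrite addnC.
have -> : C0 ^+ (n1 + n2).-1 * profile A A' (n1 + n2) (size l) = C0 * c.
  by rewrite /c mulrA -exprS; congr (_ ^+ _ * _); lia.
rewrite mulrA; apply: ler_wpM2r => //; rewrite /C0 natrM natrX; apply: ler_wpM2l => //.
by apply: ler_weXn2l; [rewrite ler1n|lia].
Qed.

End Brackets.
End LieBrackets.

(** * Regular vector fields on a ball *)

Section Regular.
Context {R : realType} {K : scalar_field R}.
Hypothesis hK : K = real_scalars R \/ K = complex_scalars R.
Context {d : nat}.
Local Notation V := 'rV[K]_d.
Implicit Types (x y z v : V) (f g : V -> V).

(** All that the comparison of flows uses of a vector field of class C^2. *)
Record regular (rho N Q : R) (f : V -> V) (Df : V -> V -> V) : Prop := Regular {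
  reg_linear : forall x, cball rho x -> linear (Df x);
  reg_bound : forall x, cball rho x -> norm2 (f x) <= N;
  reg_dbound : forall x v, cball rho x -> norm2 (Df x v) <= N * norm2 v;
  reg_lip : forall x y, cball rho x -> cball rho y ->
    norm2 (f y - f x) <= N * norm2 (y - x);
  reg_quad : forall x y, cball rho x -> cball rho y ->
    norm2 (f y - f x - Df x (y - x)) <= Q * norm2 (y - x) ^+ 2 }.

Lemma regular_le rho N Q N' Q' f Df : N <= N' -> Q <= Q' ->
  regular rho N Q f Df -> regular rho N' Q' f Df.
Proof.
move=> NN QQ [h1 h2 h3 h4 h5]; split => //.
- by move=> x /h2 /le_trans; apply.
- by move=> x v /(h3 x v) /le_trans; apply; apply: ler_wpM2r NN; exact: norm2_ge0.
- by move=> x y hx /(h4 x y hx) /le_trans; apply; apply: ler_wpM2r NN; exact: norm2_ge0.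
- by move=> x y hx /(h5 x y hx) /le_trans; apply; apply: ler_wpM2r QQ; exact: sqr_ge0.
Qed.

Lemma regular0 rho : regular rho 0 0 (fun=> 0) (fun _ _ => 0).
Proof.
split => *; rewrite ?subrr ?subr0 ?(norm2_0 hK) ?mul0r//.
by move=> a u v; rewrite scaler0 addr0.
Qed.

Lemma regularD rho N Q N' Q' f Df g Dg : regular rho N Q f Df -> regular rho N' Q' g Dg ->
  regular rho (N + N') (Q + Q') (fun x => f x + g x) (fun x v => Df x v + Dg x v).
Proof.
move=> [f1 f2 f3 f4 f5] [g1 g2 g3 g4 g5]; split.
- by move=> x hx a u v; rewrite f1// g1// scalerDr addrACA.
- by move=> x hx; apply: (le_trans (norm2D hK _ _)); apply: lerD; auto.
- by move=> x v hx; apply: (le_trans (norm2D hK _ _)); rewrite mulrDl; apply: lerD; auto.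
- move=> x y hx hy; rewrite opprD addrACA; apply: (le_trans (norm2D hK _ _)).
  by rewrite mulrDl; apply: lerD; auto.
- move=> x y hx hy; rewrite 2!opprD (addrACA (f y)) (addrACA (f y - f x)).
  apply: (le_trans (norm2D hK _ _)).
  by rewrite mulrDl; apply: lerD; [exact: f5|exact: g5].
Qed.

Lemma regularZ rho N Q (a : K) f Df : regular rho N Q f Df ->
  regular rho (abs a * N) (abs a * Q) (fun x => a *: f x) (fun x v => a *: Df x v).
Proof.
move=> [f1 f2 f3 f4 f5]; split.
- by move=> x hx b u v; rewrite f1// scalerDr !scalerA mulrC.
- by move=> x hx; rewrite (norm2Z hK); apply: ler_wpM2l; [exact: abs_ge0|exact: f2].
- by move=> x v hx; rewrite (norm2Z hK) -mulrA; apply: ler_wpM2l; [exact: abs_ge0|exact: f3].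
- by move=> x y hx hy; rewrite -scalerBr (norm2Z hK) -mulrA; apply: ler_wpM2l;
    [exact: abs_ge0|exact: f4].
- by move=> x y hx hy; rewrite -!scalerBr (norm2Z hK) -mulrA; apply: ler_wpM2l;
    [exact: abs_ge0|exact: f5].
Qed.

Lemma regular_sum rho N Q (J : Type) (s : seq J) (P : pred J) (a : J -> K)
    (f : J -> V -> V) (Df : J -> V -> V -> V) :
  (forall j, P j -> regular rho N Q (f j) (Df j)) ->
  regular rho ((\sum_(j <- s | P j) abs (a j)) * N) ((\sum_(j <- s | P j) abs (a j)) * Q)
    (fun x => \sum_(j <- s | P j) a j *: f j x)
    (fun x v => \sum_(j <- s | P j) a j *: Df j x v).
Proof.
move=> h; elim: s => [|j s IH].
  have e1 : (fun x => \sum_(i <- [::] | P i) a i *: f i x) = fun=> 0.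
    by apply/funext => x; rewrite big_nil.
  have e2 : (fun x v => \sum_(i <- [::] | P i) a i *: Df i x v) = fun _ _ => 0.
    by apply/funext => x; apply/funext => v; rewrite big_nil.
  rewrite e1 e2 big_nil !mul0r; exact: regular0.
have e1 : (fun x => \sum_(i <- j :: s | P i) a i *: f i x) =
  if P j then (fun x => a j *: f j x + \sum_(i <- s | P i) a i *: f i x)
  else (fun x => \sum_(i <- s | P i) a i *: f i x).
  by apply/funext => x; rewrite big_cons; case: ifP.
have e2 : (fun x v => \sum_(i <- j :: s | P i) a i *: Df i x v) =
  if P j then (fun x v => a j *: Df j x v + \sum_(i <- s | P i) a i *: Df i x v)
  else (fun x v => \sum_(i <- s | P i) a i *: Df i x v).
  by apply/funext => x; apply/funext => v; rewrite big_cons; case: ifP.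
rewrite e1 e2 big_cons; case: ifP => // Pj.
by rewrite !mulrDl; apply: regularD => //; apply: regularZ; exact: h.
Qed.

Section FromSmooth.
Context {U : set V}.
Hypothesis oU : open U.
Context (rho : R).
Hypothesis BU : cball rho `<=` U.

Lemma norm2_jac_le f x v (c : R) : (forall j, norm2 (pderive j f x) <= c) ->
  norm2 (jac f x v) <= d%:R * c * norm2 v.
Proof.
move=> h; apply: (le_trans (norm2_sum hK _ _ _)).
apply: (@le_trans _ _ (\sum_(j < d) norm2 v * c)).
  apply: ler_sum => j _; rewrite (norm2Z hK); apply: ler_pM; rewrite ?norm2_ge0 ?(abs_ge0 hK)//.
  exact: abs_le_norm2.
by rewrite sumr_const card_ord -[_ *+ d]mulr_natl mulrA mulrAC.
Qed.

Lemma lipschitz_on_cball f x y (c : R) : C_on 1 U f ->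
  (forall z j, cball rho z -> norm2 (pderive j f z) <= c) ->
  cball rho x -> cball rho y ->
  norm2 (f y - f x) <= d%:R * (2 * (d%:R * c)) * norm2 (y - x).
Proof.
move=> fC h hx hy.
have := @mean_value_incr _ _ hK _ f x (y - x) 0 (d%:R * c * norm2 (y - x)).
have -> : x + (y - x) = y by rewrite addrC subrK.
rewrite subr0 => H; apply: (le_trans (H _)); last by rewrite !mulrA.
move=> s s01; have hz := cball_segment hK s01 hx hy.
exists (jac f (x + inj s *: (y - x)) (y - x)).
  by apply: (is_derive_jac hK oU) => //; exact: BU.
by rewrite subr0; apply: norm2_jac_le => j; exact: h.
Qed.

Lemma regular_C2 f (c c' : R) : (0 < d)%N -> 0 <= c -> C_on 2 U f ->
  (forall x, cball rho x -> norm2 (f x) <= c) ->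
  (forall x j, cball rho x -> norm2 (pderive j f x) <= c) ->
  (forall x i j, cball rho x -> norm2 (pderive i (pderive j f) x) <= c') ->
  regular rho (d%:R * (2 * (d%:R * c)))
    (d%:R * (2 * (d%:R * (d%:R * (2 * (d%:R * c')))))) f (jac f).
Proof.
move=> d0 c0 fC h0 h1 h2.
have fC1 := C_onS fC.
have d1 : 1 <= d%:R :> R by rewrite ler1n.
have dc : c <= d%:R * c by rewrite ler_peMl.
have dcc : d%:R * c <= d%:R * (2 * (d%:R * c)).
  by apply: ler_wpM2l => //; rewrite mulr_natl mulr2n ler_wpDl// mulr_ge0.
split.
- by move=> x hx; exact: jac_is_linear.
- by move=> x hx; apply: (le_trans (h0 x hx)); exact: le_trans dcc.
- move=> x v hx; apply: (@le_trans _ _ (d%:R * c * norm2 v)).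
    by apply: norm2_jac_le => j; exact: h1.
  by apply: ler_wpM2r => //; exact: norm2_ge0.
- by move=> x y hx hy; exact: (lipschitz_on_cball fC1 h1 hx hy).
move=> x y hx hy.
pose q := d%:R * (2 * (d%:R * c')) * norm2 (y - x).
have lip z j : cball rho z -> norm2 (pderive j f z - pderive j f x) <=
    d%:R * (2 * (d%:R * c')) * norm2 (z - x).
  move=> hz; exact: (lipschitz_on_cball (C_on_pderive j fC) (fun w i hw => h2 w i j hw) hx hz).
have := @mean_value_incr _ _ hK _ f x (y - x) (jac f x (y - x)) (d%:R * q * norm2 (y - x)).
have -> : x + (y - x) = y by rewrite addrC subrK.
move=> H; apply: (le_trans (H _)).
  move=> s s01; have hz := cball_segment hK s01 hx hy.
  exists (jac f (x + inj s *: (y - x)) (y - x)).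
    exact: (is_derive_jac hK oU _ fC1 (BU hz)).
  have -> : jac f (x + inj s *: (y - x)) (y - x) - jac f x (y - x) =
      \sum_j (y - x) 0 j *: (pderive j f (x + inj s *: (y - x)) - pderive j f x).
    by rewrite /jac -sumrB; apply: eq_bigr => j _; rewrite -scalerBr.
  apply: (le_trans (norm2_sum hK _ _ _)).
  apply: (@le_trans _ _ (\sum_(j < d) norm2 (y - x) * q)).
    apply: ler_sum => j _; rewrite (norm2Z hK).
    apply: ler_pM; rewrite ?norm2_ge0 ?(abs_ge0 hK)//; first exact: abs_le_norm2.
    apply: (le_trans (lip _ j hz)); rewrite /q; apply: ler_wpM2l.
      have c'0 : 0 <= c' by apply: le_trans (h2 x j j hx); exact: norm2_ge0.
      by rewrite !mulr_ge0.
    rewrite addrC addKr (norm2Z hK) (abs_inj hK).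
    by case/andP: s01 => s0 s1; rewrite ger0_norm// ler_piMl// norm2_ge0.
  by rewrite sumr_const card_ord -[_ *+ d]mulr_natl mulrA mulrAC.
rewrite le_eqVlt; apply/orP; left; apply/eqP; rewrite /q; ring.
Qed.

Lemma lie_jac f g x : C_on 1 U f -> C_on 1 U g -> cball rho x ->
  lie f g x = jac g x (f x) - jac f x (g x).
Proof.
move=> fC gC /BU Ux; have dg := diff_jac hK oU (f x) gC Ux.
have df := diff_jac hK oU (g x) fC Ux.
exact: (f_equal2 (fun a b : V => a - b) dg df).
Qed.

End FromSmooth.
End Regular.

(** * Primitives of integrable functions *)

Section RealPrimitive.
Context {R : realType}.
Local Notation mu := (@lebesgue_measure R).
Implicit Types (f g h : R -> R) (T s t : R).

Definition prim f t : R := \int[mu]_(s in `[0, t]) f s.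

Definition integ T f : Prop := mu.-integrable `[0, T] (EFin \o f).

Lemma integrable_oo_cc T f : mu.-integrable `]0, T[ (EFin \o f) -> integ T f.
Proof.
move=> /integrableP[mf fi]; apply/integrableP; split.
  exact: emeasurable_fun_itv_cc mf.
rewrite (integral_itv_bndoo true false)//; apply: (measurableT_comp _ mf); exact: abse_measurable.
Qed.

Lemma integ_le T t f : t <= T -> integ T f -> integ t f.
Proof.
move=> tT; apply: integrableS => //.
by apply: subset_itvl; rewrite bnd_simp.
Qed.

Lemma integD T f g : integ T f -> integ T g -> integ T (fun s => f s + g s).
Proof. by move=> fi gi; apply: (integrableD _ fi gi). Qed.

Lemma integZ T (a : R) f : integ T f -> integ T (fun s => a * f s).
Proof. by move=> fi; apply: (integrableZl _ a fi). Qed.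

Lemma integN T f : integ T f -> integ T (fun s => - f s).
Proof. by move=> fi; apply: (integrableN fi). Qed.

Lemma integ_norm T f : integ T f -> integ T (fun s => `|f s|).
Proof. by move=> fi; apply: (integrable_norm fi). Qed.

Lemma integ_cst T (a : R) : integ T (fun=> a).
Proof.
apply: continuous_compact_integrable; first exact: segment_compact.
by apply: continuous_subspaceT => x; exact: cst_continuous.
Qed.

Lemma integM_continuous T f g : integ T f -> {within `[0, T], continuous g} ->
  integ T (fun s => g s * f s).
Proof.
move=> fi gc.
have mg : measurable_fun (`[0, T] : set R) g.
  exact: subspace_continuous_measurable_fun.
have bg : [bounded g x | x in (`[0, T] : set R)].
  have : compact (g @` (`[0, T] : set R)) by apply: continuous_compact => //; exact: segment_compact.
  move=> /compact_bounded [M [Mr HM]]; exists M; split => // N MN x xT /=.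
  by apply: (HM N MN); exists x.
have mT : measurable (`[0, T] : set R) by exact: measurable_itv.
have H := @integrableMr _ _ R mu _ mT g (EFin \o f) mg bg fi.
exact: H.
Qed.

Lemma primD T t f g : t <= T -> integ T f -> integ T g ->
  prim (fun s => f s + g s) t = prim f t + prim g t.
Proof. by move=> tT fi gi; apply: RintegralD => //; apply: integ_le tT _. Qed.

Lemma primZ T t (a : R) f : t <= T -> integ T f ->
  prim (fun s => a * f s) t = a * prim f t.
Proof. by move=> tT fi; apply: RintegralZl => //; apply: integ_le tT _. Qed.

Lemma primB T t f g : t <= T -> integ T f -> integ T g ->
  prim (fun s => f s - g s) t = prim f t - prim g t.
Proof.
move=> tT fi gi; rewrite -mulN1r -(primZ _ tT gi) -(primD tT fi (integZ _ gi)).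
by apply: eq_Rintegral => s _; rewrite mulN1r.
Qed.

Lemma prim0 f : prim f 0 = 0.
Proof. by rewrite /prim set_itv1 Rintegral_set1. Qed.

Lemma prim_cst (a : R) t : 0 <= t -> prim (fun=> a) t = a * t.
Proof.
move=> t0; rewrite /prim Rintegral_cst//.
have e : mu (`[0, t] : set R) = (if (0 < t)%R then (t%:E - 0%:E)%E else 0%E).
  by have := lebesgue_measure_itv (`[0, t] : interval R); rewrite /= lte_fin.
transitivity (a * fine (mu (`[0, t] : set R))); first by [].
rewrite e; by case: ltgtP t0 => // [t0 _|<- _] /=; rewrite ?subr0 ?mulr0.
Qed.

Lemma prim_incr T s t f : 0 <= s -> s <= t -> t <= T -> integ T f ->
  prim f t - prim f s = \int[mu]_(r in `]s, t[) f r.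
Proof.
move=> s0 st tT fi; rewrite /prim Rintegral_itvB; last 3 first.
- exact: integ_le tT fi.
- by rewrite bnd_simp.
- by rewrite bnd_simp.
rewrite Rintegral_itv_bndo_bndc//; apply: integrableS fi => //.
by apply: subset_itv; rewrite bnd_simp.
Qed.

Lemma integ_oo T s t f : 0 <= s -> t <= T -> integ T f ->
  mu.-integrable `]s, t[ (EFin \o f).
Proof.
move=> s0 tT; apply: integrableS => //.
by apply: subset_itv; rewrite bnd_simp.
Qed.

Lemma prim_incr_le T s t f h : 0 <= s -> s <= t -> t <= T -> integ T f -> integ T h ->
  (forall r, s < r < t -> `|f r| <= h r) ->
  `|prim f t - prim f s| <= prim h t - prim h s.
Proof.
move=> s0 st tT fi hi fh; rewrite !(prim_incr s0 st tT)//.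
apply: (le_trans (le_normr_Rintegral _ (integ_oo s0 tT fi))) => //.
have i1 := integ_oo s0 tT (integ_norm fi); have i2 := integ_oo s0 tT hi.
by apply: (le_Rintegral _ i1 i2) => // r; rewrite /= in_itv; exact: fh.
Qed.

Lemma prim_mono T s t h : 0 <= s -> s <= t -> t <= T -> integ T h ->
  (forall r, 0 <= h r) -> prim h s <= prim h t.
Proof.
move=> s0 st tT hi h0; rewrite -subr_ge0; apply: le_trans (prim_incr_le s0 st tT hi hi _).
  exact: normr_ge0.
by move=> r _; rewrite ger0_norm.
Qed.

Lemma prim_continuous T f : 0 <= T -> integ T f -> {within `[0, T], continuous (prim f)}.
Proof. by move=> T0 fi; exact: parameterized_integral_continuous. Qed.

Lemma derive1_prim T f : integ T f ->
  \forall t \ae mu, 0 < t < T -> derive1 (prim f) t = f t.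
Proof.
move=> fi; pose g := f \_ `[0, T].
have gi : mu.-integrable setT (EFin \o g).
  by rewrite /g -restrict_EFin; apply: (integrable_mkcond _ _).1.
have gl : locally_integrable setT g by apply: integrable_locally_restrict.
have g0y y : mu.-integrable `[0, y] (EFin \o g) by apply: integrableS gi.
have := @FTC1 _ g (BLeft 0) g0y gl.
move=> FTC; have aeF := ae_filter_ringOfSetsType mu; apply: filterS FTC => t H /andP[t0 tT].
have gf r : 0 <= r <= T -> g r = f r.
  by move=> rT; rewrite /g patchE mem_set.
have [|_] := H.
  by rewrite /Order.lt /=.
rewrite gf ?ltW// => <-.
rewrite !derive1E; apply: near_eq_derive; near=> s.
have s0T : 0 < s < T by near: s; apply: near_in_itvoo; rewrite in_itv /= t0.
apply: eq_Rintegral => r; rewrite inE /= in_itv /= => /andP[r0 rs].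
by rewrite gf// r0 /= (le_trans rs)// ltW//; case/andP: s0T.
Unshelve. all: by end_near. Qed.

End RealPrimitive.

Section AlmostEverywhere.
Local Open Scope ereal_scope.
Context {d : measure_display} {T : measurableType d} {R : realType}.
Variable mu : {measure set T -> \bar R}.
Import HBNNSimple.

Lemma ge0_integral_le_off_null (N : set T) (f g : T -> \bar R) : measurable N -> mu N = 0 ->
  (forall x, 0 <= f x) -> (forall x, 0 <= g x) -> (forall x, ~ N x -> f x = g x) ->
  \int[mu]_x f x <= \int[mu]_x g x.
Proof.
move=> mN N0 f0 g0 fg; rewrite !ge0_integralTE//; apply: ge_ereal_sup => _ [h hf <-].
have mCN : measurable (~` N) by exact: measurableC.
have -> : sintegral mu h = sintegral mu (proj_nnsfun h mCN).
  rewrite -integralT_nnsfun -mrestrict -integral_nnsfun// -setTD.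
  by apply: ge0_negligible_integral => //; [apply: measurableT_comp|move=> x _; rewrite lee_fin].
apply: ereal_sup_ubound; exists (proj_nnsfun h mCN) => // x.
rewrite -mrestrict patchE; case: ifPn => [|_]; last exact: g0.
by rewrite inE => Nx; rewrite -fg//; exact: hf.
Qed.

(** No measurability is asked for: an almost everywhere derivative is only known to
  agree with a measurable function outside of a null set. *)
Lemma integral_eq_off_null (N D : set T) (f g : T -> \bar R) : measurable N -> mu N = 0 ->
  (forall x, D x -> ~ N x -> f x = g x) ->
  \int[mu]_(x in D) f x = \int[mu]_(x in D) g x.
Proof.
move=> mN N0 fg.
have fgD x : ~ N x -> (f \_ D) x = (g \_ D) x.
  by move=> Nx; rewrite !patchE; case: ifPn => //; rewrite inE => Dx; exact: fg.
rewrite integral_mkcond [RHS]integral_mkcond integralE [RHS]integralE.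
by congr (_ - _); apply/eqP; rewrite eq_le; apply/andP; split;
  apply: (ge0_integral_le_off_null mN N0) => // x Nx; rewrite ?funeposE ?funenegE fgD.
Qed.

End AlmostEverywhere.

Section ScalarPrimitive.
Context {R : realType} {K : scalar_field R}.
Hypothesis hK : K = real_scalars R \/ K = complex_scalars R.
Local Notation mu := (@lebesgue_measure R).
Implicit Types (g w phi : R -> K) (T s t : R).

Definition integK T g : Prop := integ T (fun s => re (g s)) /\ integ T (fun s => im (g s)).

Lemma L1_integK T g : L1 T g -> integK T g.
Proof. by move=> [h1 h2]; split; exact: integrable_oo_cc. Qed.

Lemma integK_le T t g : t <= T -> integK T g -> integK t g.
Proof. by move=> tT [h1 h2]; split; exact: integ_le tT _. Qed.

Lemma eq_integ T (f f' : R -> R) : f =1 f' -> integ T f -> integ T f'.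
Proof. by move=> /funext ->. Qed.

Lemma integK_D T g w : integK T g -> integK T w -> integK T (fun s => g s + w s).
Proof.
move=> [g1 g2] [w1 w2]; split.
  by apply: eq_integ (integD g1 w1) => s; rewrite reD.
by apply: eq_integ (integD g2 w2) => s; rewrite imD.
Qed.

Lemma integK_M T g phi : integK T g ->
  {within `[0, T], continuous (fun s => re (phi s))} ->
  {within `[0, T], continuous (fun s => im (phi s))} ->
  integK T (fun s => phi s * g s).
Proof.
move=> [g1 g2] c1 c2; split.
  apply: eq_integ (integD (integM_continuous g1 c1) (integN (integM_continuous g2 c2))) => s.
  by rewrite reM.
apply: eq_integ (integD (integM_continuous g2 c1) (integM_continuous g1 c2)) => s.
by rewrite imM.
Qed.

Lemma integK_Z T (a : K) g : integK T g -> integK T (fun s => a * g s).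
Proof.
move=> gi; apply: (@integK_M T g (fun=> a) gi);
  by apply: continuous_subspaceT => x; exact: cst_continuous.
Qed.

Lemma integK_cst T (a : K) : integK T (fun=> a).
Proof. by split; exact: integ_cst. Qed.

Lemma integK_sum T (J : Type) (r : seq J) (g : J -> R -> K) :
  (forall j, integK T (g j)) -> integK T (fun s => \sum_(j <- r) g j s).
Proof.
move=> h; elim: r => [|j r IH].
  rewrite [X in integK _ X](_ : _ = fun=> 0); first exact: integK_cst.
  by apply/funext => s; rewrite big_nil.
rewrite [X in integK _ X](_ : _ = fun s => g j s + \sum_(j <- r) g j s).
  exact: integK_D.
by apply/funext => s; rewrite big_cons.
Qed.

Lemma absE (z : K) : abs z = Num.sqrt (re z ^+ 2 + im z ^+ 2).
Proof.
rewrite /abs; move: z; case: hK => -> z; first by rewrite /= expr0n addr0 sqrtr_sqr.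
by case: z => a b.
Qed.

Lemma integ_abs T g : integK T g -> integ T (fun s => abs (g s)).
Proof.
move=> [g1 g2]; have ig := integD (integ_norm g1) (integ_norm g2).
apply: le_integrable ig => //.
  have m1 : measurable_fun (`[0, T] : set R) (fun s => re (g s)).
    by apply/measurable_EFinP; case/integrableP: g1.
  have m2 : measurable_fun (`[0, T] : set R) (fun s => im (g s)).
    by apply/measurable_EFinP; case/integrableP: g2.
  apply/measurable_EFinP.
  rewrite [X in measurable_fun _ X](_ : _ =
      Num.sqrt \o (fun s => re (g s) ^+ 2 + im (g s) ^+ 2)).
    apply: measurableT_comp; first exact: continuous_measurable_fun (@sqrt_continuous R).
    by apply: measurable_funD; apply: measurable_funX.
  by apply/funext => s; rewrite /= absE.
move=> s _ /=; rewrite lee_fin ger0_norm ?(abs_ge0 hK)// ger0_norm ?addr_ge0//.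
exact: abs_le_re_im.
Qed.

Lemma int0D T t g w : t <= T -> integK T g -> integK T w ->
  int0 (fun s => g s + w s) t = int0 g t + int0 w t.
Proof.
move=> tT [g1 g2] [w1 w2]; apply: (re_im_inj hK).
  rewrite reD// !re_integral0// -(primD tT g1 w1).
  by apply: eq_Rintegral => s _; rewrite reD.
rewrite imD// !im_integral0// -(primD tT g2 w2).
by apply: eq_Rintegral => s _; rewrite imD.
Qed.

Lemma int0Z T t (a : K) g : t <= T -> integK T g ->
  int0 (fun s => a * g s) t = a * int0 g t.
Proof.
move=> tT [g1 g2]; apply: (re_im_inj hK).
  rewrite reM// !re_integral0// !im_integral0//.
  rewrite -!(primZ _ tT g1) -!(primZ _ tT g2) -(primB tT (integZ _ g1) (integZ _ g2)).
  by apply: eq_Rintegral => s _; rewrite reM.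
rewrite imM// !re_integral0// !im_integral0//.
rewrite -!(primZ _ tT g1) -!(primZ _ tT g2) -(primD tT (integZ _ g2) (integZ _ g1)).
by apply: eq_Rintegral => s _; rewrite imM.
Qed.

Lemma int0B T t g w : t <= T -> integK T g -> integK T w ->
  int0 (fun s => g s - w s) t = int0 g t - int0 w t.
Proof.
move=> tT gi wi; rewrite -mulN1r -(int0Z _ tT wi) -(int0D tT gi (integK_Z _ wi)).
by congr (int0 _ t); apply/funext => s; rewrite mulN1r.
Qed.

Lemma int0_sum T t (J : Type) (r : seq J) (g : J -> R -> K) : t <= T ->
  (forall j, integK T (g j)) ->
  int0 (fun s => \sum_(j <- r) g j s) t = \sum_(j <- r) int0 (g j) t.
Proof.
move=> tT h; elim: r => [|j r IH].
  rewrite big_nil -[RHS](mul0r (int0 (fun=> 0) t)) -(int0Z 0 tT (integK_cst T 0)).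
  by congr (int0 _ t); apply/funext => s; rewrite big_nil mul0r.
rewrite big_cons -IH -(int0D tT (h j) (integK_sum _ h)).
by congr (int0 _ t); apply/funext => s; rewrite big_cons.
Qed.

Lemma int0_0 g : int0 g 0 = 0.
Proof.
by apply: (re_im_inj hK); rewrite ?re_integral0 ?im_integral0// ?re0 ?im0//; exact: prim0.
Qed.

Lemma int0_cst (a : K) t : 0 <= t -> int0 (fun=> a) t = inj t * a.
Proof.
move=> t0; apply: (re_im_inj hK).
  by rewrite reM// re_inj// im_inj// mul0r subr0 re_integral0// mulrC; exact: prim_cst.
by rewrite imM// re_inj// im_inj// mul0r addr0 im_integral0// mulrC; exact: prim_cst.
Qed.

Lemma int0_incr_le T s t g (h : R -> R) : 0 <= s -> s <= t -> t <= T ->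
  integK T g -> integ T h -> (forall r, s < r < t -> abs (g r) <= h r) ->
  abs (int0 g t - int0 g s) <= 2 * (prim h t - prim h s).
Proof.
move=> s0 st tT [g1 g2] hi gh; apply: (le_trans (abs_le_re_im hK _)).
rewrite mulr_natl mulr2n reB// imB// !re_integral0// !im_integral0//.
by apply: lerD; apply: (prim_incr_le s0 st tT) => // r /gh; apply: le_trans;
  [exact: abs_re|exact: abs_im].
Qed.

Lemma int0_continuous T g : 0 <= T -> integK T g ->
  {within `[0, T], continuous (fun t => re (int0 g t))} /\
  {within `[0, T], continuous (fun t => im (int0 g t))}.
Proof.
move=> T0 [g1 g2].
have -> : (fun t => re (int0 g t)) = prim (fun s => re (g s)).
  by apply/funext => t; rewrite re_integral0.
have -> : (fun t => im (int0 g t)) = prim (fun s => im (g s)).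
  by apply/funext => t; rewrite im_integral0.
by split; exact: prim_continuous.
Qed.

Lemma int0_eq_ae g w t (N : set R) : measurable N -> mu N = 0%E ->
  (forall s, 0 < s < t -> ~ N s -> g s = w s) -> int0 g t = int0 w t.
Proof.
move=> mN N0 gw.
pose N' : set R := N `|` [set 0; t].
have m0t : measurable ([set 0; t] : set R).
  by apply: measurableU; exact: measurable_set1.
have mN' : measurable N' by apply: measurableU.
have N'0 : mu N' = 0%E.
  by rewrite measureU0//; rewrite measureU0//; exact: lebesgue_measure_set1.
have eq s : s \in `[0, t] -> ~ N' s -> g s = w s.
  rewrite in_itv /= => /andP[s0 st] sN; apply: gw; last by move=> h; apply: sN; left.
  rewrite !lt_neqAle s0 st !andbT; apply/andP; split; apply/eqP => h; apply: sN; right;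
    by [left|right].
have E (p : K -> R) : \int[mu]_(s in `[0, t]) p (g s) = \int[mu]_(s in `[0, t]) p (w s).
  congr fine; apply: (@integral_eq_off_null _ _ R mu N' _ _ _ mN' N'0) => s h1 h2.
  by rewrite (eq s).
by apply: (re_im_inj hK); rewrite ?re_integral0 ?im_integral0//; exact: E.
Qed.

Lemma tderive_int0 T w : integK T w -> exists N : set R, [/\ measurable N, mu N = 0%E &
  forall s, 0 < s < T -> ~ N s -> tderive (int0 w) s = w s].
Proof.
move=> [w1 w2].
have [N1 [m1 n1 h1]] := derive1_prim w1; have [N2 [m2 n2 h2]] := derive1_prim w2.
exists (N1 `|` N2); split; first exact: measurableU.
  by rewrite measureU0.
move=> s sT sN.
have r1 : re \o int0 w = prim (fun s => re (w s)).
  by apply/funext => t; rewrite /= re_integral0.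
have r2 : im \o int0 w = prim (fun s => im (w s)).
  by apply/funext => t; rewrite /= im_integral0.
apply: (re_im_inj hK).
  rewrite re_tderive// r1; apply: contrapT => h; apply: sN; left; apply: h1 => /= h'.
  by apply: h; exact: h'.
rewrite im_tderive// r2; apply: contrapT => h; apply: sN; right; apply: h2 => /= h'.
by apply: h; exact: h'.
Qed.

End ScalarPrimitive.

(** * Control systems: increments and existence of solutions *)

Section Within.
Context {R : realType} {K : scalar_field R}.
Hypothesis hK : K = real_scalars R \/ K = complex_scalars R.
Context {d : nat}.
Local Notation V := 'rV[K]_d.

Lemma within_realP (T : R) (phi : R -> R) : {within `[0, T], continuous phi} <->
  (forall t, 0 <= t <= T -> forall e : R, 0 < e -> exists2 r : R, 0 < r &
    forall s, 0 <= s <= T -> `|s - t| < r -> `|phi s - phi t| < e).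
Proof.
split => [/subspace_continuousP H t tT e e0|H].
  have tT' : (`[0, T]%classic : set R) t by rewrite /= in_itv.
  have /(_ (ball (phi t) e) (nbhsx_ballx _ _ e0)) := H t tT'.
  move=> /nbhs_ballP[r r0 rH]; exists r => // s sT st.
  have := rH s; rewrite /ball /= distrC => /(_ st); rewrite in_itv /= => /(_ sT).
  by rewrite distrC.
apply/subspace_continuousP => t; rewrite /= in_itv /= => tT P /nbhs_ballP[e e0 eP].
have [r r0 rH] := H t tT e e0.
apply/nbhs_ballP; exists r => // s; rewrite /ball /= distrC in_itv /= => st sT.
by apply: eP; rewrite /ball /= distrC; exact: rH.
Qed.

Lemma within_norm2P (T : R) (x : R -> V) : {within `[0, T], continuous x} <->
  (forall t, 0 <= t <= T -> forall e : R, 0 < e -> exists2 r : R, 0 < r &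
    forall s, 0 <= s <= T -> `|s - t| < r -> norm2 (x s - x t) < e).
Proof.
split => [/subspace_continuousP H t tT e e0|H].
  have tT' : (`[0, T]%classic : set R) t by rewrite /= in_itv.
  have B : nbhs (x t) [set y | norm2 (y - x t) < e].
    by apply/(nbhs_norm2P hK); exists e.
  have /(_ _ B) := H t tT'.
  move=> /nbhs_ballP[r r0 rH]; exists r => // s sT st.
  by have := rH s; rewrite /ball /= distrC => /(_ st); rewrite in_itv /= => /(_ sT).
apply/subspace_continuousP => t; rewrite /= in_itv /= => tT P /(nbhs_norm2P hK)[e e0 eP].
have [r r0 rH] := H t tT e e0.
apply/nbhs_ballP; exists r => // s; rewrite /ball /= distrC in_itv /= => st sT.
by apply: eP; exact: rH.
Qed.

Lemma within_comp (T : R) (x : R -> V) (phi : V -> R) (L : R) :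
  {within `[0, T], continuous x} ->
  (forall s t, 0 <= s <= T -> 0 <= t <= T ->
    `|phi (x s) - phi (x t)| <= L * norm2 (x s - x t)) ->
  {within `[0, T], continuous (fun s => phi (x s))}.
Proof.
move=> /within_norm2P xc h; apply/within_realP => t tT e e0.
have L0 : 0 < `|L| + 1 by rewrite ltr_wpDl.
have [r r0 rH] := xc t tT _ (divr_gt0 e0 L0); exists r => // s sT st.
apply: (le_lt_trans (h s t sT tT)); have := rH s sT st; rewrite ltr_pdivlMr// => H.
apply: le_lt_trans H; rewrite mulrC ler_wpM2l ?norm2_ge0//.
by apply: (le_trans (ler_norm L)); rewrite lerDl.
Qed.

End Within.

Lemma le0_geometric (R : realType) (a c : R) : (forall n, a <= c * 2^-1 ^+ n) -> a <= 0.
Proof.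
move=> h; have [c0|c0] := leP c 0.
  by apply: (le_trans (h 0%N)); rewrite expr0 mulr1.
apply/ler_addgt0Pr => e e0; rewrite add0r.
have [n cn] : exists n : nat, c / e < n%:R.
  by exists (Num.truncn (c / e)).+1; rewrite truncnS_gt.
apply: (le_trans (h n)).
have n2 : n%:R <= 2 ^+ n :> R by rewrite -natrX ler_nat ltnW// ltn_expl.
rewrite exprVn ler_pdivrMr ?exprn_gt0//; rewrite ltr_pdivrMr// mulrC in cn.
by apply: (le_trans (ltW cn)); rewrite ler_wpM2l// ltW.
Qed.

Section Control.
Context {R : realType} {K : scalar_field R}.
Hypothesis hK : K = real_scalars R \/ K = complex_scalars R.
Context {d : nat}.
Local Notation V := 'rV[K]_d.
Context {J : finType} (rho T N L : R) (f : J -> V -> V) (u : J -> R -> K).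
Hypothesis T0 : 0 <= T.
Hypothesis L0 : 0 <= L.
Hypothesis ui : forall i, integK T (u i).
Hypothesis fN : forall i x, cball rho x -> norm2 (f i x) <= N.
Hypothesis fL : forall i x y, cball rho x -> cball rho y ->
  norm2 (f i y - f i x) <= L * norm2 (y - x).

Definition variation (t : R) : R := prim (fun s => \sum_i abs (u i s)) t.

Lemma integ_sum_abs : integ T (fun s => \sum_i abs (u i s)).
Proof.
have h (r : seq J) : integ T (fun s => \sum_(i <- r) abs (u i s)).
  elim: r => [|i r IH].
    by apply: eq_integ (integ_cst T 0) => s; rewrite big_nil.
  by apply: eq_integ (integD (integ_abs hK (ui i)) IH) => s; rewrite big_cons.
exact: h.
Qed.

Lemma variation_mono s t : 0 <= s -> s <= t -> t <= T -> variation s <= variation t.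
Proof.
move=> s0 st tT; apply: (prim_mono s0 st tT integ_sum_abs) => r.
by apply: sumr_ge0 => i _; exact: abs_ge0.
Qed.

Lemma variation_ge0 t : 0 <= t <= T -> 0 <= variation t.
Proof. by move=> /andP[t0 tT]; rewrite -(prim0 (fun s => \sum_i abs (u i s))) variation_mono. Qed.

(** A curve along which the field may be integrated. *)
Definition admissible (x : R -> V) : Prop :=
  {within `[0, T], continuous x} /\ forall t, 0 <= t <= T -> cball rho (x t).

Definition int_field (x : R -> V) (t : R) : V :=
  \row_j int0 (fun s => control_field f u s (x s) 0 j) t.

Lemma integK_field x i j : admissible x -> integK T (fun s => f i (x s) 0 j * u i s).
Proof.
move=> [xc xb]; apply: (integK_M hK) (ui i) _ _.
  apply: (within_comp (phi := fun y => re (f i y 0 j)) (L := L) hK xc) => s t sT tT.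
  rewrite -reB//; apply: (le_trans (abs_re hK _)).
  have := abs_le_norm2 hK (f i (x s) - f i (x t)) j; rewrite !mxE => /le_trans; apply.
  by apply: fL; exact: xb.
apply: (within_comp (phi := fun y => im (f i y 0 j)) (L := L) hK xc) => s t sT tT.
rewrite -imB//; apply: (le_trans (abs_im hK _)).
have := abs_le_norm2 hK (f i (x s) - f i (x t)) j; rewrite !mxE => /le_trans; apply.
by apply: fL; exact: xb.
Qed.

Lemma control_fieldE x s j :
  control_field f u s (x s) 0 j = \sum_i f i (x s) 0 j * u i s.
Proof.
rewrite /control_field summxE; apply: eq_bigr => i _.
by rewrite mxE mulrC.
Qed.

Lemma integK_control x j : admissible x -> integK T (fun s => control_field f u s (x s) 0 j).
Proof.
move=> xa; have h i : integK T (fun s => f i (x s) 0 j * u i s) by exact: integK_field.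
have := integK_sum hK (index_enum J) h.
by congr integK; apply/funext => s; rewrite control_fieldE.
Qed.

(** All estimates of integrals along curves are instances of this one. *)
Lemma int0_incr_weighted (c : J -> R -> K) (C : R) s t :
  0 <= s -> s <= t -> t <= T -> (forall i, integK T (fun r => c i r * u i r)) ->
  (forall i r, s <= r <= t -> abs (c i r) <= C) ->
  abs (int0 (fun r => \sum_i c i r * u i r) t - int0 (fun r => \sum_i c i r * u i r) s)
    <= 2 * C * (variation t - variation s).
Proof.
move=> s0 st tT ci cC.
have := @int0_incr_le _ _ hK T s t (fun r => \sum_i c i r * u i r)
  (fun r => C * \sum_i abs (u i r)) s0 st tT.
rewrite !(primZ _ _ integ_sum_abs)//; last by rewrite (le_trans st).
rewrite -/(variation t) -/(variation s) -mulrBr mulrA; apply.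
- exact: integK_sum.
- exact: integZ integ_sum_abs.
move=> r /andP[sr rt]; apply: (le_trans (abs_sum hK _ _ _)).
rewrite mulr_sumr; apply: ler_sum => i _; rewrite (absM hK).
by apply: ler_wpM2r; [exact: abs_ge0|apply: cC; rewrite !ltW].
Qed.

Lemma norm2_int_field_incr x s t : admissible x -> 0 <= s -> s <= t -> t <= T ->
  norm2 (int_field x t - int_field x s) <= d%:R * (2 * N * (variation t - variation s)).
Proof.
move=> xa s0 st tT; apply: (norm2_le hK) => j; rewrite !mxE.
have -> : (fun s0 => control_field f u s0 (x s0) 0 j) =
    (fun r => \sum_i f i (x r) 0 j * u i r).
  by apply/funext => r; rewrite control_fieldE.
apply: int0_incr_weighted => // [i|i r /andP[sr rt]]; first exact: integK_field.
apply: (le_trans (abs_le_norm2 hK _ _)); apply: fN; apply: xa.2.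
by rewrite (le_trans s0 sr) (le_trans rt tT).
Qed.

Lemma norm2_int_field_dist x y (D : R) t : admissible x -> admissible y -> 0 <= t <= T ->
  (forall s, 0 <= s <= T -> norm2 (y s - x s) <= D) ->
  norm2 (int_field y t - int_field x t) <= d%:R * (2 * (L * D) * variation t).
Proof.
move=> xa ya /andP[t0 tT] D0; apply: (norm2_le hK) => j; rewrite !mxE.
rewrite -(int0B hK tT); [|exact: integK_control..].
have -> : (fun s => control_field f u s (y s) 0 j - control_field f u s (x s) 0 j) =
    (fun r => \sum_i (f i (y r) 0 j - f i (x r) 0 j) * u i r).
  by apply/funext => r; rewrite !control_fieldE -sumrB; apply: eq_bigr => i _; rewrite mulrBl.
have := @int0_incr_weighted (fun i r => f i (y r) 0 j - f i (x r) 0 j) (L * D) 0 t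
  (lexx 0) t0 tT.
rewrite (int0_0 hK) subr0 /variation prim0 subr0; apply.
  move=> i; rewrite [X in integK _ X](_ : _ =
    fun s => f i (y s) 0 j * u i s + (-1) * (f i (x s) 0 j * u i s)).
    by apply: (integK_D hK); [exact: integK_field|apply: (integK_Z hK); exact: integK_field].
  by apply/funext => s; rewrite mulrBl mulN1r.
move=> i r /andP[r0 rt]; have rT : 0 <= r <= T by rewrite r0 (le_trans rt).
have := abs_le_norm2 hK (f i (y r) - f i (x r)) j; rewrite !mxE => /le_trans; apply.
apply: (le_trans (fL i (xa.2 r rT) (ya.2 r rT))).
by apply: ler_wpM2l => //; exact: D0.
Qed.

Lemma solutionE p x : solution rho T (control_field f u) p x <->
  admissible x /\ forall t, 0 <= t <= T -> x t = p + int_field x t.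
Proof.
split=> [[xc xb xe]|[[xc xb] xe]].
  split; first by split=> // t tT; apply: xb; rewrite in_itv.
  move=> t tT; apply/rowP => j; rewrite !mxE; apply: xe.
  by rewrite in_itv.
split; [exact: xc|by move=> t; rewrite in_itv /=; exact: xb|].
by move=> t; rewrite in_itv /= => tT j; rewrite [in LHS]xe// !mxE.
Qed.

Lemma solution_start p x : solution rho T (control_field f u) p x -> x 0 = p.
Proof.
move=> /solutionE[_ ->]; last by rewrite lexx T0.
by apply/rowP => j; rewrite !mxE (int0_0 hK) addr0.
Qed.

Lemma solution_incr p x s t : solution rho T (control_field f u) p x ->
  0 <= s -> s <= t -> t <= T ->
  norm2 (x t - x s) <= d%:R * (2 * N * (variation t - variation s)).
Proof.
move=> /solutionE[xa xe] s0 st tT.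
rewrite !xe ?s0 ?(le_trans s0 st) ?(le_trans st tT)// opprD addrACA subrr add0r.
exact: norm2_int_field_incr.
Qed.

Lemma solution_incr2 p x s t : solution rho T (control_field f u) p x ->
  0 <= s -> s <= t -> t <= T ->
  norm2 (x t - x s - \sum_i (int0 (u i) t - int0 (u i) s) *: f i (x s)) <=
    d%:R * (2 * (L * (d%:R * (2 * N * (variation t - variation s)))) *
      (variation t - variation s)).
Proof.
move=> xs s0 st tT; have [xa xe] := (solutionE p x).1 xs.
have sT : s <= T := le_trans st tT.
have e0 : x t - x s = int_field x t - int_field x s.
  by rewrite !xe ?s0 ?(le_trans s0 st) ?sT ?tT// opprD addrACA subrr add0r.
rewrite e0; apply: (norm2_le hK) => j; rewrite !mxE summxE.
have cE : (fun r => control_field f u r (x r) 0 j) = (fun r => \sum_i f i (x r) 0 j * u i r).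
  by apply/funext => r; rewrite control_fieldE.
pose c i r := f i (x r) 0 j - f i (x s) 0 j.
have ci i : integK T (fun r => c i r * u i r).
  rewrite [X in integK _ X](_ : _ =
    fun r => f i (x r) 0 j * u i r + (- f i (x s) 0 j) * u i r).
    by apply: (integK_D hK); [exact: integK_field|apply: (integK_Z hK)].
  by apply/funext => r; rewrite /c mulrBl mulNr.
have E r : r <= T -> int0 (fun r => \sum_i c i r * u i r) r =
    int0 (fun r => \sum_i f i (x r) 0 j * u i r) r - \sum_i f i (x s) 0 j * int0 (u i) r.
  move=> rT; rewrite !(int0_sum hK _ rT) -?sumrB//; last by move=> i; exact: integK_field.
  apply: eq_bigr => i _; rewrite -(int0Z hK _ rT)// -(int0B hK rT).
  - by congr (int0 _ r); apply/funext => z; rewrite /c mulrBl.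
  - exact: integK_field.
  - exact: integK_Z.
have := @int0_incr_weighted c _ s t s0 st tT ci.
rewrite !E// cE => H.
have -> : int0 (fun r => \sum_i f i (x r) 0 j * u i r) t -
     int0 (fun r => \sum_i f i (x r) 0 j * u i r) s -
     \sum_i ((int0 (u i) t - int0 (u i) s) *: f i (x s)) 0 j =
   int0 (fun r => \sum_i f i (x r) 0 j * u i r) t - \sum_i f i (x s) 0 j * int0 (u i) t -
   (int0 (fun r => \sum_i f i (x r) 0 j * u i r) s - \sum_i f i (x s) 0 j * int0 (u i) s).
  have -> : \sum_i ((int0 (u i) t - int0 (u i) s) *: f i (x s)) 0 j =
      \sum_i f i (x s) 0 j * int0 (u i) t - \sum_i f i (x s) 0 j * int0 (u i) s.
    by rewrite -sumrB; apply: eq_bigr => i _; rewrite mxE; ring.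
  by ring.
apply: H => i r /andP[sr rt].
have rT : 0 <= r <= T by rewrite (le_trans s0 sr) (le_trans rt tT).
have sT' : 0 <= s <= T by rewrite s0.
have := abs_le_norm2 hK (f i (x r) - f i (x s)) j; rewrite !mxE => /le_trans; apply.
apply: (le_trans (fL i (xa.2 s sT') (xa.2 r rT))); apply: ler_wpM2l => //.
apply: (le_trans (solution_incr xs s0 sr (le_trans rt tT))).
have N0 : 0 <= N by apply: le_trans (fN i (xa.2 s sT')); exact: norm2_ge0.
by rewrite !ler_wpM2l// ?mulr_ge0// lerB// variation_mono// (le_trans s0).
Qed.

(** Picard iteration. The smallness of the total variation makes the integral operator
  a contraction on the whole interval. *)
Lemma solution_exists p : 0 <= N -> d%:R * (2 * L * variation T) <= 2^-1 ->
  norm2 p + d%:R * (2 * N * variation T) <= rho ->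
  exists x, solution rho T (control_field f u) p x.
Proof.
move=> N0 small stay.
pose X := fix X n : R -> V := if n is n'.+1 then fun t => p + int_field (X n') t else fun=> p.
have VT0 : 0 <= variation T by apply: variation_ge0; rewrite T0 lexx.
have TT : 0 <= T <= T by rewrite T0 lexx.
have vT t : 0 <= t <= T -> variation t <= variation T.
  by move=> /andP[t0 tT]; exact: variation_mono.
have int0f x : int_field x 0 = 0 by apply/rowP => j; rewrite !mxE (int0_0 hK).
have v0 : variation 0 = 0 by rewrite /variation prim0.
have vc : {within `[0, T], continuous variation}.
  by apply: prim_continuous => //; exact: integ_sum_abs.
have step_adm x : admissible x -> admissible (fun t => p + int_field x t).
  move=> xa; split.
    apply/(within_norm2P hK) => t tT e e0.
    have c0 : 0 < d%:R * (2 * N) + 1 by rewrite ltr_wpDl// !mulr_ge0.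
    have [r r0 rH] := (within_realP T variation).1 vc t tT _ (divr_gt0 e0 c0).
    exists r => // s sT st; rewrite opprD addrACA subrr add0r.
    have vst := rH s sT st; rewrite ltr_pdivlMr// in vst; apply: le_lt_trans vst.
    have main a b : 0 <= a <= T -> 0 <= b <= T -> a <= b ->
        norm2 (int_field x b - int_field x a) <=
        `|variation b - variation a| * (d%:R * (2 * N) + 1).
      move=> /andP[a0 aT] /andP[b0 bT] ab.
      apply: (le_trans (norm2_int_field_incr xa a0 ab bT)).
      rewrite ger0_norm ?subr_ge0 ?variation_mono//.
      rewrite mulrA mulrC; apply: ler_wpM2l; first by rewrite subr_ge0 variation_mono.
      by rewrite lerDl.
    have [ts|ts] := leP t s; first exact: main.
    by rewrite (norm2_distC hK) distrC; apply: main => //; exact: ltW.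
  move=> t tT; apply: le_trans stay; apply: (le_trans (norm2D hK _ _)); rewrite lerD2l.
  have := @norm2_int_field_incr x 0 t xa (lexx 0).
  rewrite int0f v0 !subr0; case/andP: (tT) => t0 t1 /(_ t0 t1) /le_trans; apply.
  by rewrite !ler_wpM2l// ?mulr_ge0// vT.
have Xa n : admissible (X n).
  elim: n => [|n IH]; last exact: step_adm.
  split; first by apply: continuous_subspaceT => ?; exact: cst_continuous.
  by move=> t _; apply: le_trans stay; rewrite lerDl !mulr_ge0.
pose c := d%:R * (2 * N * variation T).
have c0 : 0 <= c by rewrite /c !mulr_ge0.
have Xd n t : 0 <= t <= T -> norm2 (X n.+1 t - X n t) <= c * 2^-1 ^+ n.
  elim: n t => [|n IH] t tT.
    rewrite expr0 mulr1 /= addrC addKr.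
    have := @norm2_int_field_incr (fun=> p) 0 t (Xa 0%N) (lexx 0).
    rewrite int0f v0 !subr0; case/andP: (tT) => t0 t1 /(_ t0 t1) /le_trans; apply.
    by rewrite !ler_wpM2l// ?mulr_ge0// vT.
  rewrite [X n.+2]/= [X in _ - X n.+1 _]/= opprD addrACA subrr add0r.
  have := norm2_int_field_dist (Xa n) (Xa n.+1) tT IH.
  move=> /le_trans; apply; rewrite exprS.
  apply: (@le_trans _ _ (d%:R * (2 * L * variation T) * (c * 2^-1 ^+ n))).
    have -> : d%:R * (2 * L * variation T) * (c * 2^-1 ^+ n) =
      d%:R * (2 * (L * (c * 2^-1 ^+ n)) * variation T) by ring.
    by rewrite !ler_wpM2l// ?mulr_ge0 ?exprn_ge0// vT.
  by rewrite (mulrCA c); apply: ler_wpM2r small; rewrite mulr_ge0// exprn_ge0.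
have h01 : 0 <= (2^-1 : R) < 1 by apply/andP; split; lra.
have lim t : exists l : V, 0 <= t <= T ->
    forall n, norm2 (X n t - l) <= d%:R * (2 * (c * 2^-1 ^+ n / (1 - 2^-1))).
  case: (boolP (0 <= t <= T)) => [tT|_]; last by exists 0.
  have lj (j : 'I_d) : {l : K | forall n, abs (X n t 0 j - l) <= 2 * (c * 2^-1 ^+ n / (1 - 2^-1))}.
    apply: cid; apply: (abs_complete hK) => // n.
    by have := abs_le_norm2 hK (X n.+1 t - X n t) j; rewrite !mxE => /le_trans; apply; exact: Xd.
  exists (\row_j projT1 (lj j)) => _ n; apply: (norm2_le hK) => j; rewrite !mxE.
  exact: (projT2 (lj j)).
pose x t := projT1 (cid (lim t)).
pose C := d%:R * (2 * (c / (1 - 2^-1))).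
have h12 : 0 <= 1 - 2^-1 :> R by rewrite subr_ge0 ltW//; case/andP: h01.
have C0 : 0 <= C by rewrite /C !mulr_ge0// invr_ge0.
have xX n t : 0 <= t <= T -> norm2 (X n t - x t) <= C * 2^-1 ^+ n.
  move=> tT; apply: (le_trans (projT2 (cid (lim t)) tT n)).
  by rewrite /C le_eqVlt; apply/orP; left; apply/eqP; ring.
have xa : admissible x.
  split.
    apply/(within_norm2P hK) => t tT e e0.
    have [n Cn] : exists n, C * 2^-1 ^+ n < e / 3.
      apply: contrapT => hn; have : e / 3 <= 0; last by lra.
      apply: (le0_geometric (c := C)) => n; rewrite leNgt; apply/negP => h; apply: hn.
      by exists n.
    have e3 : 0 < e / 3 by lra.
    have [r r0 rH] := (within_norm2P hK T (X n)).1 (Xa n).1 t tT _ e3.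
    exists r => // s sT st.
    have h1 := rH s sT st; have h2 := xX n s sT; have h3 := xX n t tT.
    have := norm2_triangle hK (X n s) (x s) (x t); have := norm2_triangle hK (X n t) (X n s) (x t).
    rewrite (norm2_distC hK (x s) (X n s)).
    move: h1 h2 h3 Cn; clear; lra.
  move=> t tT; rewrite /cball /= -subr_le0; apply: (le0_geometric (c := C)) => n.
  have := xX n t tT; have := (Xa n).2 t tT; rewrite /cball /=.
  have := norm2D hK (x t - X n t) (X n t); rewrite subrK (norm2_distC hK); clear; lra.
exists x; apply/solutionE; split => // t tT.
apply/eqP; rewrite -subr_eq0; apply/eqP; apply: (norm2_le0 hK).
apply: (le0_geometric (c := C + d%:R * (2 * L * variation t) * C)) => n.
have h1 := xX n.+1 t tT.
have h2 := norm2_int_field_dist xa (Xa n) tT (fun s sT => xX n s sT).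
have h3 : norm2 (x t - (p + int_field x t)) <=
    norm2 (x t - X n.+1 t) + norm2 (int_field (X n) t - int_field x t).
  have -> : int_field (X n) t - int_field x t = X n.+1 t - (p + int_field x t).
    by rewrite /= opprD addrACA subrr add0r.
  exact: norm2_triangle.
apply: (le_trans h3); rewrite (norm2_distC hK) mulrDl; apply: lerD.
  apply: (le_trans h1); rewrite exprS; apply: ler_wpM2l => //.
  by case/andP: h01 => h0 h1'; rewrite ler_piMl ?exprn_ge0// ltW.
apply: (le_trans h2); rewrite le_eqVlt; apply/orP; left; apply/eqP; ring.
Qed.

End Control.

(** * A discrete Gronwall lemma *)

Section Gronwall.
Context {R : realType}.

Lemma le0_harmonic (a c : R) : (forall n, a * n.+1%:R <= c) -> a <= 0.
Proof.
move=> h; rewrite leNgt; apply/negP => a0.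
have := h (Num.truncn (c / a)); apply/negP; rewrite -ltNge mulrC -ltr_pdivrMr//.
exact: truncnS_gt.
Qed.

(** The error terms quadratic in the increments of [V] disappear as the partition of
  [0, T] is refined. Its points are chosen so that [V] has equal increments. *)
Lemma discrete_gronwall (T L A C : R) (V phi : R -> R) :
  0 <= T -> 0 <= L -> 0 <= A -> 0 <= C ->
  {within `[0, T], continuous V} -> V 0 = 0 ->
  (forall s t, 0 <= s -> s <= t -> t <= T -> V s <= V t) ->
  (forall t, 0 <= phi t) ->
  (forall s t, 0 <= s -> s <= t -> t <= T -> phi t <= phi s +
     L * (V t - V s) * phi s + A * (V t - V s) + C * (V t - V s) ^+ 2) ->
  L * V T <= 2^-1 ->
  phi T <= 2 * (phi 0 + A * V T).
Proof.
move=> T0 L0 A0 C0 Vc V0 Vm phi0 step LV.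
have VT : 0 <= V T by rewrite -V0; exact: Vm.
have [VTz|VTn] := eqVneq (V T) 0.
  have := step 0 T (lexx _) T0 (lexx _); rewrite V0 VTz subrr expr0n /= !mulr0 mul0r !addr0.
  by have := phi0 0; clear; lra.
have VTp : 0 < V T by rewrite lt_neqAle eq_sym VTn.
rewrite -subr_le0; apply: (le0_harmonic (c := 2 * C * V T ^+ 2)) => n.
pose N : R := n.+1%:R; have N0 : 0 < N by rewrite ltr0n.
pose dl := V T / N; have dl0 : 0 < dl by rewrite divr_gt0.
have pt (i : nat) : exists s, (i <= n.+1)%N -> 0 <= s <= T /\ V s = i%:R * dl.
  case: (leqP i n.+1) => [iN|_]; last by exists 0.
  have [|s] := @IVT R V 0 T (i%:R * dl) T0 Vc.
    rewrite V0 (min_idPl VT) (max_idPr VT); apply/andP; split.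
      by rewrite mulr_ge0 ?ler0n// ltW.
    by rewrite /dl mulrCA ler_piMr// ler_pdivrMr// mul1r ler_nat.
  by rewrite in_itv /= => sT Vs; exists s.
pose t_ i := if i == 0%N then 0 else if i == n.+1 then T else projT1 (cid (pt i)).
have NV : N * dl = V T by rewrite /dl mulrC divfK// lt0r_neq0.
have tP i : (i <= n.+1)%N -> 0 <= t_ i <= T /\ V (t_ i) = i%:R * dl.
  rewrite /t_; case: eqVneq => [->|i0] iN; first by rewrite lexx T0 V0 mul0r.
  case: eqVneq => [->|_]; first by rewrite T0 lexx; split => //; rewrite -NV.
  exact: (projT2 (cid (pt i)) iN).
have tmono i : (i < n.+1)%N -> t_ i <= t_ i.+1.
  move=> iN; have [/andP[ti0 tiT] Vi] := tP i (ltnW iN); have [/andP[tj0 tjT] Vj] := tP i.+1 iN.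
  rewrite leNgt; apply/negP => h; have := Vm _ _ tj0 (ltW h) tiT.
  by rewrite Vi Vj ler_pM2r// ler_nat ltnn.
pose B := A + C * dl; have B0 : 0 <= B by rewrite addr_ge0// mulr_ge0// ltW.
have main i : (i <= n.+1)%N ->
    phi (t_ i) <= phi 0 * (1 + 2 * i%:R * (L * dl)) + 2 * i%:R * (dl * B).
  elim: i => [|i IH] iN.
    by rewrite /t_ eqxx mulr0 !mul0r !addr0 mulr1.
  have [/andP[ti0 tiT] Vi] := tP i (ltnW iN); have [/andP[tj0 tjT] Vj] := tP i.+1 iN.
  have := step _ _ ti0 (tmono i iN) tjT; rewrite Vi Vj -mulrBl -natrB// subSnn mul1r.
  have := IH (ltnW iN).
  have iL : 2 * i%:R * (L * dl) <= 1.
    apply: (@le_trans _ _ (2 * (L * V T))); last by move: LV; clear; lra.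
    rewrite -mulrA ler_pM2l// -NV mulrCA; apply: ler_wpM2l => //.
    by apply: ler_wpM2r; [exact: ltW|rewrite ler_nat ltnW].
  have p0 := phi0 0; have Ld : 0 <= L * dl by rewrite mulr_ge0// ltW.
  have dB : 0 <= dl * B by rewrite mulr_ge0// ltW.
  rewrite -natr1; set k : R := i%:R in iL *; have k0 : 0 <= k by rewrite ler0n.
  have eB : A * dl + C * dl ^+ 2 = dl * B by rewrite /B; ring.
  set l := L * dl in iL Ld *; set q := dl * B in dB eB *.
  set a := phi 0 in p0 *; set x := phi (t_ i) => hx.
  have -> : x + l * x + A * dl + C * dl ^+ 2 = x + l * x + q by rewrite -eB; ring.
  move=> /le_trans; apply.
  have h1 : l * x <= l * (a * (1 + 2 * k * l) + 2 * k * q) by apply: ler_wpM2l.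
  have h2 : a * (2 * k * l) <= a by rewrite ler_piMr.
  have h3 : l * (a * (2 * k * l)) <= l * a by apply: ler_wpM2l.
  have h4 : q * (2 * k * l) <= q by rewrite ler_piMr.
  move: hx h1 h3 h4; clear; lra.
have tN : t_ n.+1 = T by rewrite /t_ /= eqxx.
have := main n.+1 (leqnn _); rewrite tN -/N => H.
have LVN : 2 * N * (L * dl) <= 1.
  have -> : 2 * N * (L * dl) = 2 * (L * V T) by rewrite -NV; ring.
  by move: LV; clear; lra.
have h2 : phi 0 * (2 * N * (L * dl)) <= phi 0 by rewrite ler_piMr.
have h3 : 2 * N * (dl * B) = 2 * (A * V T) + 2 * C * V T * dl by rewrite /B -NV; ring.
have h4 : phi T - 2 * (phi 0 + A * V T) <= 2 * C * V T * dl.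
  move: H h2; rewrite h3; clear; lra.
apply: (le_trans (ler_wpM2r (ltW N0) h4)).
have -> : 2 * C * V T * dl * N = 2 * C * V T * (N * dl) by ring.
by rewrite NV expr2 !mulrA.
Qed.

End Gronwall.

(** * Comparison of neighbouring flows *)

Section Jets.
Context {R : realType} {K : scalar_field R}.
Hypothesis hK : K = real_scalars R \/ K = complex_scalars R.
Context {d : nat}.
Local Notation V := 'rV[K]_d.
Implicit Types (v w : R -> V) (a b : R -> K).

(** Differentiability on [0, 1] with a derivative [v'] and a remainder which is
  quadratic uniformly in time: the form in which it enters the Gronwall lemma. *)
Definition jet v v' : Prop := exists2 C : R, 0 <= C &
  (forall t, 0 <= t <= 1 -> norm2 (v t) <= C /\ norm2 (v' t) <= C) /\
  (forall s t, 0 <= s -> s <= t -> t <= 1 ->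
    norm2 (v t - v s - inj (t - s) *: v' s) <= C * (t - s) ^+ 2).

Definition jetK a a' : Prop := exists2 C : R, 0 <= C &
  (forall t, 0 <= t <= 1 -> abs (a t) <= C /\ abs (a' t) <= C) /\
  (forall s t, 0 <= s -> s <= t -> t <= 1 ->
    abs (a t - a s - inj (t - s) * a' s) <= C * (t - s) ^+ 2).

Lemma jet_lip v v' : jet v v' -> exists2 C : R, 0 <= C & forall s t,
  0 <= s -> s <= t -> t <= 1 -> norm2 (v t - v s) <= C * (t - s).
Proof.
move=> [C C0 [Cb Ch]]; exists (2 * C) => [|s t s0 st t1]; first by rewrite mulr_ge0.
have s1 : 0 <= s <= 1 by rewrite s0 (le_trans st).
have h0 : 0 <= t - s by rewrite subr_ge0.
have h1 : t - s <= 1 by lra.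
have := norm2D hK (v t - v s - inj (t - s) *: v' s) (inj (t - s) *: v' s).
rewrite subrK (norm2Z hK) (abs_inj hK) ger0_norm// => /le_trans; apply.
have e1 : C * (t - s) ^+ 2 <= C * (t - s) by rewrite ler_wpM2l// expr2 ler_piMl.
have e2 : (t - s) * norm2 (v' s) <= (t - s) * C by rewrite ler_wpM2l//; case: (Cb s s1).
have := lerD (Ch s t s0 st t1) e2; move: e1; clear; lra.
Qed.

Lemma jetK_lip a a' : jetK a a' -> exists2 C : R, 0 <= C & forall s t,
  0 <= s -> s <= t -> t <= 1 -> abs (a t - a s) <= C * (t - s).
Proof.
move=> [C C0 [Cb Ch]]; exists (2 * C) => [|s t s0 st t1]; first by rewrite mulr_ge0.
have s1 : 0 <= s <= 1 by rewrite s0 (le_trans st).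
have h0 : 0 <= t - s by rewrite subr_ge0.
have h1 : t - s <= 1 by lra.
have := absD hK (a t - a s - inj (t - s) * a' s) (inj (t - s) * a' s).
rewrite subrK (absM hK) (abs_inj hK) ger0_norm// => /le_trans; apply.
have e1 : C * (t - s) ^+ 2 <= C * (t - s) by rewrite ler_wpM2l// expr2 ler_piMl.
have e2 : (t - s) * abs (a' s) <= (t - s) * C by rewrite ler_wpM2l//; case: (Cb s s1).
have := lerD (Ch s t s0 st t1) e2; move: e1; clear; lra.
Qed.

Lemma jetD v v' w w' : jet v v' -> jet w w' -> jet (fun t => v t + w t) (fun t => v' t + w' t).
Proof.
move=> [C C0 [Cb Ch]] [D D0 [Db Dh]]; exists (C + D); first exact: addr_ge0.
split=> [t tT|s t s0 st t1].
  have [c1 c2] := Cb t tT; have [d1 d2] := Db t tT.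
  by split; apply: (le_trans (norm2D hK _ _)); apply: lerD.
have -> : v t + w t - (v s + w s) - inj (t - s) *: (v' s + w' s) =
    (v t - v s - inj (t - s) *: v' s) + (w t - w s - inj (t - s) *: w' s).
  by apply/rowP => k; rewrite !mxE; ring.
by apply: (le_trans (norm2D hK _ _)); rewrite mulrDl; apply: lerD; [exact: Ch|exact: Dh].
Qed.

Lemma jet0 : jet (fun=> 0) (fun=> 0).
Proof.
exists 0 => //; split=> [t _|s t _ _ _]; first by rewrite (norm2_0 hK).
by rewrite subr0 scaler0 subr0 (norm2_0 hK) mul0r.
Qed.

Lemma jet_sum n (v v' : nat -> R -> V) : (forall m, (m < n)%N -> jet (v m) (v' m)) ->
  jet (fun t => \sum_(m < n) v m t) (fun t => \sum_(m < n) v' m t).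
Proof.
elim: n => [|n IH] h.
  have e (w : nat -> R -> V) : (fun t => \sum_(m < 0) w m t) = fun=> 0.
    by apply/funext => t; rewrite big_ord0.
  rewrite !e; exact: jet0.
have e (w : nat -> R -> V) : (fun t => \sum_(m < n.+1) w m t) =
    fun t => \sum_(m < n) w m t + w n t.
  by apply/funext => t; rewrite big_ord_recr.
rewrite !e; apply: jetD; last exact: h.
by apply: IH => m mn; apply: h; rewrite ltnS ltnW.
Qed.

Lemma jetZ a a' v v' : jetK a a' -> jet v v' ->
  jet (fun t => a t *: v t) (fun t => a' t *: v t + a t *: v' t).
Proof.
move=> ja jv; have [A A0 Al] := jetK_lip ja; have [B B0 Bl] := jet_lip jv.
move: ja jv => [C C0 [Cb Ch]] [D D0 [Db Dh]].
have CD : 0 <= C * D by rewrite mulr_ge0.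
exists (2 * (C * D) + A * B); first by rewrite addr_ge0 ?mulr_ge0.
have bd (x y : R) : 0 <= x -> 0 <= y -> x <= C -> y <= D -> x * y <= C * D.
  by move=> *; apply: ler_pM.
split=> [t tT|s t s0 st t1].
  have [c1 c2] := Cb t tT; have [d1 d2] := Db t tT.
  have AB : 0 <= A * B by rewrite mulr_ge0.
  split; last first.
    apply: (le_trans (norm2D hK _ _)); rewrite !(norm2Z hK).
    have := bd _ _ (abs_ge0 hK _) (norm2_ge0 _) c2 d1.
    have := bd _ _ (abs_ge0 hK _) (norm2_ge0 _) c1 d2.
    by move: AB; clear; lra.
  rewrite (norm2Z hK); have := bd _ _ (abs_ge0 hK _) (norm2_ge0 _) c1 d1.
  by move: AB CD; clear; lra.
have s1 : 0 <= s <= 1 by rewrite s0 (le_trans st).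
have [c1 c2] := Cb s s1; have [d1 d2] := Db s s1.
have -> : a t *: v t - a s *: v s - inj (t - s) *: (a' s *: v s + a s *: v' s) =
    (a t - a s - inj (t - s) * a' s) *: v s + a s *: (v t - v s - inj (t - s) *: v' s)
    + (a t - a s) *: (v t - v s).
  by apply/rowP => k; rewrite !mxE; ring.
apply: (le_trans (norm2D hK _ _)); apply: (le_trans (lerD (norm2D hK _ _) (lexx _))).
rewrite !(norm2Z hK).
have e1 : abs (a t - a s - inj (t - s) * a' s) * norm2 (v s) <= C * (t - s) ^+ 2 * D.
  by apply: ler_pM; rewrite ?(abs_ge0 hK) ?norm2_ge0//; exact: Ch.
have e2 : abs (a s) * norm2 (v t - v s - inj (t - s) *: v' s) <= C * (D * (t - s) ^+ 2).
  by apply: ler_pM; rewrite ?(abs_ge0 hK) ?norm2_ge0//; exact: Dh.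
have e3 : abs (a t - a s) * norm2 (v t - v s) <= (A * (t - s)) * (B * (t - s)).
  by apply: ler_pM; rewrite ?(abs_ge0 hK) ?norm2_ge0//; [exact: Al|exact: Bl].
apply: (le_trans (lerD (lerD e1 e2) e3)).
by rewrite le_eqVlt; apply/orP; left; apply/eqP; ring.
Qed.

Lemma jetK_M a a' b b' : jetK a a' -> jetK b b' ->
  jetK (fun t => a t * b t) (fun t => a' t * b t + a t * b' t).
Proof.
move=> ja jv; have [A A0 Al] := jetK_lip ja; have [B B0 Bl] := jetK_lip jv.
move: ja jv => [C C0 [Cb Ch]] [D D0 [Db Dh]].
have CD : 0 <= C * D by rewrite mulr_ge0.
exists (2 * (C * D) + A * B); first by rewrite addr_ge0 ?mulr_ge0.
have bd (x y : R) : 0 <= x -> 0 <= y -> x <= C -> y <= D -> x * y <= C * D.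
  by move=> *; apply: ler_pM.
split=> [t tT|s t s0 st t1].
  have [c1 c2] := Cb t tT; have [d1 d2] := Db t tT.
  have AB : 0 <= A * B by rewrite mulr_ge0.
  split; last first.
    apply: (le_trans (absD hK _ _)); rewrite !(absM hK).
    have := bd _ _ (abs_ge0 hK _) (abs_ge0 hK _) c2 d1.
    have := bd _ _ (abs_ge0 hK _) (abs_ge0 hK _) c1 d2.
    by move: AB; clear; lra.
  rewrite (absM hK); have := bd _ _ (abs_ge0 hK _) (abs_ge0 hK _) c1 d1.
  by move: AB CD; clear; lra.
have s1 : 0 <= s <= 1 by rewrite s0 (le_trans st).
have [c1 c2] := Cb s s1; have [d1 d2] := Db s s1.
have -> : a t * b t - a s * b s - inj (t - s) * (a' s * b s + a s * b' s) =
    (a t - a s - inj (t - s) * a' s) * b s + a s * (b t - b s - inj (t - s) * b' s)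
    + (a t - a s) * (b t - b s).
  by ring.
apply: (le_trans (absD hK _ _)); apply: (le_trans (lerD (absD hK _ _) (lexx _))).
rewrite !(absM hK) -(absM hK).
have e1 : abs (a t - a s - inj (t - s) * a' s) * abs (b s) <= C * (t - s) ^+ 2 * D.
  by apply: ler_pM; rewrite ?(abs_ge0 hK)//; exact: Ch.
have e2 : abs (a s) * abs (b t - b s - inj (t - s) * b' s) <= C * (D * (t - s) ^+ 2).
  by apply: ler_pM; rewrite ?(abs_ge0 hK)//; exact: Dh.
have e3 : abs (a t - a s) * abs (b t - b s) <= (A * (t - s)) * (B * (t - s)).
  by apply: ler_pM; rewrite ?(abs_ge0 hK)//; [exact: Al|exact: Bl].
rewrite -?(absM hK) ?(absM hK); apply: (le_trans (lerD (lerD e1 e2) e3)).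
by rewrite le_eqVlt; apply/orP; left; apply/eqP; ring.
Qed.

Lemma jetK_affine (p q : K) : jetK (fun t => p + inj t * q) (fun=> q).
Proof.
exists (abs p + abs q); first by rewrite addr_ge0 ?(abs_ge0 hK).
split=> [t /andP[t0 t1]|s t s0 st t1].
  split; last by rewrite lerDr (abs_ge0 hK).
  apply: (le_trans (absD hK _ _)); rewrite lerD2l (absM hK) (abs_inj hK) ger0_norm//.
  by rewrite ler_piMl// (abs_ge0 hK).
have -> : p + inj t * q - (p + inj s * q) - inj (t - s) * q = 0.
  by rewrite (injD hK) (injN hK); ring.
by rewrite (abs0 hK) mulr_ge0 ?sqr_ge0// addr_ge0 ?(abs_ge0 hK).
Qed.

Lemma jet_regular rho N Q f Df v v' : 0 <= N -> 0 <= Q -> regular rho N Q f Df ->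
  (forall t, 0 <= t <= 1 -> cball rho (v t)) -> jet v v' ->
  jet (fun t => f (v t)) (fun t => Df (v t) (v' t)).
Proof.
move=> N0 Q0 rf vb jv; have [B B0 Bl] := jet_lip jv.
move: jv => [C C0 [Cb Ch]].
have NC : 0 <= N * C by rewrite mulr_ge0.
exists (N + N * C + Q * B ^+ 2); first by rewrite !addr_ge0 ?mulr_ge0 ?sqr_ge0.
have QB : 0 <= Q * B ^+ 2 by rewrite mulr_ge0 ?sqr_ge0.
split=> [t tT|s t s0 st t1].
  have vt := vb t tT; have [c1 c2] := Cb t tT.
  split; first by have := reg_bound rf vt; move: NC QB; clear; lra.
  apply: (le_trans (reg_dbound rf (v' t) vt)).
  by have := ler_wpM2l N0 c2; move: N0 QB; clear; lra.
have s1 : 0 <= s <= 1 by rewrite s0 (le_trans st).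
have t1' : 0 <= t <= 1 by rewrite t1 (le_trans s0).
have vs := vb s s1; have vt := vb t t1'.
have lin := reg_linear rf vs.
have linB (b : K) (y z : V) : Df (v s) (y - b *: z) = Df (v s) y - b *: Df (v s) z.
  by rewrite addrC -scaleNr lin scaleNr addrC.
have -> : f (v t) - f (v s) - inj (t - s) *: Df (v s) (v' s) =
    (f (v t) - f (v s) - Df (v s) (v t - v s)) +
    Df (v s) (v t - v s - inj (t - s) *: v' s).
  by rewrite linB; apply/rowP => k; rewrite !mxE; ring.
apply: (le_trans (norm2D hK _ _)).
have e1 : Q * norm2 (v t - v s) ^+ 2 <= Q * (B * (t - s)) ^+ 2.
  have b0 : 0 <= B * (t - s) by rewrite mulr_ge0// subr_ge0.
  by apply: ler_wpM2l => //; apply: lerXn2r; rewrite ?nnegrE ?norm2_ge0//; exact: Bl.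
have e2 := reg_quad rf vs vt.
have e3 := reg_dbound rf (v t - v s - inj (t - s) *: v' s) vs.
have e4 := ler_wpM2l N0 (Ch s t s0 st t1).
have e5 : 0 <= N * (t - s) ^+ 2 by rewrite mulr_ge0 ?sqr_ge0.
rewrite exprMn in e1.
apply: (le_trans (lerD (le_trans e2 e1) (le_trans e3 e4))).
move: e5; set q := (t - s) ^+ 2; clear; lra.
Qed.

(** The coefficients of the exponential series of the adjoint action. *)
Definition exp_coef (z : K) m : K := (m`!)%:R^-1 * z ^+ m.

Lemma exp_coefS (z : K) m : exp_coef z m.+1 = exp_coef z m * ((m.+1)%:R^-1 * z).
Proof.
rewrite /exp_coef factS natrM exprS invfM; ring.
Qed.

Lemma jetK_exp_coef (z : K) m : jetK (fun t => exp_coef (inj (1 - t) * z) m)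
  (fun t => if m is m'.+1 then - z * exp_coef (inj (1 - t) * z) m' else 0).
Proof.
elim: m => [|m IH].
  have := jetK_affine 1 0; congr jetK; apply/funext => t.
  by rewrite mulr0 addr0 /exp_coef fact0 invr1 expr0 mulr1.
have := jetK_M IH (jetK_affine (m.+1%:R^-1 * z) (- (m.+1%:R^-1 * z))).
have m0 : m.+1%:R != 0 :> K by rewrite pnatr_eq0.
have aff t : m.+1%:R^-1 * z + inj t * - (m.+1%:R^-1 * z) = m.+1%:R^-1 * (inj (1 - t) * z).
  by rewrite (injD hK) (injN hK) (inj1 hK); ring.
congr jetK; apply/funext => t; rewrite aff ?exp_coefS//.
case: m {IH aff} m0 => [|m] m0; first by rewrite mul0r add0r invr1 mul1r mulrC.
have a0 : m.+1%:R != 0 :> K by rewrite pnatr_eq0.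
rewrite exp_coefS; move: m0 a0; rewrite -(natr1 m.+1).
move: (m.+1%:R : K) (exp_coef _ _) => a c m0 a0; field.
by rewrite a0 m0.
Qed.

End Jets.

Section Flows.
Context {R : realType} {K : scalar_field R}.
Hypothesis hK : K = real_scalars R \/ K = complex_scalars R.
Context {d : nat}.
Local Notation V := 'rV[K]_d.
Implicit Types (x y z v p : V) (f g : V -> V).

Section OneFlow.
Context (rho N L : R) (g : V -> V).
Hypothesis L0 : 0 <= L.
Hypothesis gN : forall x, cball rho x -> norm2 (g x) <= N.
Hypothesis gL : forall x y, cball rho x -> cball rho y -> norm2 (g y - g x) <= L * norm2 (y - x).

(* A flow is the control system of a single field, with the control 1. *)
Let f1 (_ : unit) := g.
Let u1 (_ : unit) (_ : R) : K := 1.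

Lemma flow_control : (fun=> g) = control_field f1 u1.
Proof.
apply/funext => s; apply/funext => y.
by rewrite /control_field (big_pred1 tt) => [|[]//]; rewrite scale1r.
Qed.

Lemma variation1 t : 0 <= t -> variation u1 t = t.
Proof.
move=> t0; rewrite /variation -[RHS]mul1r -(prim_cst 1 t0); apply: eq_Rintegral => s _.
by rewrite (big_pred1 tt) => [|[]//]; rewrite (abs1 hK).
Qed.

Let integ1 i : integK 1 (u1 i).
Proof. exact: integK_cst. Qed.

Lemma flow_start p (x : R -> V) : solution rho 1 (fun=> g) p x -> x 0 = p.
Proof. by rewrite flow_control; apply: (solution_start hK) => //; exact: ler01. Qed.

Lemma flow_ball p (x : R -> V) t : solution rho 1 (fun=> g) p x -> 0 <= t <= 1 -> cball rho (x t).
Proof. by move=> [_ xb _] t1; apply: xb; rewrite in_itv. Qed.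

Lemma flow_incr p (x : R -> V) s t : solution rho 1 (fun=> g) p x ->
  0 <= s -> s <= t -> t <= 1 -> norm2 (x t - x s) <= d%:R * (2 * N * (t - s)).
Proof.
rewrite flow_control => xs s0 st t1.
have := solution_incr hK integ1 (fun _ => gN) (fun _ => gL) xs s0 st t1.
by rewrite !variation1// (le_trans s0).
Qed.

Lemma flow_incr2 p (x : R -> V) s t : solution rho 1 (fun=> g) p x ->
  0 <= s -> s <= t -> t <= 1 -> norm2 (x t - x s - inj (t - s) *: g (x s)) <=
    d%:R * (2 * (L * (d%:R * (2 * N * (t - s)))) * (t - s)).
Proof.
rewrite flow_control => xs s0 st t1.
have := solution_incr2 hK L0 integ1 (fun _ => gN) (fun _ => gL) xs s0 st t1.
rewrite !variation1 ?(le_trans s0)// (big_pred1 tt) => [|[]//].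
by rewrite /u1 !int0_cst ?(le_trans s0)// !mulr1 -(injN hK) -(injD hK).
Qed.

Lemma flow_jet p (x : R -> V) : 0 <= N -> solution rho 1 (fun=> g) p x ->
  jet x (fun t => g (x t)).
Proof.
move=> N0 xs; have LN : 0 <= d%:R * (2 * (L * (d%:R * (2 * N)))) by rewrite !mulr_ge0.
have r0 : 0 <= rho.
  have := flow_ball xs (introT andP (conj (lexx (0 : R)) ler01)).
  by apply: le_trans; exact: norm2_ge0.
exists (rho + N + d%:R * (2 * (L * (d%:R * (2 * N))))); first by rewrite !addr_ge0.
split=> [t t1|s t s0 st t1].
  have xb := flow_ball xs t1; split; first by apply: (le_trans xb); rewrite -addrA lerDl addr_ge0.
  by apply: (le_trans (gN xb)); rewrite addrAC lerDr addr_ge0.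
apply: (le_trans (flow_incr2 xs s0 st t1)).
have q0 := sqr_ge0 (t - s); have NR : 0 <= rho + N by rewrite addr_ge0.
rewrite [leRHS]mulrDl; have -> : d%:R * (2 * (L * (d%:R * (2 * N * (t - s)))) * (t - s)) =
  d%:R * (2 * (L * (d%:R * (2 * N)))) * (t - s) ^+ 2 by ring.
by rewrite lerDr mulr_ge0.
Qed.

Lemma flow_exists p : 0 <= N -> d%:R * (2 * L) <= 2^-1 -> norm2 p + d%:R * (2 * N) <= rho ->
  exists x : R -> V, solution rho 1 (fun=> g) p x.
Proof.
move=> N0 small stay; rewrite flow_control.
apply: (solution_exists hK ler01 L0 integ1 (fun _ => gN) (fun _ => gL)) => //.
  by rewrite variation1// mulr1.
by rewrite variation1// mulr1.
Qed.

End OneFlow.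

Section Conjugation.
Context (rho Ng Qg : R) (g : V -> V) (Dg : V -> V -> V).
Hypothesis Ng0 : 0 <= Ng.
Hypothesis Qg0 : 0 <= Qg.
Hypothesis rg : regular rho Ng Qg g Dg.

Lemma regular_linearD f Df N Q y u v : regular rho N Q f Df -> cball rho y ->
  Df y (u + v) = Df y u + Df y v.
Proof. by move=> rf hy; have := reg_linear rf hy 1 u v; rewrite !scale1r. Qed.

Lemma regular_linear0 f Df N Q y : regular rho N Q f Df -> cball rho y -> Df y 0 = 0.
Proof.
move=> rf hy; have := regular_linearD 0 0 rf hy; rewrite addr0 => /eqP.
by rewrite -subr_eq0 opprD addrA subrr sub0r oppr_eq0 => /eqP.
Qed.

Lemma regular_linearZ f Df N Q y (a : K) v : regular rho N Q f Df -> cball rho y ->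
  Df y (a *: v) = a *: Df y v.
Proof.
by move=> rf hy; have := reg_linear rf hy a v 0; rewrite !addr0 (regular_linear0 rf hy) addr0.
Qed.

Lemma regular_linear_sum f Df N Q y n (v : nat -> V) : regular rho N Q f Df -> cball rho y ->
  Df y (\sum_(m < n) v m) = \sum_(m < n) Df y (v m).
Proof.
move=> rf hy; elim: n => [|n IH]; first by rewrite !big_ord0 (regular_linear0 rf hy).
by rewrite !big_ord_recr /= (regular_linearD _ _ rf hy) IH.
Qed.

Context (n : nat) (h r : nat -> V -> V) (Dh : nat -> V -> V -> V) (Nh Qh rem : nat -> R).
Hypothesis n0 : (0 < n)%N.
Hypothesis rh : forall m, (m < n)%N -> [/\ 0 <= Nh m, 0 <= Qh m &
  regular rho (Nh m) (Qh m) (h m) (Dh m)].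
Hypothesis hn : forall y, cball rho y -> h n y = 0.
Hypothesis lie_h : forall m y, (m < n)%N -> cball rho y ->
  Dh m y (g y) - Dg y (h m y) = h m.+1 y + r m y.
Hypothesis r_rem : forall m y, (m < n)%N -> cball rho y -> norm2 (r m y) <= rem m.
Context (xi0 xi1 : K) (X S c e sg : R).
Hypothesis xi0X : abs xi0 <= X.
Hypothesis xi1X : abs xi1 <= X.
Hypothesis xi1N : abs xi1 * Ng <= 2^-1.
Hypothesis DS : abs (xi1 - xi0) <= S.
Hypothesis hS : forall m y, (m < n)%N -> cball rho y -> norm2 (h m y) <= c * S.
Hypothesis eP : \sum_(m < n) abs xi0 ^+ m.+1 * rem m <= e.
Hypothesis sg1 : abs (xi1 - xi0) * Ng <= sg.
Hypothesis sgh : forall m y, (m < n)%N -> cball rho y -> abs xi0 ^+ m * norm2 (h m y) <= sg.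

Lemma abs_exp_coef (z : K) m : abs (exp_coef z m) <= abs z ^+ m.
Proof.
rewrite /exp_coef (absM hK) (absX hK) (absV hK) (abs_nat hK).
by rewrite ler_piMl ?exprn_ge0 ?(abs_ge0 hK)// invf_le1 ?ler1n ?ltr0n fact_gt0.
Qed.

(** [e^(xi1 g) (y + sum_m xi0^m / m! h_m y)] is [e^(xi0 g) y + (xi1 - xi0) g + h_0] up
  to second order, where [h_m] is the [m]-th bracket of [h_0] with [g]. Both sides are
  values at time 1 of curves starting from the same point: the flow of [xi1 g], and the
  flow [x] of [xi0 g] corrected by [t (xi1 - xi0) g + sum_m ((1 - t) xi0)^m / m! h_m],
  which nearly solves the same equation. This is the adjoint action of a flow, without
  differentiating it with respect to its initial value. *)
Lemma conjugation_step x0 x1 (x y : R -> V) :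
  solution rho 1 (fun=> fun z => xi0 *: g z) x0 x ->
  solution rho 1 (fun=> fun z => xi1 *: g z) x1 y ->
  (forall t, 0 <= t <= 1 -> norm2 (x t) + n.+1%:R * sg <= rho) ->
  forall c1, c1 = Ng + c * \sum_(m < n) X ^+ m ->
  norm2 (y 1 - (x 1 + (xi1 - xi0) *: g (x 1) + h 0%N (x 1))) <=
    2 * (norm2 (x1 - (x0 + \sum_(m < n) exp_coef xi0 m *: h m x0)) +
      (e + (Ng * c1 + X * Qg * c1 ^+ 2) * S ^+ 2)).
Proof.
move=> xs ys stay c1 c1E.
have X0 : 0 <= X := le_trans (abs_ge0 hK _) xi0X.
have S0 : 0 <= S := le_trans (abs_ge0 hK _) DS.
have xb t : 0 <= t <= 1 -> cball rho (x t) by move=> t1; exact: flow_ball xs t1.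
have yb t : 0 <= t <= 1 -> cball rho (y t) by move=> t1; exact: flow_ball ys t1.
have zero1 : 0 <= (0 : R) <= 1 by rewrite lexx ler01.
have one1 : 0 <= (1 : R) <= 1 by rewrite lexx ler01.
have cS0 : 0 <= c * S by apply: le_trans (hS n0 (xb 0 zero1)); exact: norm2_ge0.
pose D := xi1 - xi0.
pose cf m t : K := exp_coef (inj (1 - t) * xi0) m.
pose cf' m t : K := if m is m'.+1 then - xi0 * cf m' t else 0.
pose w t := x t + ((0 + inj t * D) *: g (x t) + \sum_(m < n) cf m t *: h m (x t)).
have cfX m t : 0 <= t <= 1 -> abs (cf m t) <= abs xi0 ^+ m.
  move=> /andP[t0 t1]; apply: (le_trans (abs_exp_coef _ _)).
  apply: lerXn2r; rewrite ?nnegrE ?(abs_ge0 hK)// (absM hK) (abs_inj hK).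
  rewrite ger0_norm ?subr_ge0//; rewrite ler_piMl ?(abs_ge0 hK)//; lra.
have aD t : 0 <= t <= 1 -> abs (0 + inj t * D) <= abs D.
  move=> /andP[t0 t1]; rewrite add0r (absM hK) (abs_inj hK) ger0_norm//.
  by rewrite ler_piMl// (abs_ge0 hK).
have wx t : 0 <= t <= 1 -> norm2 (w t - x t) <= c1 * S.
  move=> t1; rewrite /w addrC addKr; apply: (le_trans (norm2D hK _ _)).
  rewrite c1E mulrDl; apply: lerD.
    rewrite (norm2Z hK) mulrC; apply: ler_pM; rewrite ?norm2_ge0 ?(abs_ge0 hK)//.
      by apply: (reg_bound rg); exact: xb.
    exact: le_trans (aD t t1) DS.
  apply: (le_trans (norm2_sum hK _ _ _)); rewrite mulrAC mulr_sumr; apply: ler_sum => m _.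
  rewrite (norm2Z hK) mulrC; apply: ler_pM; rewrite ?norm2_ge0 ?(abs_ge0 hK)//.
    by apply: hS => //; exact: xb.
  apply: (le_trans (cfX m t t1)); apply: lerXn2r; rewrite ?nnegrE ?(abs_ge0 hK)//.
have wb t : 0 <= t <= 1 -> cball rho (w t).
  move=> t1; apply: le_trans (stay t t1).
  apply: (le_trans (norm2D hK _ _)); rewrite lerD2l; apply: (le_trans (norm2D hK _ _)).
  rewrite -natr1 mulrDl mul1r addrC; apply: lerD.
    apply: (le_trans (norm2_sum hK _ _ _)); apply: (@le_trans _ _ (\sum_(m < n) sg)).
      apply: ler_sum => m _; rewrite (norm2Z hK).
      apply: le_trans (sgh (ltn_ord m) (xb t t1)); apply: ler_wpM2r; first exact: norm2_ge0.
      exact: cfX.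
    by rewrite sumr_const card_ord mulr_natl.
  apply: le_trans sg1; rewrite (norm2Z hK); apply: ler_pM; rewrite ?norm2_ge0 ?(abs_ge0 hK)//.
    exact: aD.
  by apply: (reg_bound rg); exact: xb.
pose w' t := xi0 *: g (x t) + ((D *: g (x t) + (0 + inj t * D) *: Dg (x t) (xi0 *: g (x t))) +
  \sum_(m < n) (cf' m t *: h m (x t) + cf m t *: Dh m (x t) (xi0 *: g (x t)))).
have rxi (z : K) : regular rho (abs z * Ng) (abs z * Qg) (fun y => z *: g y)
    (fun y v => z *: Dg y v) by exact: regularZ.
have aN (z : K) : 0 <= abs z * Ng by rewrite mulr_ge0// (abs_ge0 hK).
have jx : jet x (fun t => xi0 *: g (x t)).
  exact: (flow_jet (aN xi0) (reg_bound (rxi xi0)) (reg_lip (rxi xi0)) (aN xi0) xs).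
have jy : jet y (fun t => xi1 *: g (y t)).
  exact: (flow_jet (aN xi1) (reg_bound (rxi xi1)) (reg_lip (rxi xi1)) (aN xi1) ys).
have jw : jet w w'.
  apply: (jetD hK jx); apply: (jetD hK).
    exact: (jetZ hK (jetK_affine hK 0 D) (jet_regular hK Ng0 Qg0 rg xb jx)).
  apply: (jet_sum hK (v := fun m t => cf m t *: h m (x t))
    (v' := fun m t => cf' m t *: h m (x t) + cf m t *: Dh m (x t) (xi0 *: g (x t)))) => m mn.
  have [N0 Q0 rm] := rh mn.
  exact: (jetZ hK (jetK_exp_coef hK xi0 m) (jet_regular hK N0 Q0 rm xb jx)).
have resid t : 0 <= t <= 1 ->
    norm2 (w' t - xi1 *: g (w t)) <= e + (Ng * c1 + X * Qg * c1 ^+ 2) * S ^+ 2.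
  move=> t1; have xt := xb t t1; have wt := wb t t1; have wxt := wx t t1.
  set dw := w t - x t in wxt.
  have Edw : dw = (0 + inj t * D) *: g (x t) + \sum_(m < n) cf m t *: h m (x t).
    by rewrite /dw /w addrC addKr.
  pose rr := g (w t) - g (x t) - Dg (x t) dw.
  have sumE : \sum_(m < n) (cf' m t *: h m (x t) + cf m t *: Dh m (x t) (xi0 *: g (x t))) =
      xi0 *: Dg (x t) (\sum_(m < n) cf m t *: h m (x t)) +
      \sum_(m < n) (xi0 * cf m t) *: r m (x t).
    have -> : Dg (x t) (\sum_(m < n) cf m t *: h m (x t)) =
        \sum_(m < n) cf m t *: Dg (x t) (h m (x t)).
      rewrite (regular_linear_sum n (fun m => cf m t *: h m (x t)) rg xt).
      by apply: eq_bigr => m _; rewrite (regular_linearZ _ _ rg xt).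
    rewrite scaler_sumr -big_split /=.
    have -> : \sum_(m < n) (cf' m t *: h m (x t) + cf m t *: Dh m (x t) (xi0 *: g (x t))) =
      \sum_(m < n) (xi0 *: (cf m t *: Dg (x t) (h m (x t))) + (xi0 * cf m t) *: r m (x t)) +
      \sum_(m < n) (cf' m t *: h m (x t) + (xi0 * cf m t) *: h m.+1 (x t)).
      rewrite -big_split /=; apply: eq_bigr => m _; have [_ _ rm] := rh (ltn_ord m).
      rewrite (regular_linearZ _ _ rm xt).
      have -> : Dh m (x t) (g (x t)) = h m.+1 (x t) + r m (x t) + Dg (x t) (h m (x t)).
        by rewrite -lie_h// subrK.
      by apply/rowP => k; rewrite !mxE; ring.
    rewrite [X in _ + X](_ : _ = 0) ?addr0//.
    have tele k : \sum_(m < k) (cf' m t *: h m (x t) + (xi0 * cf m t) *: h m.+1 (x t)) =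
        - cf' k t *: h k (x t).
      elim: k => [|k IH]; first by rewrite big_ord0 oppr0 scale0r.
      rewrite big_ord_recr /= IH addrA -scalerDl addNr scale0r add0r.
      by rewrite mulNr opprK.
    by rewrite tele hn// scaler0.
  have -> : w' t - xi1 *: g (w t) =
      \sum_(m < n) (xi0 * cf m t) *: r m (x t) - D *: Dg (x t) dw - xi1 *: rr.
    have e1 : Dg (x t) dw = (0 + inj t * D) *: Dg (x t) (g (x t)) +
        Dg (x t) (\sum_(m < n) cf m t *: h m (x t)).
      by rewrite Edw (regular_linearD _ _ rg xt) (regular_linearZ _ _ rg xt).
    rewrite /w' sumE (regular_linearZ _ _ rg xt) /rr e1 /D.
    move: (\sum_(m < n) (xi0 * cf m t) *: r m (x t)) => s.
    move: (Dg (x t) (\sum_(m < n) cf m t *: h m (x t))) => B.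
    move: (Dg (x t) (g (x t))) => A.
    by apply/rowP => k; rewrite !mxE; ring.
  apply: (le_trans (norm2B hK _ _)); apply: (le_trans (lerD (norm2B hK _ _) (lexx _))).
  rewrite !(norm2Z hK) mulrDl addrA; apply: lerD; first apply: lerD.
  - apply: le_trans eP; apply: (le_trans (norm2_sum hK _ _ _)); apply: ler_sum => m _.
    rewrite (norm2Z hK) (absM hK); apply: ler_pM; rewrite ?norm2_ge0 ?mulr_ge0 ?(abs_ge0 hK)//.
      by rewrite exprS; apply: ler_wpM2l; [exact: abs_ge0|exact: cfX].
    exact: r_rem.
  - have -> : Ng * c1 * S ^+ 2 = S * (Ng * (c1 * S)) by ring.
    apply: ler_pM; rewrite ?norm2_ge0 ?(abs_ge0 hK)//.
    by apply: (le_trans (reg_dbound rg dw xt)); apply: ler_wpM2l.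
  have -> : X * Qg * c1 ^+ 2 * S ^+ 2 = X * (Qg * (c1 * S) ^+ 2) by ring.
  apply: ler_pM; rewrite ?norm2_ge0 ?(abs_ge0 hK)//.
  apply: (le_trans (reg_quad rg xt wt)); apply: ler_wpM2l => //.
  have c1S : 0 <= c1 * S by apply: le_trans wxt; exact: norm2_ge0.
  by apply: lerXn2r; rewrite ?nnegrE ?norm2_ge0.
set E := e + _ in resid *.
have E0 : 0 <= E by apply: le_trans (resid 0 zero1); exact: norm2_ge0.
have [Cy Cy0 [_ Hy]] := jy; have [Cw Cw0 [_ Hw]] := jw.
have idc : {within `[0, 1], continuous (fun t : R => t)}.
  by apply: continuous_subspaceT => t; exact: cvg_id.
have := @discrete_gronwall R 1 (abs xi1 * Ng) E (Cy + Cw) id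
  (fun t => norm2 (y t - w t)) ler01 (aN xi1) E0 (addr_ge0 Cy0 Cw0) idc erefl.
rewrite !mulr1; move=> /(_ (fun s t _ st _ => st) (fun t => norm2_ge0 _)) G.
have y0 : y 0 = x1 := flow_start ys.
have x00 : x 0 = x0 := flow_start xs.
have w0 : w 0 = x0 + \sum_(m < n) exp_coef xi0 m *: h m x0.
  rewrite /w x00 (inj0 hK) mul0r addr0 scale0r add0r; congr (_ + _).
  by apply: eq_bigr => m _; rewrite /cf subr0 (inj1 hK) mul1r.
have w1 : w 1 = x 1 + (xi1 - xi0) *: g (x 1) + h 0%N (x 1).
  rewrite /w (inj1 hK) mul1r add0r addrA; congr (_ + _).
  case: (n) n0 => // n' _; rewrite big_ord_recl /cf subrr (inj0 hK) mul0r.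
  rewrite {1}/exp_coef fact0 expr0 invr1 mulr1 scale1r big1 ?addr0// => m _.
  by rewrite /exp_coef expr0n /= mulr0 scale0r.
rewrite -w0 -w1 -{1}y0; apply: G => // s t s0 st t1.
have s1 : 0 <= s <= 1 by rewrite s0 (le_trans st).
have ts : 0 <= t - s by rewrite subr_ge0.
have -> : y t - w t = (y s - w s) + inj (t - s) *: (xi1 *: (g (y s) - g (w s)))
    - inj (t - s) *: (w' s - xi1 *: g (w s))
    + ((y t - y s - inj (t - s) *: (xi1 *: g (y s))) - (w t - w s - inj (t - s) *: w' s)).
  by apply/rowP => k; rewrite !mxE; ring.
apply: (le_trans (norm2D hK _ _)); apply: lerD; last first.
  apply: (le_trans (norm2B hK _ _)); rewrite mulrDl; apply: lerD; [exact: Hy|exact: Hw].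
apply: (le_trans (norm2B hK _ _)); apply: lerD; last first.
  rewrite (norm2Z hK) (abs_inj hK) ger0_norm// mulrC; apply: ler_wpM2r => //; exact: resid.
apply: (le_trans (norm2D hK _ _)); rewrite lerD2l !(norm2Z hK) (abs_inj hK) ger0_norm//.
have := reg_lip rg (wb s s1) (yb s s1) => lip.
have -> : abs xi1 * Ng * (t - s) * norm2 (y s - w s) =
  (t - s) * (abs xi1 * (Ng * norm2 (y s - w s))) by ring.
by apply: ler_wpM2l => //; apply: ler_wpM2l => //; exact: abs_ge0.
Qed.

End Conjugation.
End Flows.

(** * Lazard elimination in a Hall set *)

Section Elimination.
Context {I : finType}.
Implicit Types (b c g v : br I) (pre suf s : seq (br I)).

Definition lead pre b : bool := if b is Node c _ then c \in pre else true.

(** The generators left once the elements of [pre] have been eliminated: the elements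
  of [suf] which are not brackets by a remaining element. *)
Definition letters pre suf : seq (br I) := [seq b <- suf | lead pre b].

Lemma blen_iter g v m : blen (iter m (Node g) v) = (m * blen g + blen v)%N.
Proof. by elim: m => // m IH; rewrite iterS /= IH mulSn addnA. Qed.

Context (B : {pred br I}) (le : rel (br I)) (hB : hall_set B le) (M : nat) (s : seq (br I)).
Hypothesis sorted_s : sorted (blt le) s.
Hypothesis mem_s : forall b, (b \in s) = (b \in B) && (blen b <= M)%N.

Lemma mem_sB b : b \in s -> b \in B.
Proof. by rewrite mem_s => /andP[]. Qed.

Lemma blt_trans : {in B & &, transitive (blt le)}.
Proof.
move=> c b d cB bB dB /andP[bc lbc] /andP[cd lcd].
rewrite /blt (hall_trans hB cB bB dB lbc lcd) andbT.
apply/eqP => e; rewrite -e in lcd; move: bc.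
by rewrite (hall_anti hB bB cB) ?eqxx// lbc lcd.
Qed.

Lemma pairwise_s : pairwise (blt le) s.
Proof.
rewrite -(sorted_pairwise_in blt_trans)//.
by apply/allP => b; exact: mem_sB.
Qed.

Lemma blt_asym b c : b \in B -> c \in B -> blt le b c -> ~~ blt le c b.
Proof.
move=> bB cB /andP[bc lbc]; apply/negP => /andP[_ lcb].
by move: bc; rewrite (hall_anti hB bB cB) ?eqxx// lbc.
Qed.

Section Split.
Context (pre suf : seq (br I)) (g : br I).
Hypothesis sE : s = pre ++ g :: suf.

Let pw : [/\ forall c, c \in pre -> blt le c g, forall c, c \in suf -> blt le g c &
  forall b c, b \in pre -> c \in suf -> blt le b c].
Proof.
have := pairwise_s; rewrite sE pairwise_cat pairwise_cons.
move=> /and3P[/allrelP h1 _ /andP[/allP h2 _]]; split => //.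
- by move=> c cp; apply: h1 => //; rewrite mem_head.
- by move=> b c bp cs; apply: h1 => //; rewrite inE cs orbT.
Qed.

Let gs : g \in s. Proof. by rewrite sE mem_cat mem_head orbT. Qed.
Let gB : g \in B. Proof. exact: mem_sB. Qed.
Let sufs c : c \in suf -> c \in s.
Proof. by move=> cp; rewrite sE mem_cat inE cp !orbT. Qed.

Lemma mem_pre c : c \in s -> blt le c g -> c \in pre.
Proof.
move=> cs cg; have := cs; rewrite sE mem_cat inE => /or3P[//|/eqP ce|cf].
  by move: cg; rewrite ce /blt eqxx.
by have [_ /(_ _ cf) gc _] := pw; have := blt_asym (mem_sB cs) gB cg; rewrite gc.
Qed.

Lemma mem_suf c : c \in s -> blt le g c -> c \in suf.
Proof.
move=> cs gc; have := cs; rewrite sE mem_cat inE => /or3P[cp|/eqP ce|//].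
  by have [/(_ _ cp) cg _ _] := pw; have := blt_asym (mem_sB cs) gB cg; rewrite gc.
by move: gc; rewrite ce /blt eqxx.
Qed.

Lemma uniq_suf : uniq suf.
Proof.
have /pairwise_uniq -/(_ _) : pairwise (blt le) suf.
  by have := pairwise_s; rewrite sE pairwise_cat pairwise_cons => /and3P[_ _ /andP[]].
by apply => b; rewrite /blt eqxx.
Qed.

Lemma notin_pre : g \notin pre.
Proof. by apply/negP => gp; have [/(_ _ gp)] := pw; rewrite /blt eqxx. Qed.

Lemma lead_g : lead pre g.
Proof.
case gE : g => [//|c b] /=; apply: mem_pre.
  have : Node c b \in B by rewrite -gE.
  move=> /(hall_node hB)[cB _ _ _]; rewrite mem_s cB /=.
  have := gs; rewrite mem_s gE /= => /andP[_]; apply: leq_trans; exact: leq_addr.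
have : Node c b \in B by rewrite -gE.
move=> cbB; have [cB bB _ _] := (hall_node hB _ _).1 cbB.
by rewrite gE; exact: (hall_lt hB).
Qed.

Lemma letters_neq v : v \in letters pre suf -> forall c, v != Node g c.
Proof.
rewrite mem_filter => /andP[lv _] c; apply/eqP => ve; move: lv; rewrite ve /=.
by rewrite (negbTE notin_pre).
Qed.

(** Brackets by [g] are peeled off as long as possible. The Hall condition on the left
  factor of a right factor keeps the result a bracket by [g] or by an element of [pre]. *)
Lemma letters_ad_mem b : b \in suf -> lead (rcons pre g) b ->
  exists v m, [/\ v \in letters pre suf, (m < M)%N & b = iter m (Node g) v].
Proof.
elim: b => [i|c _ d IH] bs lb.
  exists (Leaf i), 0%N; split => //; first by rewrite mem_filter.
  have := sufs bs; rewrite mem_s => /andP[_]; exact: leq_trans.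
have bM : (blen (Node c d) <= M)%N by have := sufs bs; rewrite mem_s => /andP[].
have [lpb|lpb] := boolP (lead pre (Node c d)).
  exists (Node c d), 0%N; split => //; first by rewrite mem_filter lpb.
  exact: leq_trans (blen_gt0 _) bM.
rewrite /= in lb lpb bM.
move: lb; rewrite mem_rcons inE (negbTE lpb) orbF => /eqP ce; subst c.
have gdB : Node g d \in B by apply: mem_sB; exact: sufs.
have [_ dB gd hd] := (hall_node hB _ _).1 gdB.
have dM : (blen d <= M)%N by apply: leq_trans bM; rewrite leq_addl.
have ds : d \in s by rewrite mem_s dB.
have dsuf : d \in suf by exact: mem_suf.
have [||v [m [vl mM de]]] := IH => //.
  case: d {IH bs lpb bM gdB gd} hd dB dM ds dsuf => [//|e d] eg dB dM ds dsuf /=.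
  rewrite mem_rcons inE; have [//|ne] := eqVneq e g.
  apply: mem_pre; last by rewrite /blt ne eg.
  have [eB _ _ _] := (hall_node hB _ _).1 dB; rewrite mem_s eB /=.
  by apply: leq_trans dM; rewrite /= leq_addr.
exists v, m.+1; split => //; last by rewrite iterS -de.
have := bM; rewrite de blen_iter => h; apply: leq_trans h.
rewrite addnA -mulSn -[m.+2]addn1; exact: leq_add (leq_pmulr _ (blen_gt0 g)) (blen_gt0 v).
Qed.

Lemma letters_ad_sub v m : v \in letters pre suf -> (blen (iter m (Node g) v) <= M)%N ->
  iter m (Node g) v \in letters (rcons pre g) suf.
Proof.
move=> vl; elim: m => [_|m IH mM].
  move: vl; rewrite !mem_filter => /andP[lv ->]; rewrite andbT.
  by case: (v) lv => //= c _ cp; rewrite mem_rcons inE cp orbT.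
have {IH} := IH (leq_trans (leq_addl _ _) mM).
rewrite !mem_filter iterS => /andP[ld ds]; set d := iter m _ v in ld ds mM *.
rewrite [lead _ _]/= mem_rcons mem_head andTb.
have [_ /(_ _ ds) gd _] := pw.
have dB : d \in B by apply: mem_sB; exact: sufs.
have gdB : Node g d \in B.
  apply/(hall_node hB); split => //; case: (d) ld dB => [//|e d'] /=.
  rewrite mem_rcons inE => /orP[/eqP ->|ep] _.
    by have := hall_total hB gB gB; rewrite orbb.
  by have [/(_ _ ep) /andP[_]] := pw.
apply: mem_suf; last exact: (hall_lt hB).
by rewrite mem_s gdB.
Qed.

Lemma iter_ad_inj v v' m m' : v \in letters pre suf -> v' \in letters pre suf ->
  iter m (Node g) v = iter m' (Node g) v' -> v = v' /\ m = m'.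
Proof.
move=> vl vl'; elim: m m' => [|m IH] [|m'] //=.
- by move=> e; have := letters_neq vl (iter m' (Node g) v'); rewrite e eqxx.
- by move=> e; have := letters_neq vl' (iter m (Node g) v); rewrite -e eqxx.
- by move=> [/IH[-> ->]].
Qed.

(** Eliminating [g] replaces each other generator [v] by the brackets [ad_g^m v]. *)
Lemma letters_perm : perm_eq (letters (rcons pre g) suf)
  [seq b <- [seq iter m (Node g) v | v <- letters pre suf, m <- iota 0 M] | (blen b <= M)%N].
Proof.
apply: uniq_perm.
- by rewrite filter_uniq// uniq_suf.
- apply: filter_uniq; apply: allpairs_uniq; first by rewrite filter_uniq// uniq_suf.
    exact: iota_uniq.
  move=> [v m] [v' m'] /allpairsP[[? ?] [/= vl _ [-> ->]]] /allpairsP[[? ?] [/= vl' _ [-> ->]]] e.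
  by have [-> ->] := iter_ad_inj vl vl' e.
move=> b; rewrite [RHS]mem_filter; apply/idP/andP => [bl|[bM /allpairsP[[v m] [/= vl _ be]]]].
  have := bl; rewrite mem_filter => /andP[lb bs]; split.
    by have := sufs bs; rewrite mem_s => /andP[].
  have [v [m [vl mM ->]]] := letters_ad_mem bs lb.
  by apply/allpairsP; exists (v, m); split => //=; rewrite mem_iota.
by rewrite be in bM *; exact: letters_ad_sub.
Qed.

Lemma big_letters (W : zmodType) (F : br I -> W) :
  \sum_(b <- letters (rcons pre g) suf) F b =
  \sum_(m < M) \sum_(v <- letters pre suf | (blen (iter m (Node g) v) <= M)%N)
    F (iter m (Node g) v).
Proof.
rewrite (perm_big _ letters_perm) big_filter big_mkcond big_allpairs_dep exchange_big /=.
rewrite -[X in iota 0 X]subn0 -/(index_iota 0 M) big_mkord.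
by apply: eq_bigr => m _; rewrite -big_mkcond.
Qed.

End Split.
End Elimination.

(** * Coordinates of the second kind *)

Section Coordinates.
Context {R : realType} {K : scalar_field R}.
Hypothesis hK : K = real_scalars R \/ K = complex_scalars R.
Context {I : finType} (T : R) (u : I -> R -> K).
Hypothesis T0 : 0 <= T.
Hypothesis ui : forall i, integK T (u i).
Implicit Types (b c g : br I) (w : R -> K).

Let vT := variation u T.
Let vT0 : 0 <= vT.
Proof. by apply: (variation_ge0 hK ui); rewrite T0 lexx. Qed.

Lemma ad_decomposition b1 b2 : exists m c,
  Node b1 b2 = iter m.+1 (Node b1) c /\ forall c', c != Node b1 c'.
Proof.
elim: b2 => [i|d _ c [m [c0 [ce cN]]]].
  by exists 0%N, (Leaf i); split => // c'; apply/eqP.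
have [e|ne] := eqVneq d b1; first by exists m.+1, c0; rewrite e ce.
exists 0%N, (Node d c); split => // c'.
by apply/eqP => -[e _]; rewrite e eqxx in ne.
Qed.

Lemma within_continuousM (f g : R -> R) : {within `[0, T], continuous f} ->
  {within `[0, T], continuous g} -> {within `[0, T], continuous (fun s => f s * g s)}.
Proof. by move=> fc gc x; exact: cvgM (fc x) (gc x). Qed.

Lemma within_continuousX (phi : R -> K) m :
  {within `[0, T], continuous (fun s => re (phi s))} /\
  {within `[0, T], continuous (fun s => im (phi s))} ->
  {within `[0, T], continuous (fun s => re (phi s ^+ m))} /\
  {within `[0, T], continuous (fun s => im (phi s ^+ m))}.
Proof.
move=> [c1 c2]; elim: m => [|m [IH1 IH2]].
  by split; apply: continuous_subspaceT => x; exact: cst_continuous.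
split.
  have -> : (fun s => re (phi s ^+ m.+1)) =
      (fun s => re (phi s) * re (phi s ^+ m) - im (phi s) * im (phi s ^+ m)).
    by apply/funext => s; rewrite exprS reM.
  by move=> x; apply: cvgB; [exact: (within_continuousM c1 IH1)|exact: (within_continuousM c2 IH2)].
have -> : (fun s => im (phi s ^+ m.+1)) =
    (fun s => re (phi s) * im (phi s ^+ m) + im (phi s) * re (phi s ^+ m)).
  by apply/funext => s; rewrite exprS imM.
by move=> x; apply: cvgD; [exact: (within_continuousM c1 IH2)|exact: (within_continuousM c2 IH1)].
Qed.

Lemma tderive_eq w w' s : 0 < s < T -> (forall r, 0 <= r <= T -> w r = w' r) ->
  tderive w s = tderive w' s.
Proof.
move=> sT ww'; rewrite /tderive !derive1E.
have n1 : \forall r \near s, w r = w' r.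
  near=> r; apply: ww'.
  have : 0 < r < T by near: r; apply: near_in_itvoo; rewrite in_itv.
  by move=> /andP[r0 rT]; rewrite !ltW.
by congr (re_im _ _ _); apply: near_eq_derive; apply: filterS n1 => r /= ->.
Unshelve. all: by end_near. Qed.

Definition sum_abs (s : R) : R := \sum_i abs (u i s).

(** The bound is homogeneous, of degree [blen b] in [u]. *)
Definition density b w : Prop := [/\ integK T w,
  forall t, 0 <= t <= T -> xi u b t = int0 w t &
  forall s, 0 <= s <= T -> abs (w s) <= 4 ^+ (blen b).-1 * vT ^+ (blen b).-1 * sum_abs s].

Lemma density_incr b w s t : density b w -> 0 <= s -> s <= t -> t <= T ->
  abs (xi u b t - xi u b s) <=
    2 * (4 ^+ (blen b).-1 * vT ^+ (blen b).-1) * (variation u t - variation u s).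
Proof.
move=> [wi we wb] s0 st tT; have sT : s <= T := le_trans st tT.
have iS := integ_sum_abs hK ui.
rewrite !we ?s0 ?sT ?(le_trans s0 st)//.
have := int0_incr_le hK s0 st tT wi (integZ (4 ^+ (blen b).-1 * vT ^+ (blen b).-1) iS).
rewrite (primZ _ _ iS)// (primZ _ _ iS)// -/(variation u t) -/(variation u s) -mulrBr => H.
rewrite -[leRHS]mulrA; apply: H.
by move=> r /andP[sr rt]; apply: wb; rewrite (le_trans s0 (ltW sr)) (le_trans (ltW rt) tT).
Qed.

Lemma density_bound b w t : density b w -> 0 <= t <= T ->
  abs (xi u b t) <= 4 ^+ blen b * vT ^+ blen b.
Proof.
move=> wd /andP[t0 tT]; have := density_incr wd (lexx 0) t0 tT.
have [_ we _] := wd; rewrite [xi u b 0]we ?lexx ?T0// (int0_0 hK) subr0.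
rewrite [variation u 0]prim0 subr0 => /le_trans; apply.
have v1 : variation u t <= vT := variation_mono hK ui t0 tT (lexx _).
have q0 : 0 <= 4 ^+ (blen b).-1 * vT ^+ (blen b).-1 by rewrite mulr_ge0 ?exprn_ge0.
apply: (@le_trans _ _ (4 * (4 ^+ (blen b).-1 * vT ^+ (blen b).-1) * vT)).
  apply: ler_pM => //; first by rewrite mulr_ge0.
    by apply: (variation_ge0 hK ui); rewrite t0.
  by apply: ler_wpM2r => //; rewrite ler_nat.
have -> : 4 * (4 ^+ (blen b).-1 * vT ^+ (blen b).-1) * vT =
  4 ^+ (blen b).-1.+1 * vT ^+ (blen b).-1.+1 by rewrite !exprS; ring.
by rewrite prednK// blen_gt0.
Qed.

Lemma int0_tderive_eq w w' (phi : R -> K) b t : density b w -> t <= T ->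
  (forall s, 0 <= s <= T -> phi s = w' s) ->
  int0 (fun s => phi s * tderive (xi u b) s) t = int0 (fun s => w' s * w s) t.
Proof.
move=> [wi we wb] tT pw; have [N [mN N0 hN]] := tderive_int0 hK wi.
apply: (int0_eq_ae hK mN N0) => s /andP[s0 st] sN.
have sT : 0 < s < T by rewrite s0 (lt_le_trans st tT).
rewrite pw ?(ltW s0) ?(ltW (lt_le_trans st tT))//; congr (_ * _).
by rewrite (tderive_eq sT we); exact: hN.
Qed.

(** The derivative of [xi u c] in the definition of [xi u (ad^m c)] is only defined almost
  everywhere, where it is a density of [xi u c]: densities are obtained by induction. *)
Lemma has_density b : exists w, density b w.
Proof.
elim: {b}(blen b).+1 {-2}b (ltnSn (blen b)) => // n IH [i _|b1 b2 bn].
  exists (u i); split => // s _; rewrite /= !expr0 !mul1r /sum_abs (bigD1 i)//= lerDl.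
  by apply: sumr_ge0 => j _; exact: abs_ge0.
have [m [c [be cN]]] := ad_decomposition b1 b2.
have bl : blen (Node b1 b2) = (m.+1 * blen b1 + blen c)%N by rewrite be blen_iter.
have p1 := blen_gt0 b1; have pc := blen_gt0 c.
have [w1 d1] : exists w, density b1 w.
  by apply: IH; move: bn; rewrite bl mulSn; move: pc; clear; lia.
have [wc dc] : exists w, density c w.
  by apply: IH; move: bn; rewrite bl mulSn; move: p1; clear; lia.
have [i1 e1 _] := d1; have [ic ec bc] := dc.
pose w s := ((m.+1)`!)%:R^-1 * (int0 w1 s ^+ m.+1 * wc s).
have iM : integK T (fun s => int0 w1 s ^+ m.+1 * wc s).
  have [c1 c2] := within_continuousX m.+1 (int0_continuous hK T0 i1).
  exact: integK_M.
exists w; split.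
- exact: integK_Z.
- move=> t /andP[t0 tT]; rewrite be xi_ad// (int0Z hK _ tT iM); congr (_ * _).
  by apply: (int0_tderive_eq dc tT) => s sT; rewrite e1.
move=> s sT; rewrite /w (absM hK) (absV hK) (abs_nat hK).
have f1 : (m.+1`!)%:R^-1 <= 1 :> R by rewrite invf_le1 ?ler1n ?ltr0n fact_gt0.
have f0 : 0 <= (m.+1`!)%:R^-1 :> R by rewrite invr_ge0.
apply: (@le_trans _ _ (1 * abs (int0 w1 s ^+ m.+1 * wc s))).
  by apply: ler_wpM2r => //; exact: abs_ge0.
rewrite mul1r (absM hK) (absX hK) -e1//.
have -> : (blen (Node b1 b2)).-1 = (m.+1 * blen b1 + (blen c).-1)%N by rewrite bl; lia.
have -> : 4 ^+ (m.+1 * blen b1 + (blen c).-1) * vT ^+ (m.+1 * blen b1 + (blen c).-1) * sum_abs s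
    = (4 ^+ blen b1 * vT ^+ blen b1) ^+ m.+1 *
      (4 ^+ (blen c).-1 * vT ^+ (blen c).-1 * sum_abs s).
  by rewrite mulnC !(exprD _ (blen b1 * m.+1)%N) !exprM exprMn mulrACA -!mulrA.
apply: ler_pM; rewrite ?exprn_ge0 ?(abs_ge0 hK)//; last exact: bc.
apply: lerXn2r; rewrite ?nnegrE ?mulr_ge0 ?exprn_ge0 ?(abs_ge0 hK)//.
exact: density_bound d1 sT.
Qed.

Lemma xi_incr b s t : 0 <= s -> s <= t -> t <= T -> abs (xi u b t - xi u b s) <=
  2 * (4 ^+ (blen b).-1 * vT ^+ (blen b).-1) * (variation u t - variation u s).
Proof. by move=> *; have [w wd] := has_density b; exact: density_incr wd _ _ _. Qed.

Lemma xi_bound b t : 0 <= t <= T -> abs (xi u b t) <= 4 ^+ blen b * vT ^+ blen b.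
Proof. by move=> *; have [w wd] := has_density b; exact: density_bound wd _. Qed.

Lemma xi0 b : xi u b 0 = 0.
Proof.
have [w [_ we _]] := has_density b; rewrite we ?lexx//; exact: int0_0.
Qed.

Lemma abs_subrX (x y : K) (X : R) m : abs x <= X -> abs y <= X ->
  abs (x ^+ m.+1 - y ^+ m.+1) <= m.+1%:R * X ^+ m * abs (x - y).
Proof.
move=> hx hy; have X0 : 0 <= X := le_trans (abs_ge0 hK _) hx.
elim: m => [|m IH]; first by rewrite !expr1 expr0 mulr1 mul1r.
have -> : x ^+ m.+2 - y ^+ m.+2 = x * (x ^+ m.+1 - y ^+ m.+1) + (x - y) * y ^+ m.+1.
  by rewrite !(exprS _ m.+1); ring.
apply: (le_trans (absD hK _ _)); rewrite !(absM hK) (absX hK).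
have e1 : abs x * abs (x ^+ m.+1 - y ^+ m.+1) <= X * (m.+1%:R * X ^+ m * abs (x - y)).
  by apply: ler_pM; rewrite ?(abs_ge0 hK).
have e2 : abs (x - y) * abs y ^+ m.+1 <= abs (x - y) * X ^+ m.+1.
  apply: ler_wpM2l; first exact: abs_ge0.
  by apply: lerXn2r; rewrite ?nnegrE ?(abs_ge0 hK).
apply: (le_trans (lerD e1 e2)); rewrite -(natr1 m.+1) !exprS.
by rewrite le_eqVlt; apply/orP; left; apply/eqP; ring.
Qed.

(** The definition of [xi_(ad_g^m c)] as an integral, where [xi_g] is frozen at the
  beginning of the interval: [xi_g] varies by [O(dV)] only. *)
Lemma xi_ad_incr g c m : (forall c', c != Node g c') -> exists2 C : R, 0 <= C &
  forall s t, 0 <= s -> s <= t -> t <= T ->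
  abs (xi u (iter m (Node g) c) t - xi u (iter m (Node g) c) s -
       exp_coef (xi u g s) m * (xi u c t - xi u c s)) <=
    C * (variation u t - variation u s) ^+ 2.
Proof.
case: m => [|m] cN.
  exists 0 => // s t _ _ _; rewrite /exp_coef fact0 invr1 expr0 !mul1r subrr (abs0 hK).
  by rewrite mul0r.
have [wg [ig eg bg]] := has_density g; have [wc dc] := has_density c.
have [ic ec bc] := dc.
pose X := 4 ^+ blen g * vT ^+ blen g.
pose A := 2 * (4 ^+ (blen g).-1 * vT ^+ (blen g).-1).
pose Cc := 4 ^+ (blen c).-1 * vT ^+ (blen c).-1.
have X0 : 0 <= X by rewrite mulr_ge0 ?exprn_ge0.
have A0 : 0 <= A by rewrite !mulr_ge0 ?exprn_ge0.
have Cc0 : 0 <= Cc by rewrite mulr_ge0 ?exprn_ge0.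
exists (2 * (m.+1%:R * X ^+ m * A * Cc)); first by rewrite !mulr_ge0 ?exprn_ge0.
move=> s t s0 st tT; have sT : s <= T := le_trans st tT.
have t0 : 0 <= t := le_trans s0 st.
have iM : integK T (fun r => int0 wg r ^+ m.+1 * wc r).
  have [c1 c2] := within_continuousX m.+1 (int0_continuous hK T0 ig).
  exact: integK_M.
have E r : 0 <= r <= T -> xi u (iter m.+1 (Node g) c) r =
    ((m.+1)`!)%:R^-1 * int0 (fun z => int0 wg z ^+ m.+1 * wc z) r.
  move=> /andP[r0 rT]; rewrite xi_ad//; congr (_ * _).
  by apply: (int0_tderive_eq dc rT) => z zT; rewrite eg.
rewrite !E ?s0 ?t0 ?sT ?tT// !ec ?s0 ?t0 ?sT ?tT//.
pose h r := (int0 wg r ^+ m.+1 - xi u g s ^+ m.+1) * wc r.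
have ih : integK T h.
  rewrite [h](_ : _ = fun r => int0 wg r ^+ m.+1 * wc r + (- xi u g s ^+ m.+1) * wc r).
    by apply: (integK_D hK) => //; exact: integK_Z.
  by apply/funext => r; rewrite /h mulrDl.
have Eh r : r <= T -> int0 h r = int0 (fun z => int0 wg z ^+ m.+1 * wc z) r -
    xi u g s ^+ m.+1 * int0 wc r.
  move=> rT; rewrite -(int0Z hK _ rT ic) -(int0B hK rT iM (integK_Z hK _ ic)).
  by congr (int0 _ r); apply/funext => z; rewrite /h mulrBl.
rewrite /exp_coef.
have -> : forall a b c' d' e' f' : K, a * b - a * c' - a * e' * (d' - f') =
    a * ((b - e' * d') - (c' - e' * f')) by move=> *; ring.
rewrite -!Eh// (absM hK) (absV hK) (abs_nat hK).
have f1 : (m.+1`!)%:R^-1 <= 1 :> R by rewrite invf_le1 ?ler1n ?ltr0n fact_gt0.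
have f0 : 0 <= (m.+1`!)%:R^-1 :> R by rewrite invr_ge0.
apply: (@le_trans _ _ (1 * abs (int0 h t - int0 h s))).
  by apply: ler_wpM2r => //; exact: abs_ge0.
rewrite mul1r.
pose dv := variation u t - variation u s.
have dv0 : 0 <= dv by rewrite subr_ge0 (variation_mono hK ui).
have iS := integ_sum_abs hK ui.
have := int0_incr_le hK s0 st tT ih (integZ (m.+1%:R * X ^+ m * (A * dv) * Cc) iS).
rewrite (primZ _ _ iS)// (primZ _ _ iS)// -/(variation u t) -/(variation u s) -mulrBr -/dv => H.
have -> : 2 * (m.+1%:R * X ^+ m * A * Cc) * dv ^+ 2 =
  2 * (m.+1%:R * X ^+ m * (A * dv) * Cc * dv) by ring.
apply: H => r /andP[sr rt]; have rT : 0 <= r <= T.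
  by rewrite (le_trans s0 (ltW sr)) (le_trans (ltW rt) tT).
rewrite /h (absM hK) -[leRHS]mulrA; apply: ler_pM; rewrite ?(abs_ge0 hK)//; last exact: bc.
rewrite -eg//; apply: (le_trans (abs_subrX m (xi_bound g rT) (xi_bound g _))).
  by rewrite s0 sT.
apply: ler_wpM2l; first by rewrite mulr_ge0 ?exprn_ge0.
case/andP: rT => r0 rT; apply: (le_trans (xi_incr g s0 (ltW sr) rT)); rewrite -/A.
apply: ler_wpM2l => //; rewrite lerB//; exact: (variation_mono hK ui r0 (ltW rt) tT).
Qed.

End Coordinates.

(** * Bounds on the brackets of smooth fields *)

Section FieldBounds.
Context {R : realType} {K : scalar_field R}.
Hypothesis hK : K = real_scalars R \/ K = complex_scalars R.
Context {d : nat} {I : finType} (M : nat) (rho : R) (f : I -> 'rV[K]_d -> 'rV[K]_d).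
Hypothesis d0 : (0 < d)%N.
Hypothesis M0 : (0 < M)%N.
Hypothesis rho0 : 0 <= rho.
Hypothesis fC : forall i, C_ball (2 * M) rho (f i).

Transparent C_on.
Lemma C_on_subset k (U W : set 'rV[K]_d) g : W `<=` U -> C_on k U g -> C_on k W g.
Proof.
move=> WU; elim: k g => [|k IH] g [gc gd].
  by split => // x; rewrite inE => /WU Ux; apply: gc; rewrite inE.
split=> [x|j]; first by rewrite inE => /WU Ux; apply: gc; rewrite inE.
by have [h1 h2] := gd j; split=> [x /WU|]; [exact: h1|exact: IH].
Qed.
Opaque C_on.

Lemma common_domain : exists U, [/\ open U, cball rho `<=` U &
  forall i, C_on (2 * M) U (f i)].
Proof.
suff [U [oU BU h]] : exists U, [/\ open U, cball rho `<=` U &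
    forall i, i \in enum I -> C_on (2 * M) U (f i)].
  by exists U; split => // i; apply: h; rewrite mem_enum.
elim: (enum I) => [|i r [U [oU BU h]]].
  by exists setT; split => //; exact: openT.
have [W [oW BW h']] := fC i; exists (U `&` W); split.
- exact: openI.
- by move=> x hx; split; [exact: BU|exact: BW].
move=> j; rewrite inE => /orP[/eqP ->|jr].
  by apply: C_on_subset h' => x [].
by apply: C_on_subset (h j jr) => x [].
Qed.

Definition pd_const k : R := d%:R * (k`! ^ d)%:R.

Lemma normCk_ge0 k (g : 'rV[K]_d -> 'rV[K]_d) : (k <= 2 * M)%N ->
  C_ball (2 * M) rho g -> 0 <= normCk k rho g.
Proof.
move=> kM gC; have z : cball rho (0 : 'rV[K]_d) by rewrite /cball /= (norm2_0 hK).
have := pd_le_normCk (l := [::]) hK rho0 kM gC (leq0n _) z.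
move=> /(le_trans (norm2_ge0 _)).
by rewrite mulrA pmulr_rge0// mulr_gt0// ltr0n// expn_gt0 fact_gt0.
Qed.

Lemma pd_le_normCks k i l x : (k <= 2 * M)%N -> (size l <= k)%N -> cball rho x ->
  norm2 (pd l (f i) x) <= pd_const k * normCks k rho f.
Proof.
move=> kM lk hx; apply: (le_trans (pd_le_normCk hK rho0 kM (fC i) lk hx)).
rewrite mulrA; apply: ler_wpM2l; first by rewrite mulr_ge0.
by rewrite /normCks (bigD1 i)//= lerDl; apply: sumr_ge0 => j _; exact: normCk_ge0.
Qed.

Lemma normCks_ge0 k : (k <= 2 * M)%N -> 0 <= normCks k rho f.
Proof. by move=> kM; apply: sumr_ge0 => i _; exact: normCk_ge0. Qed.

Definition field_const : R := d%:R * (2 * (d%:R * (d * 2 ^ (2 * M).+1)%:R ^+ (2 * M))).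

(** A bracket of length [n <= M] and its first derivatives involve derivatives of order
  at most [M], whence the bound in [a ^ n]. The constants [N] and [Q], not controlled,
  enter errors of second order in the increments only. *)
Lemma field_bounds : exists a a' N Q : R,
  [/\ 0 <= a <= pd_const M * normCks M rho f,
    a <= a' /\ a' = pd_const (2 * M) * normCks (2 * M) rho f,
    0 <= N /\ 0 <= Q,
    forall b, (blen b <= M)%N ->
      regular rho (field_const * a ^+ blen b) Q (bfield f b) (jac (bfield f b)) /\
      field_const * a ^+ blen b <= N &
    (forall b x, (M < blen b <= 2 * M)%N -> cball rho x ->
      norm2 (bfield f b x) <= field_const * (a ^+ (blen b).-1 * a')) /\
    (forall g b x, (blen g <= M)%N -> (blen b <= M)%N -> cball rho x ->
      jac (bfield f b) x (bfield f g x) - jac (bfield f g) x (bfield f b x) =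
      bfield f (Node g b) x)].
Proof.
have [U [oU BU hU]] := common_domain.
pose a1 := pd_const M * normCks M rho f; pose a2 := pd_const (2 * M) * normCks (2 * M) rho f.
have M2 : (M <= 2 * M)%N by rewrite leq_pmull.
have c0 k : 0 <= pd_const k by rewrite mulr_ge0.
have a10 : 0 <= a1 by rewrite mulr_ge0// normCks_ge0.
have a20 : 0 <= a2 by rewrite mulr_ge0// normCks_ge0.
pose a := Num.min a1 a2.
have a0 : 0 <= a by rewrite le_min a10.
have aa2 : a <= a2 by rewrite ge_min lexx orbT.
have hA x i l : cball rho x -> (size l <= M)%N -> norm2 (pd l (f i) x) <= a.
  move=> hx lM; rewrite le_min !pd_le_normCks//; exact: leq_trans lM M2.
have hA' x i l : cball rho x -> (size l <= 2 * M)%N -> norm2 (pd l (f i) x) <= a2.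
  by move=> hx lM; rewrite pd_le_normCks.
pose C0 : R := (d * 2 ^ (2 * M).+1)%:R.
have C01 : 1 <= C0 by rewrite ler1n muln_gt0 d0 expn_gt0.
have C00 : 0 <= C0 := le_trans ler01 C01.
pose K1 := C0 ^+ (2 * M).
have K10 : 0 <= K1 by rewrite exprn_ge0.
have kE y : field_const * y = d%:R * (2 * (d%:R * (K1 * y))).
  by rewrite /field_const -/C0 -/K1 -!mulrA.
have bd b l x : (size l + blen b <= (2 * M).+1)%N -> cball rho x ->
    norm2 (pd l (bfield f b) x) <= K1 * profile M a a2 (blen b) (size l).
  move=> lb hx; apply: (le_trans (norm2_pd_bfield_le hK oU hU (BU _ hx) a0 aa2
    (fun i l => hA x i l hx) (fun i l => hA' x i l hx) lb)).
  apply: ler_wpM2r; first exact: profile_ge0.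
  by apply: ler_weXn2l => //; move: lb; clear; lia.
have p1 b l x : (size l <= 1)%N -> (blen b <= M)%N -> cball rho x ->
    norm2 (pd l (bfield f b) x) <= K1 * a ^+ blen b.
  move=> l1 bM hx; have := @bd b l x; rewrite /profile ifT; last by move: l1 bM; clear; lia.
  by apply => //; move: l1 bM M0; clear; lia.
have a1p : 1 <= 1 + a2 by rewrite lerDl.
have powM n : (n <= (2 * M).+1)%N -> a ^+ n <= (1 + a2) ^+ (2 * M).+1.
  move=> nM; apply: (@le_trans _ _ ((1 + a2) ^+ n)); last exact: ler_weXn2l.
  have aa : a <= 1 + a2 by apply: (le_trans aa2); rewrite lerDr.
  by apply: lerXn2r aa; rewrite nnegrE// (le_trans ler01).
have P0 : 0 <= (1 + a2) ^+ (2 * M).+1 by rewrite exprn_ge0// (le_trans ler01).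
pose c' := K1 * ((1 + a2) ^+ (2 * M).+1 * (1 + a2)).
have c'0 : 0 <= c' by apply: mulr_ge0 => //; apply: mulr_ge0 => //; exact: le_trans a1p.
have p2 b l x : (size l = 2)%N -> (blen b <= M)%N -> cball rho x ->
    norm2 (pd l (bfield f b) x) <= c'.
  move=> l2 bM hx; apply: (le_trans (bd b l x _ hx)); first by rewrite l2; move: bM M0; clear; lia.
  apply: ler_wpM2l => //; rewrite /profile; case: ifP => _.
    apply: (@le_trans _ _ ((1 + a2) ^+ (2 * M).+1)); first by apply: powM; move: bM; clear; lia.
    by rewrite ler_peMr.
  apply: ler_pM; rewrite ?exprn_ge0//; first by apply: powM; move: bM; clear; lia.
  by rewrite lerDr.
exists a, a2, (d%:R * (2 * (d%:R * (K1 * (1 + a2) ^+ (2 * M).+1)))),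
  (d%:R * (2 * (d%:R * (d%:R * (2 * (d%:R * c')))))); split.
- by rewrite a0 ge_min lexx.
- by [].
- by split; repeat (apply: mulr_ge0 => //).
- move=> b bM; rewrite kE; split; last first.
    by do 4 (apply: ler_wpM2l => //); apply: powM; move: bM; clear; lia.
  apply: (regular_C2 hK oU BU) => //.
  + by apply: mulr_ge0 => //; exact: exprn_ge0.
  + by apply: (C_on_bfield hK oU hU); move: bM M0; clear; lia.
  + by move=> x hx; exact: (p1 b [::] x).
  + by move=> x j hx; exact: (p1 b [:: j] x).
  + by move=> x i j hx; exact: (p2 b [:: j; i] x).
split.
  move=> b x /andP[bM b2M] hx; apply: (le_trans (bd b [::] x _ hx)).
    by rewrite add0n (leq_trans b2M).
  have d1 : 1 <= d%:R :> R by rewrite ler1n.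
  have a20' : 0 <= a ^+ (blen b).-1 * a2 by rewrite mulr_ge0 ?exprn_ge0.
  have K1d : K1 <= field_const.
    rewrite -[field_const]mulr1 kE mulr1; apply: (@le_trans _ _ (1 * (1 * (1 * K1)))).
      by rewrite !mul1r.
    apply: ler_pM => //; first by rewrite !mul1r.
    apply: ler_pM => //; [by rewrite mul1r|by rewrite ler1n|exact: ler_wpM2r].
  apply: (@le_trans _ _ (K1 * (a ^+ (blen b).-1 * a2))); last exact: ler_wpM2r.
  apply: ler_wpM2l => //; rewrite /profile; case: ifP => _ //.
  rewrite -[in leLHS](prednK (blen_gt0 b)) exprSr.
  by apply: ler_wpM2l => //; exact: exprn_ge0.
move=> g b x gM bM hx; apply/esym; apply: (lie_jac hK oU BU) => //;
  by apply: (C_on_bfield hK oU hU); move: gM bM M0; clear; lia.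
Qed.

Lemma field_const_ge1 : 1 <= field_const.
Proof.
have d1 : 1 <= d%:R :> R by rewrite ler1n.
have h : 1 <= (d * 2 ^ (2 * M).+1)%:R ^+ (2 * M) :> R.
  by apply: exprn_ege1; rewrite ler1n muln_gt0 d0 expn_gt0.
apply: mulr_ege1 => //; apply: mulr_ege1; [by rewrite ler1n|exact: mulr_ege1].
Qed.

End FieldBounds.
Arguments pd_const : clear implicits.
Arguments field_const : clear implicits.

(** * Increments of products of exponentials *)

Local Ltac nonneg := repeat first [by [] | apply: mulr_ge0 | apply: exprn_ge0].

Section Products.
Context {R : realType} {K : scalar_field R}.
Hypothesis hK : K = real_scalars R \/ K = complex_scalars R.
Context {d : nat} {I : finType}.
Local Notation V := 'rV[K]_d.

Let step_arith (n z w q C1 C3 C4 : R) : n <= w + C1 * q + C4 * q -> z <= w ->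
  2 * (n + (z + C3 * q)) <= 4 * w + 2 * (C1 + C4 + C3) * q.
Proof. lra. Qed.

Lemma uniform_bound (J : eqType) (l : seq J) (P : J -> R -> Prop) :
  (forall j C C', P j C -> C <= C' -> P j C') ->
  (forall j, j \in l -> exists2 C, 0 <= C & P j C) ->
  exists2 C, 0 <= C & forall j, j \in l -> P j C.
Proof.
move=> Pm; elim: l => [|j l IH] h; first by exists 0.
have [C C0 hC] := h j (mem_head _ _).
have [|C' C'0 hC'] := IH; first by move=> k kl; apply: h; rewrite inE kl orbT.
exists (C + C'); first exact: addr_ge0.
move=> k; rewrite inE => /orP[/eqP ->|kl].
  by apply: Pm hC _; rewrite lerDl.
by apply: Pm (hC' k kl) _; rewrite lerDr.
Qed.

Lemma sum_le_size (J : eqType) (l : seq J) (P : pred J) (F : J -> R) (c : R) : 0 <= c ->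
  (forall j, j \in l -> P j -> F j <= c) -> \sum_(j <- l | P j) F j <= (size l)%:R * c.
Proof.
move=> c0; elim: l => [|j l IH] h; first by rewrite big_nil mul0r.
have {}IH : \sum_(j <- l | P j) F j <= (size l)%:R * c.
  by apply: IH => k kl; apply: h; rewrite inE kl orbT.
rewrite big_cons /= -natr1 mulrDl mul1r addrC; case: ifP => Pj.
  by apply: lerD => //; apply: h => //; exact: mem_head.
by rewrite (le_trans IH)// lerDl.
Qed.

Context (f : I -> V -> V) (M : nat) (T rho : R) (u : I -> R -> K).
Context (a a' k0 N Q : R) (s : seq (br I)).
Hypothesis M0 : (0 < M)%N.
Hypothesis T0 : 0 <= T.
Hypothesis ui : forall i, integK T (u i).
Let vT := variation u T.
Let F b : V -> V := bfield f b.
Let n_s : R := (size s)%:R.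
Hypothesis a0 : 0 <= a.
Hypothesis aa' : a <= a'.
Hypothesis k1 : 1 <= k0.
Hypothesis N0 : 0 <= N.
Hypothesis Q0 : 0 <= Q.
Hypothesis F_regular : forall b, (blen b <= M)%N ->
  regular rho (k0 * a ^+ blen b) Q (F b) (jac (F b)) /\ k0 * a ^+ blen b <= N.
Hypothesis F_large : forall b x, (M < blen b <= 2 * M)%N -> cball rho x ->
  norm2 (F b x) <= k0 * (a ^+ (blen b).-1 * a').
Hypothesis F_lie : forall g b x, (blen g <= M)%N -> (blen b <= M)%N -> cball rho x ->
  jac (F b) x (F g x) - jac (F g) x (F b x) = F (Node g b) x.
Context (B : {pred br I}) (le : rel (br I)) (hB : hall_set B le).
Hypothesis sorted_s : sorted (blt le) s.
Hypothesis mem_s : forall b, (b \in s) = (b \in B) && (blen b <= M)%N.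

(** The dimensionless small parameter. *)
Let th : R := 4 * vT * a.
Let sg : R := k0 * th.
Hypothesis th1 : th <= 1.

Let vT0 : 0 <= vT.
Proof. by apply: (variation_ge0 hK ui); rewrite T0 lexx. Qed.
Let th0 : 0 <= th.
Proof. by rewrite !mulr_ge0. Qed.
Let k00 : 0 <= k0.
Proof. exact: le_trans ler01 k1. Qed.
Let sg0 : 0 <= sg.
Proof. by rewrite mulr_ge0. Qed.

Let s_len b : b \in s -> (blen b <= M)%N.
Proof. by rewrite mem_s => /andP[]. Qed.

Lemma thX n : (0 < n)%N -> th ^+ n <= th.
Proof.
case: n => // n _; rewrite exprS ler_piMr//; exact: exprn_ile1.
Qed.

Lemma F_regN b : (blen b <= M)%N -> regular rho N Q (F b) (jac (F b)).
Proof. by move=> /F_regular[rb bN]; exact: regular_le bN (lexx _) rb. Qed.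

Lemma xi_F_le b t : (blen b <= M)%N -> 0 <= t <= T ->
  abs (xi u b t) * (k0 * a ^+ blen b) <= sg.
Proof.
move=> bM tT; apply: (@le_trans _ _ (4 ^+ blen b * vT ^+ blen b * (k0 * a ^+ blen b))).
  apply: ler_wpM2r; first by rewrite mulr_ge0 ?exprn_ge0.
  exact: (xi_bound hK T0 ui).
rewrite mulrCA -!exprMn; apply: ler_wpM2l => //; apply: thX; exact: blen_gt0.
Qed.

Lemma dxi_F_le b t0 t1 : (blen b <= M)%N -> 0 <= t0 -> t0 <= t1 -> t1 <= T ->
  abs (xi u b t1 - xi u b t0) * (k0 * a ^+ blen b) <= 2 * sg.
Proof.
move=> bM h0 h01 h1.
have t1T : 0 <= t1 <= T by rewrite h1 (le_trans h0).
have t0T : 0 <= t0 <= T by rewrite h0 (le_trans h01).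
apply: (@le_trans _ _ ((abs (xi u b t1) + abs (xi u b t0)) * (k0 * a ^+ blen b))).
  by apply: ler_wpM2r; [rewrite mulr_ge0 ?exprn_ge0|exact: absB].
by rewrite mulrDl mulr_natl mulr2n; apply: lerD; exact: xi_F_le.
Qed.

Let exps t (suf : seq (br I)) := [seq (fun y => xi u b t *: F b y) | b <- suf].

Lemma exp_regular b t : (blen b <= M)%N ->
  regular rho (abs (xi u b t) * (k0 * a ^+ blen b)) (abs (xi u b t) * Q)
   (fun y => xi u b t *: F b y) (fun y v => xi u b t *: jac (F b) y v).
Proof. by move=> /F_regular[rb _]; exact: regularZ. Qed.

Lemma exp_const_ge0 b t : 0 <= abs (xi u b t) * (k0 * a ^+ blen b).
Proof. by rewrite !mulr_ge0 ?exprn_ge0 ?(abs_ge0 hK). Qed.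

Lemma exp_displacement b t (tau : R) p x r : (blen b <= M)%N ->
  abs (xi u b t) * (k0 * a ^+ blen b) <= tau ->
  solution rho 1 (fun=> fun y => xi u b t *: F b y) p x -> 0 <= r <= 1 ->
  norm2 (x r - p) <= d%:R * (2 * tau).
Proof.
move=> bM bt xs /andP[r0 r1]; have rb := exp_regular t bM.
have h0 := exp_const_ge0 b t.
have := flow_incr hK (reg_bound rb) (reg_lip rb) xs (lexx 0) r0 r1.
rewrite (flow_start hK xs) subr0 => /le_trans; apply.
apply: ler_wpM2l => //; apply: (@le_trans _ _ (2 * (abs (xi u b t) * (k0 * a ^+ blen b)) * 1)).
  by apply: ler_wpM2l => //; rewrite mulr_ge0.
by rewrite mulr1; apply: ler_wpM2l.
Qed.

Lemma prod_displacement t suf (tau : R) p q :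
  (forall b, b \in suf -> (blen b <= M)%N /\ abs (xi u b t) * (k0 * a ^+ blen b) <= tau) ->
  is_exp_prod rho (exps t suf) p q -> norm2 (q - p) <= (size suf)%:R * (d%:R * (2 * tau)).
Proof.
elim: suf q => [|b suf IH] q h /=; first by move=> ->; rewrite subrr (norm2_0 hK) mul0r.
move=> [r hr [x xs <-]]; have [bM bt] := h b (mem_head _ _).
have -> : x 1 - p = (x 1 - r) + (r - p) by rewrite addrA subrK.
apply: (le_trans (norm2D hK _ _)); rewrite -natr1 mulrDl mul1r addrC; apply: lerD.
  by apply: IH => // c cs; apply: h; rewrite inE cs orbT.
by apply: (exp_displacement bM bt xs); rewrite ler01 lexx.
Qed.

Lemma prod_norm t suf p q : 0 <= t <= T -> (forall b, b \in suf -> b \in s) ->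
  is_exp_prod rho (exps t suf) p q -> norm2 q <= norm2 p + (size suf)%:R * (d%:R * (2 * sg)).
Proof.
move=> tT sub h; have := norm2D hK (q - p) p; rewrite subrK => /le_trans; apply.
rewrite addrC lerD2l; apply: (prod_displacement _ h) => b /sub bs; split; first exact: s_len.
by apply: xi_F_le => //; exact: s_len.
Qed.

Lemma prod_exists t suf p : 0 <= t <= T -> (forall b, b \in suf -> b \in s) ->
  d%:R * (2 * sg) <= 2^-1 -> norm2 p + (size suf)%:R * (d%:R * (2 * sg)) <= rho ->
  exists q, is_exp_prod rho (exps t suf) p q.
Proof.
move=> tT + small; elim: suf => [|b suf IH] sub stay; first by exists p.
have sub' c : c \in suf -> c \in s by move=> cs; apply: sub; rewrite inE cs orbT.
set D := d%:R * (2 * sg) in stay *; have D0 : 0 <= D by rewrite !mulr_ge0.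
rewrite /= -natr1 mulrDl mul1r addrA in stay.
have [|r hr] := IH sub'.
  by apply: le_trans stay; rewrite lerDl.
have bM := s_len (sub b (mem_head _ _)).
have rb := regular_le (xi_F_le bM tT) (lexx _) (exp_regular t bM).
have [|x xs] := flow_exists hK sg0 (reg_bound rb) (reg_lip rb) (p := r) sg0 small.
  by apply: le_trans stay; rewrite lerD2r; exact: prod_norm hr.
by exists (x 1), r => //; exists x.
Qed.

(** The size of the fields that the truncation neglects, up to a constant, per unit of
  variation of the controls. *)
Let E : R := th ^+ M * a'.
Let a'0 : 0 <= a' := le_trans a0 aa'.
Let E0 : 0 <= E.
Proof. by rewrite mulr_ge0 ?exprn_ge0. Qed.

(** A bracket of length [n > M] comes with [n - 1 >= M] factors [th], as its coefficient and
  its field are both homogeneous of degree [n]. *)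
Lemma remainder_le g v m t0 t1 : (blen (iter m.+1 (Node g) v) > M)%N ->
  0 <= t0 -> t0 <= t1 -> t1 <= T ->
  abs (xi u g t0) ^+ m.+1 * (abs (xi u v t1 - xi u v t0) *
    (k0 * (a ^+ (blen (iter m.+1 (Node g) v)).-1 * a'))) <=
  2 * k0 * E * (variation u t1 - variation u t0).
Proof.
move=> big h0 h01 h1; set n := blen _ in big *.
have t0T : 0 <= t0 <= T by rewrite h0 (le_trans h01).
set dv := variation u t1 - variation u t0.
have dv0 : 0 <= dv by rewrite subr_ge0 (variation_mono hK ui).
have nE : n.-1 = (m.+1 * blen g + (blen v).-1)%N.
  by rewrite /n blen_iter; have := blen_gt0 v; case: (blen v) => // k _; rewrite addnS.
have kn : 0 <= k0 * (a ^+ n.-1 * a') by rewrite !mulr_ge0 ?exprn_ge0.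
apply: (@le_trans _ _ ((4 ^+ blen g * vT ^+ blen g) ^+ m.+1 *
    (2 * (4 ^+ (blen v).-1 * vT ^+ (blen v).-1) * dv * (k0 * (a ^+ n.-1 * a'))))).
  apply: ler_pM; rewrite ?exprn_ge0 ?(abs_ge0 hK)//; first by rewrite mulr_ge0 ?(abs_ge0 hK).
    apply: lerXn2r; rewrite ?nnegrE ?(abs_ge0 hK)//; first by rewrite mulr_ge0 ?exprn_ge0.
    exact: (xi_bound hK T0 ui).
  by apply: ler_wpM2r => //; exact: (xi_incr hK T0 ui).
have -> : (4 ^+ blen g * vT ^+ blen g) ^+ m.+1 *
    (2 * (4 ^+ (blen v).-1 * vT ^+ (blen v).-1) * dv * (k0 * (a ^+ n.-1 * a'))) =
    2 * k0 * (th ^+ n.-1 * a') * dv.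
  by rewrite /th nE mulnC 2!exprD !exprM !exprMn; ring.
apply: ler_wpM2r => //; apply: ler_wpM2l; first by rewrite mulr_ge0.
apply: ler_wpM2r => //; apply: ler_wiXn2l => //.
by move: big; clear; case: (n) => // k; rewrite ltnS.
Qed.

Lemma bracket_le g v m t0 t1 : 0 <= t0 -> t0 <= t1 -> t1 <= T ->
  abs (xi u g t0) ^+ m * (abs (xi u v t1 - xi u v t0) * (k0 * a ^+ blen (iter m (Node g) v)))
    <= 2 * sg.
Proof.
move=> h0 h01 h1; have t1T : 0 <= t1 <= T by rewrite h1 (le_trans h0).
have t0T : 0 <= t0 <= T by rewrite h0 (le_trans h01).
set n := blen (iter _ _ _); have nE : n = (m * blen g + blen v)%N := blen_iter g v m.
have kn : 0 <= k0 * a ^+ n by rewrite !mulr_ge0 ?exprn_ge0.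
apply: (@le_trans _ _ ((4 ^+ blen g * vT ^+ blen g) ^+ m *
    (2 * (4 ^+ blen v * vT ^+ blen v) * (k0 * a ^+ n)))).
  apply: ler_pM; rewrite ?exprn_ge0 ?(abs_ge0 hK)//; first by rewrite mulr_ge0 ?(abs_ge0 hK).
    apply: lerXn2r; rewrite ?nnegrE ?(abs_ge0 hK)//; first by rewrite mulr_ge0 ?exprn_ge0.
    exact: (xi_bound hK T0 ui).
  apply: ler_wpM2r => //; apply: (le_trans (absB hK _ _)); rewrite mulr_natl mulr2n.
  by apply: lerD; exact: (xi_bound hK T0 ui).
have -> : (4 ^+ blen g * vT ^+ blen g) ^+ m *
    (2 * (4 ^+ blen v * vT ^+ blen v) * (k0 * a ^+ n)) = 2 * (k0 * th ^+ n).
  by rewrite /th nE mulnC 2!exprD !exprM !exprMn; ring.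
apply: ler_wpM2l => //; apply: ler_wpM2l => //; apply: thX.
by rewrite nE addn_gt0 blen_gt0 orbT.
Qed.

Let W : R := 2 * (1 + 4 * vT) ^+ M.

Lemma dxi_le b t0 t1 : (blen b <= M)%N -> 0 <= t0 -> t0 <= t1 -> t1 <= T ->
  abs (xi u b t1 - xi u b t0) <= W * (variation u t1 - variation u t0).
Proof.
move=> bM h0 h01 h1; apply: (le_trans (xi_incr hK T0 ui b h0 h01 h1)).
apply: ler_wpM2r; first by rewrite subr_ge0 (variation_mono hK ui).
apply: ler_wpM2l => //; rewrite -exprMn; set z := 4 * vT.
have z0 : 0 <= z by rewrite mulr_ge0.
have z1 : 1 <= 1 + z by rewrite lerDl.
apply: (@le_trans _ _ ((1 + z) ^+ (blen b).-1)).
  by apply: lerXn2r; rewrite ?nnegrE ?addr_ge0// lerDr.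
by apply: ler_weXn2l => //; apply: leq_trans bM; exact: leq_pred.
Qed.

Lemma norm2_sum_le_size (J : eqType) (l : seq J) (P : pred J) (G : J -> V) (c : R) : 0 <= c ->
  (forall j, j \in l -> P j -> norm2 (G j) <= c) ->
  norm2 (\sum_(j <- l | P j) G j) <= (size l)%:R * c.
Proof. by move=> c0 h; apply: (le_trans (norm2_sum hK _ _ _)); exact: sum_le_size. Qed.

Lemma ord_sum_le n (G : nat -> R) (c : R) : (forall m, (m < n)%N -> G m <= c) ->
  \sum_(m < n) G m <= n%:R * c.
Proof.
move=> h; apply: (@le_trans _ _ (\sum_(m < n) c)); first by apply: ler_sum => m _; exact: h.
by rewrite sumr_const card_ord mulr_natl.
Qed.

Context (p : V).
Hypothesis sg_small : sg <= 2^-1.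
Hypothesis stay_in : norm2 p + n_s * (d%:R * (2 * sg)) + M.+1%:R * (n_s * (2 * sg)) <= rho.

Let ce : R := M%:R * (n_s * (2 * k0)).

(** Induction on the number of factors: a new factor [e^(xi_g g)] transforms the
  increments of the product of the others by the adjoint action, that is, transforms
  the brackets [ad_g^m v] into [v], and adds [dxi_g g]. *)
Lemma suffix_incr suf : forall pre, s = pre ++ suf -> exists2 C : R, 0 <= C &
  forall t0 t1 q0 q1, 0 <= t0 -> t0 <= t1 -> t1 <= T ->
  is_exp_prod rho (exps t0 suf) p q0 -> is_exp_prod rho (exps t1 suf) p q1 ->
  norm2 (q1 - (q0 + \sum_(b <- letters pre suf) (xi u b t1 - xi u b t0) *: F b q0)) <=
    4 ^+ size suf * (ce * E) * (variation u t1 - variation u t0) +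
    C * (variation u t1 - variation u t0) ^+ 2.
Proof.
have ce0 : 0 <= ce by nonneg.
have W0 : 0 <= W by rewrite mulr_ge0// exprn_ge0// addr_ge0// mulr_ge0.
elim: suf => [|g suf IH] pre sE.
  exists 0 => // t0 t1 _ _ h0 h01 h1 -> ->; rewrite big_nil addr0 subrr (norm2_0 hK) mul0r addr0.
  by rewrite mulr_ge0// ?subr_ge0 ?(variation_mono hK ui)// !mulr_ge0 ?exprn_ge0.
have sE' : s = rcons pre g ++ suf by rewrite cat_rcons.
have [C1 C10 h1] := IH _ sE'.
pose l := letters pre suf.
have l_suf v : v \in l -> v \in suf by rewrite mem_filter => /andP[].
have suf_s v : v \in suf -> v \in s by rewrite sE mem_cat inE => ->; rewrite !orbT.
have gs : g \in s by rewrite sE mem_cat mem_head orbT.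
have gM := s_len gs.
have size_l : (size l)%:R <= n_s.
  rewrite ler_nat sE size_cat /= size_filter; apply: leq_trans (count_size _ _) _.
  by rewrite addnS ltnW// ltnS leq_addl.
have lM v : v \in l -> (blen v <= M)%N by move=> vl; apply: s_len; apply: suf_s; exact: l_suf.
pose ad m v := iter m (Node g) v.
have [C2 C20 h2] : exists2 C : R, 0 <= C & forall m, m \in iota 0 M -> forall v, v \in l ->
    forall t0 t1, 0 <= t0 -> t0 <= t1 -> t1 <= T ->
    abs (xi u (ad m v) t1 - xi u (ad m v) t0 -
      exp_coef (xi u g t0) m * (xi u v t1 - xi u v t0)) <=
    C * (variation u t1 - variation u t0) ^+ 2.
  apply: uniform_bound => [m C C' h CC v vl t0 t1 k0' k01 k1'|m _].
    by apply: (le_trans (h v vl t0 t1 k0' k01 k1')); apply: ler_wpM2r CC; exact: sqr_ge0.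
  apply: uniform_bound => [v C C' h CC t0 t1 k0' k01 k1'|v vl].
    by apply: (le_trans (h t0 t1 k0' k01 k1')); apply: ler_wpM2r CC; exact: sqr_ge0.
  apply: (xi_ad_incr hK T0 ui) => c; exact: (letters_neq hB sorted_s mem_s sE vl).
pose Ng := k0 * a ^+ blen g; pose X := 4 ^+ blen g * vT ^+ blen g.
have Ng0 : 0 <= Ng by rewrite mulr_ge0 ?exprn_ge0.
have X0 : 0 <= X by rewrite mulr_ge0 ?exprn_ge0.
pose c := n_s * N; have c0 : 0 <= c by rewrite mulr_ge0.
pose c1 := Ng + c * \sum_(m < M) X ^+ m.
have c10 : 0 <= c1 by rewrite addr_ge0// mulr_ge0// sumr_ge0// => m _; exact: exprn_ge0.
pose C3 := (Ng * c1 + X * Q * c1 ^+ 2) * W ^+ 2.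
have C30 : 0 <= C3 by rewrite mulr_ge0 ?exprn_ge0// addr_ge0 ?mulr_ge0 ?exprn_ge0.
have C40 : 0 <= M%:R * (n_s * (C2 * N)) by nonneg.
exists (2 * (C1 + M%:R * (n_s * (C2 * N)) + C3)); first by rewrite mulr_ge0// !addr_ge0.
move=> t0 t1 _ _ k0' k01 k1' [r0 hr0 [x xs <-]] [r1 hr1 [y ys <-]].
have t1T : 0 <= t1 <= T by rewrite k1' (le_trans k0').
have t0T : 0 <= t0 <= T by rewrite k0' (le_trans k01).
set dv := variation u t1 - variation u t0.
have dv0 : 0 <= dv by rewrite subr_ge0 (variation_mono hK ui).
have {}h1 := h1 t0 t1 r0 r1 k0' k01 k1' hr0 hr1.
pose dxi v := xi u v t1 - xi u v t0.
pose h m z : V := \sum_(v <- l | (blen (ad m v) <= M)%N) dxi v *: F (ad m v) z.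
pose Dh m z w : V := \sum_(v <- l | (blen (ad m v) <= M)%N) dxi v *: jac (F (ad m v)) z w.
pose r m z : V := \sum_(v <- l | (blen (ad m v) <= M < blen (ad m.+1 v))%N)
  dxi v *: F (ad m.+1 v) z.
pose rem m : R := \sum_(v <- l | (blen (ad m v) <= M < blen (ad m.+1 v))%N)
  abs (dxi v) * (k0 * (a ^+ (blen (ad m.+1 v)).-1 * a')).
pose Sm v := abs (dxi v).
have r0b : cball rho r0.
  by have := flow_ball xs (introT andP (conj (lexx (0 : R)) ler01)); rewrite (flow_start hK xs).
have rg : regular rho Ng Q (F g) (jac (F g)) := (F_regular gM).1.
pose Sh (m : nat) := \sum_(v <- l | (blen (ad m v) <= M)%N) abs (dxi v).
have Sh0 m : 0 <= Sh m by apply: sumr_ge0 => v _; exact: abs_ge0.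
have rh m : (m < M)%N -> [/\ 0 <= Sh m * N, 0 <= Sh m * Q &
    regular rho (Sh m * N) (Sh m * Q) (h m) (Dh m)].
  move=> _; split; [by rewrite mulr_ge0|by rewrite mulr_ge0|].
  exact: (regular_sum hK l dxi (fun v (vM : (blen (ad m v) <= M)%N) => F_regN vM)).
have hn z : cball rho z -> h M z = 0.
  move=> _; rewrite /h big_pred0// => v; apply/negbTE; rewrite -ltnNge /ad blen_iter.
  apply: leq_ltn_trans (leq_pmulr M (blen_gt0 g)) _.
  by rewrite -[X in (X < _)%N]addn0 ltn_add2l blen_gt0.
have lie_h m z : (m < M)%N -> cball rho z ->
    Dh m z (F g z) - jac (F g) z (h m z) = h m.+1 z + r m z.
  move=> _ hz.
  have -> : jac (F g) z (h m z) =
      \sum_(v <- l | (blen (ad m v) <= M)%N) dxi v *: jac (F g) z (F (ad m v) z).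
    rewrite /h; elim: (l) => [|v l' IHl]; first by rewrite !big_nil (regular_linear0 rg hz).
    rewrite !big_cons; case: ifP => // _.
    by rewrite (regular_linearD _ _ rg hz) (regular_linearZ _ _ rg hz) IHl.
  rewrite /Dh -sumrB (eq_bigr (fun v => dxi v *: F (ad m.+1 v) z)); last first.
    by move=> v vM; rewrite -scalerBr F_lie.
  rewrite (bigID (fun v => blen (ad m.+1 v) <= M)%N) /=; congr (_ + _).
    apply: eq_bigl => v; apply: andb_idl; apply: leq_trans; exact: leq_addl.
  by apply: eq_bigl => v; rewrite -ltnNge.
have r_rem m z : (m < M)%N -> cball rho z -> norm2 (r m z) <= rem m.
  move=> _ hz; apply: (le_trans (norm2_sum hK _ _ _)); apply: ler_sum => v /andP[v1 v2].
  rewrite (norm2Z hK); apply: ler_wpM2l; first exact: abs_ge0.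
  apply: F_large => //; rewrite v2 mul2n -addnn; exact: leq_add.
have xi0X : abs (xi u g t0) <= X by exact: (xi_bound hK T0 ui).
have xi1X : abs (xi u g t1) <= X by exact: (xi_bound hK T0 ui).
have xi1N : abs (xi u g t1) * Ng <= 2^-1 by apply: le_trans sg_small; exact: xi_F_le.
have DS : abs (xi u g t1 - xi u g t0) <= W * dv by exact: dxi_le.
have hS m z : (m < M)%N -> cball rho z -> norm2 (h m z) <= c * (W * dv).
  move=> _ hz; apply: (@le_trans _ _ ((size l)%:R * (W * dv * N))).
    apply: norm2_sum_le_size; first by nonneg.
    move=> v vl vM; rewrite (norm2Z hK); apply: ler_pM; rewrite ?norm2_ge0 ?(abs_ge0 hK)//.
      by apply: dxi_le => //; exact: lM.
    exact: (reg_bound (F_regN vM)).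
  have -> : c * (W * dv) = n_s * (W * dv * N) by rewrite /c; ring.
  by apply: ler_wpM2r => //; nonneg.
have eP : \sum_(m < M) abs (xi u g t0) ^+ m.+1 * rem m <= ce * E * dv.
  have -> : ce * E * dv = M%:R * (n_s * (2 * k0 * E * dv)) by rewrite /ce; ring.
  apply: (@ord_sum_le _ (fun m => abs (xi u g t0) ^+ m.+1 * rem m)) => m _.
  rewrite mulr_sumr; apply: (@le_trans _ _ ((size l)%:R * (2 * k0 * E * dv))).
    apply: sum_le_size; first by nonneg.
    by move=> v vl /andP[_ v2]; exact: remainder_le.
  by apply: ler_wpM2r => //; nonneg.
have ns1 : 1 <= n_s by rewrite ler1n; case: (s) gs.
have sg1 : abs (xi u g t1 - xi u g t0) * Ng <= n_s * (2 * sg).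
  apply: (le_trans (dxi_F_le gM k0' k01 k1')).
  by rewrite ler_peMl// mulr_ge0.
have sgh m z : (m < M)%N -> cball rho z ->
    abs (xi u g t0) ^+ m * norm2 (h m z) <= n_s * (2 * sg).
  move=> _ hz; apply: (@le_trans _ _ ((size l)%:R * (2 * sg))); last first.
    by apply: ler_wpM2r => //; rewrite mulr_ge0.
  apply: (@le_trans _ _ (\sum_(v <- l | (blen (ad m v) <= M)%N)
      abs (xi u g t0) ^+ m * (abs (dxi v) * (k0 * a ^+ blen (ad m v))))).
    rewrite -mulr_sumr; apply: ler_wpM2l; first by rewrite exprn_ge0// (abs_ge0 hK).
    apply: (le_trans (norm2_sum hK _ _ _)); apply: ler_sum => v vM.
    rewrite (norm2Z hK); apply: ler_wpM2l; first exact: abs_ge0.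
    exact: (reg_bound (F_regular vM).1).
  by apply: sum_le_size; [rewrite mulr_ge0|move=> v _ _; exact: bracket_le].
have stay t : 0 <= t <= 1 -> norm2 (x t) + M.+1%:R * (n_s * (2 * sg)) <= rho.
  move=> tt; apply: le_trans stay_in; rewrite lerD2r.
  have := norm2D hK (x t - r0) r0; rewrite subrK => /le_trans; apply.
  have e1 := exp_displacement gM (xi_F_le gM t0T) xs tt.
  have e2 := prod_norm t0T suf_s hr0.
  apply: (le_trans (lerD e1 e2)); rewrite addrCA lerD2l -{1}[d%:R * _]mul1r -mulrDl.
  apply: ler_wpM2r; first by nonneg.
  rewrite addrC natr1 ler_nat sE size_cat /= leq_addl//.
have main := conjugation_step hK Ng0 Q0 rg M0 rh hn lie_h r_rem xi0X xi1X xi1N DS hS eP sg1 sgh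
  xs ys stay (erefl c1).
have -> : x 1 + \sum_(b <- letters pre (g :: suf)) dxi b *: F b (x 1) =
    x 1 + (xi u g t1 - xi u g t0) *: F g (x 1) + h 0%N (x 1).
  rewrite /letters /= (lead_g hB sorted_s mem_s sE) big_cons addrA; congr (_ + _).
  rewrite /h big_seq_cond [RHS]big_seq_cond; apply: eq_bigl => v.
  by case: (boolP (v \in l)) => // vl /=; rewrite lM.
apply: (le_trans main).
have diff : norm2 (\sum_(b <- letters (rcons pre g) suf) dxi b *: F b r0 -
    \sum_(m < M) exp_coef (xi u g t0) m *: h m r0) <= M%:R * (n_s * (C2 * N)) * dv ^+ 2.
  rewrite (big_letters hB sorted_s mem_s sE) -sumrB.
  apply: (le_trans (norm2_sum hK _ _ _)).
  have -> : M%:R * (n_s * (C2 * N)) * dv ^+ 2 = M%:R * (n_s * (C2 * dv ^+ 2 * N)) by ring.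
  apply: (@ord_sum_le _ (fun m => norm2 (\sum_(v <- l | (blen (ad m v) <= M)%N)
    dxi (ad m v) *: F (ad m v) r0 - exp_coef (xi u g t0) m *: h m r0))) => m mM.
  rewrite /h scaler_sumr -sumrB; apply: (@le_trans _ _ ((size l)%:R * (C2 * dv ^+ 2 * N))).
    apply: norm2_sum_le_size => [|v vl vM]; first by nonneg.
    rewrite scalerA -scalerBl (norm2Z hK); apply: ler_pM; rewrite ?norm2_ge0 ?(abs_ge0 hK)//.
      by apply: h2 => //; rewrite mem_iota.
    exact: (reg_bound (F_regN vM)).
  by apply: ler_wpM2r => //; nonneg.
have tri : norm2 (r1 - (r0 + \sum_(m < M) exp_coef (xi u g t0) m *: h m r0)) <=
    4 ^+ size suf * (ce * E) * dv + C1 * dv ^+ 2 + M%:R * (n_s * (C2 * N)) * dv ^+ 2.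
  apply: le_trans (lerD h1 diff); apply: le_trans (norm2D hK _ _).
  by rewrite le_eqVlt; apply/orP; left; apply/eqP; congr norm2; rewrite opprD [in RHS]opprD
    -!addrA; congr (_ + (_ + _)); rewrite addrA addNr add0r.
have p4 : 1 <= 4 ^+ size suf :> R by rewrite exprn_ege1// ler1n.
have cEd : 0 <= ce * E * dv by nonneg.
have -> : (Ng * c1 + X * Q * c1 ^+ 2) * (W * dv) ^+ 2 = C3 * dv ^+ 2 by rewrite /C3; ring.
rewrite -[size (g :: suf)]/(size suf).+1 (exprS 4 (size suf)).
have := ler_wpM2r cEd p4; rewrite mul1r => e4.
have e5 : 4 ^+ size suf * (ce * E) * dv = 4 ^+ size suf * (ce * E * dv) by ring.
rewrite e5 in tri.
have -> : 4 * 4 ^+ size suf * (ce * E) * dv = 4 * (4 ^+ size suf * (ce * E * dv)) by ring.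
exact: step_arith tri e4.
Qed.

Lemma uniq_s : uniq s.
Proof.
apply: (pairwise_uniq _ (pairwise_s hB sorted_s mem_s)) => b.
by rewrite /blt eqxx.
Qed.

Lemma big_leaves (G : br I -> V) : \sum_(b <- letters [::] s) G b = \sum_i G (Leaf i).
Proof.
have h : perm_eq (letters [::] s) [seq Leaf i | i <- enum I].
  apply: uniq_perm; first by rewrite filter_uniq// uniq_s.
    by rewrite map_inj_uniq ?enum_uniq// => i j [].
  move=> b; rewrite mem_filter; apply/andP/mapP => [[lb _]|[i _ ->]].
    by case: b lb => // i _; exists i => //; rewrite mem_enum.
  by split => //; rewrite mem_s (hall_leaf hB).
by rewrite (perm_big _ h) big_map big_enum.
Qed.

Lemma leaf_regular i : regular rho (k0 * a) Q (f i) (jac (f i)).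
Proof. by have [] := F_regular (b := Leaf i) M0; rewrite expr1. Qed.

Hypothesis d_sg_small : d%:R * (2 * sg) <= 2^-1.

Let ka0 : 0 <= k0 * a.
Proof. exact: mulr_ge0. Qed.

Let ka_vT : 2 * (k0 * a) * vT <= 2 * sg.
Proof.
rewrite /sg /th; have : 0 <= k0 * a * vT by rewrite mulr_ge0.
by rewrite -subr_ge0 => h; lra.
Qed.

Lemma control_exists : norm2 p + d%:R * (2 * sg) <= rho ->
  exists x, solution rho T (control_field f u) p x.
Proof.
move=> st; apply: (solution_exists hK T0 ka0 ui (fun i => reg_bound (leaf_regular i))
  (fun i => reg_lip (leaf_regular i))) => //.
  by apply: le_trans d_sg_small; apply: ler_wpM2l.
by apply: le_trans st; rewrite lerD2l; apply: ler_wpM2l.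
Qed.

Hypothesis sg_I : #|I|%:R * sg <= 2^-1.

(** Both curves have increments [sum_i dxi_i f_i] up to errors of second order, and up
  to [E] for the product. *)
Lemma solution_prod_dist x q : solution rho T (control_field f u) p x ->
  is_exp_prod rho (exps T s) p q ->
  norm2 (x T - q) <= 2 * (4 ^+ size s * (ce * E) * vT).
Proof.
move=> xs hq; have TT : 0 <= T <= T by rewrite lexx T0.
have [z0 hz0] : exists z0 : R -> V, forall t, 0 <= t <= T -> is_exp_prod rho (exps t s) p (z0 t).
  suff /choice[z0 hz0] : forall t, exists y, 0 <= t <= T -> is_exp_prod rho (exps t s) p y.
    by exists z0.
  move=> t; have [tT|_] := boolP (0 <= t <= T); last by exists 0.
  have [|y hy] := prod_exists tT (fun b bs => bs) d_sg_small (p := p).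
    apply: le_trans stay_in; rewrite lerDl; apply: mulr_ge0 => //.
    by apply: mulr_ge0 => //; apply: mulr_ge0.
  by exists y.
pose z t := if t == T then q else z0 t.
have hz t : 0 <= t <= T -> is_exp_prod rho (exps t s) p (z t).
  by rewrite /z; case: eqP => [-> //|_]; exact: hz0.
have zT : z T = q by rewrite /z eqxx.
have zz : 0 <= (0 : R) <= T by rewrite lexx.
have z_0 : z 0 = p.
  apply/eqP; rewrite -subr_eq0; apply/eqP; apply: (norm2_le0 hK).
  rewrite -[leRHS](mulr0 (size s)%:R) -[X in _ * X](mulr0 d%:R) -[X in _ * (_ * X)](mulr0 2).
  apply: (prod_displacement _ (hz 0 zz)) => b bs; split; first exact: s_len.
  by rewrite (xi0 hK T0 ui) (abs0 hK) mul0r.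
have x_0 : x 0 = p.
  exact: (solution_start hK T0 xs).
have fN i := reg_bound (leaf_regular i); have fL i := reg_lip (leaf_regular i).
have xb t : 0 <= t <= T -> cball rho (x t).
  by move: xs => [_ xb _] tT; apply: xb; rewrite in_itv.
have p_rho : norm2 p <= rho.
  by have := xb 0 zz; rewrite x_0.
have zb t : 0 <= t <= T -> cball rho (z t).
  move=> tT; apply: (le_trans (prod_norm tT (fun b bs => bs) (hz t tT))).
  apply: le_trans stay_in; rewrite lerDl; apply: mulr_ge0 => //.
  by apply: mulr_ge0 => //; apply: mulr_ge0.
have [C C0 hC] := suffix_incr (pre := [::]) (erefl s).
pose L := #|I|%:R * (2 * (k0 * a)).
have L0 : 0 <= L by rewrite !mulr_ge0.
pose A := 4 ^+ size s * (ce * E).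
have ce0 : 0 <= ce by rewrite !mulr_ge0.
have A0 : 0 <= A by apply: mulr_ge0; [exact: exprn_ge0|exact: mulr_ge0].
pose Cx := d%:R * (2 * (k0 * a * (d%:R * (2 * (k0 * a))))).
have Cx0 : 0 <= Cx by rewrite !mulr_ge0.
have vc : {within `[0, T], continuous (variation u)}.
  exact: (prim_continuous T0 (integ_sum_abs hK ui)).
have v_0 : variation u 0 = 0 by rewrite /variation prim0.
have LV : L * variation u T <= 2^-1.
  apply: le_trans sg_I; rewrite /L -mulrA; apply: ler_wpM2l => //.
  rewrite /sg /th; have : 0 <= k0 * a * vT by rewrite mulr_ge0.
  rewrite -/vT; lra.
have := discrete_gronwall (phi := fun t => norm2 (z t - x t)) T0 L0 A0 (addr_ge0 C0 Cx0) vc v_0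
  (fun s t s0 st tT => variation_mono hK ui s0 st tT) (fun t => norm2_ge0 _) _ LV.
rewrite z_0 x_0 subrr (norm2_0 hK) add0r zT (norm2_distC hK) => H.
apply: H => t0 t1 h0 h01 h1.
have t0T : 0 <= t0 <= T by rewrite h0 (le_trans h01).
have t1T : 0 <= t1 <= T by rewrite h1 (le_trans h0).
have e1 := hC t0 t1 _ _ h0 h01 h1 (hz t0 t0T) (hz t1 t1T).
rewrite big_leaves in e1.
have e2 := solution_incr2 hK ka0 ui fN fL xs h0 h01 h1.
set dv := variation u t1 - variation u t0 in e1 e2 *.
have dv0 : 0 <= dv by rewrite subr_ge0 (variation_mono hK ui).
pose dz := \sum_i (xi u (Leaf i) t1 - xi u (Leaf i) t0) *: F (Leaf i) (z t0).
pose dx := \sum_i (int0 (u i) t1 - int0 (u i) t0) *: f i (x t0).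
have e3 : norm2 (dz - dx) <= L * dv * norm2 (z t0 - x t0).
  rewrite /dz /dx -sumrB; apply: (le_trans (norm2_sum hK _ _ _)).
  apply: (@le_trans _ _ (\sum_(i : I) 2 * dv * (k0 * a * norm2 (z t0 - x t0)))).
    apply: ler_sum => i _; rewrite -scalerBr (norm2Z hK).
    apply: ler_pM; rewrite ?norm2_ge0 ?(abs_ge0 hK)//.
      have := xi_incr hK T0 ui (Leaf i) h0 h01 h1; rewrite /= !expr0 !mulr1; exact.
    by apply: fL; [exact: xb|exact: zb].
  rewrite sumr_const -[X in X <= _]mulr_natl.
  by rewrite le_eqVlt; apply/orP; left; apply/eqP; rewrite /L; ring.
have -> : z t1 - x t1 = (z t0 - x t0) + (dz - dx) +
    ((z t1 - (z t0 + dz)) - (x t1 - x t0 - dx)).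
  by apply/rowP => k; rewrite !mxE; ring.
apply: (le_trans (norm2D hK _ _)); rewrite -[leRHS]addrA; apply: lerD.
  by apply: (le_trans (norm2D hK _ _)); apply: lerD => //; exact: e3.
apply: (le_trans (norm2B hK _ _)); rewrite mulrDl addrA; apply: lerD; first exact: e1.
apply: (le_trans e2).
by rewrite le_eqVlt; apply/orP; left; apply/eqP; rewrite /Cx; ring.
Qed.

End Products.

(** * Choice of the constants *)

Section Horizon.
Context {R : realType} {K : scalar_field R}.
Hypothesis hK : K = real_scalars R \/ K = complex_scalars R.

Lemma normL1E (I : finType) (u : I -> R -> K) t : (forall i, integK t (u i)) ->
  normL1 t u = variation u t.
Proof.
move=> ui; have ia i := integ_abs hK (ui i).
have oo (g : R -> R) : integ t g -> \int[lebesgue_measure]_(s in `]0, t[) g s = prim g t.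
  move=> gi; have i1 : lebesgue_measure.-integrable (`]0, t]%classic : set R) (EFin \o g).
    apply: integrableS gi => // s /=; rewrite !in_itv /= => /andP[s0 ->].
    by rewrite ltW.
  have i2 : lebesgue_measure.-integrable (`]0, t[%classic : set R) (EFin \o g).
    apply: integrableS gi => // s /=; rewrite !in_itv /= => /andP[s0 st].
    by rewrite !ltW.
  by rewrite Rintegral_itv_bndo_bndc// Rintegral_itv_obnd_cbnd.
have h (r : seq I) : integ t (fun s => \sum_(i <- r) abs (u i s)) /\
  prim (fun s => \sum_(i <- r) abs (u i s)) t = \sum_(i <- r) prim (fun s => abs (u i s)) t.
  elim: r => [|i r [IH1 IH2]].
    have -> : (fun s => \sum_(i <- [::]) abs (u i s)) = fun=> 0.
      by apply/funext => s; rewrite big_nil.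
    split; first exact: integ_cst.
    by rewrite big_nil /prim Rintegral_cst// mul0r.
  have -> : (fun s => \sum_(j <- i :: r) abs (u j s)) =
      fun s => abs (u i s) + \sum_(j <- r) abs (u j s).
    by apply/funext => s; rewrite big_cons.
  split; first exact: integD.
  by rewrite big_cons (primD (lexx t) (ia i) IH1) IH2.
rewrite /variation (h (index_enum I)).2; apply: eq_bigr => i _; exact: oo.
Qed.

Lemma solution_restrict d rho T t (G : R -> 'rV[K]_d -> 'rV[K]_d) p x : t <= T ->
  solution rho T G p x -> solution rho t G p x.
Proof.
move=> tT [xc xb xe].
have sub r : r \in `[0, t] -> r \in `[0, T].
  by rewrite !in_itv /= => /andP[-> rt]; exact: le_trans tT.
by split=> [|r /sub|r /sub]; [exact: continuous_subspaceW xc|exact: xb|exact: xe].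
Qed.

(** With [sg] bounding each [xi_b f_b], it collects all the conditions on [sg]: contraction
  of the Picard iterations and room in the ball for the [k] flows and their corrections. *)
Definition margin (n m k l : nat) : R :=
  4 * n%:R + 2 * l%:R + 2 + k%:R * (n%:R + m.+1%:R).

Lemma marginP n m k l (dl sg : R) : 0 <= sg -> margin n m k l * sg <= Num.min 1 dl ->
  [/\ sg <= 2^-1, n%:R * (2 * sg) <= 2^-1, l%:R * sg <= 2^-1,
    k%:R * (n%:R * (2 * sg)) + m.+1%:R * (k%:R * (2 * sg)) <= 2 * dl &
    n%:R * (2 * sg) <= dl].
Proof.
move=> s0; rewrite le_min => /andP[h1 h2].
have x1 : 0 <= n%:R * sg by rewrite mulr_ge0.
have x2 : 0 <= l%:R * sg by rewrite mulr_ge0.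
have x3 : 0 <= k%:R * (n%:R * sg) by rewrite !mulr_ge0.
have x4 : 0 <= k%:R * (m.+1%:R * sg) by rewrite !mulr_ge0.
have e : margin n m k l * sg = 4 * (n%:R * sg) + 2 * (l%:R * sg) + 2 * sg +
  (k%:R * (n%:R * sg) + k%:R * (m.+1%:R * sg)) by rewrite /margin; ring.
rewrite {}e in h1 h2.
have -> : k%:R * (n%:R * (2 * sg)) + m.+1%:R * (k%:R * (2 * sg)) =
  2 * (k%:R * (n%:R * sg) + k%:R * (m.+1%:R * sg)) by ring.
have -> : n%:R * (2 * sg) = 2 * (n%:R * sg) by ring.
by split; lra.
Qed.

Lemma margin_gt0 n m k l : 0 < margin n m k l.
Proof.
have h0 (j : nat) : 0 <= j%:R :> R by exact: ler0n.
have : 0 <= k%:R * (n%:R + m.+1%:R) :> R by rewrite mulr_ge0// addr_ge0.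
by rewrite /margin; have := h0 n; have := h0 l; lra.
Qed.

End Horizon.
Arguments margin : clear implicits.

Theorem proposition104 (R : realType) (K : scalar_field R)
    (hK : K = real_scalars R \/ K = complex_scalars R)
    (d : nat) (hd : (0 < d)%N)
    (I : finType) (B : {pred br I}) (le : rel (br I)) (hB : hall_set B le)
    (M : nat) (hM : (0 < M)%N) :
  exists C eta : R, [/\ 0 < C, 0 < eta &
    forall (T delta : R), 0 < T -> 0 < delta ->
    forall (f : I -> 'rV[K]_d -> 'rV[K]_d) (u : I -> R -> K),
    (forall i, C_ball (2 * M) (3 * delta) (f i)) ->
    (forall i, L1 T (u i)) ->
    normL1 T u * normCks M (3 * delta) f <= eta * Num.min 1 delta ->
    forall s : seq (br I), sorted (blt le) s ->
    (forall b, (b \in s) = (b \in B) && (blen b <= M)%N) ->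
    forall (t : R) (p : 'rV[K]_d), 0 <= t <= T -> cball delta p ->
    let exps := [seq (fun y => xi u b t *: bfield f b y) | b <- s] in
    [/\ exists x, solution (3 * delta) T (control_field f u) p x,
        exists q, is_exp_prod (3 * delta) exps p q &
        forall x q, solution (3 * delta) T (control_field f u) p x ->
          is_exp_prod (3 * delta) exps p q ->
          norm2 (x t - q) <=
            C * normL1 t u ^+ M.+1 * normCks (2 * M) (3 * delta) f ^+ M.+1 *
            (1 + normCks (2 * M) (3 * delta) f ^+ M.-1)]].

Proof.
(* The list of the elements of length at most [M] is unique if it exists: its size
  may enter the constants. *)
have [[s0 [ss0 ms0]]|no] := pselect (exists s0, sorted (blt le) s0 /\
    forall b, (b \in s0) = (b \in B) && (blen b <= M)%N); last first.
  exists 1, 1; split => // T delta _ _ f u _ _ _ s ss ms.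
  by case: no; exists s.
pose k0 := field_const R d M; pose c1 := pd_const R d M.
have [c2 c2E] : exists c2, c2 = pd_const R d (2 * M) by exists (pd_const R d (2 * M)).
pose kap := margin R d M (size s0) #|I|.
have k1 : 1 <= k0 := field_const_ge1 M hd.
have k00 : 0 <= k0 := le_trans ler01 k1.
have c_gt0 k : 0 < pd_const R d k by rewrite mulr_gt0 ?ltr0n// expn_gt0 fact_gt0.
have kap0 : 0 < kap := margin_gt0 d M (size s0) #|I|.
pose C := 2 * (4 ^+ size s0 * (M%:R * ((size s0)%:R * (2 * k0)) * (4 ^+ M * c2 ^+ M.+1))).
have c20 : 0 <= c2 by rewrite c2E ltW.
have C0 : 0 <= C by nonneg.
have K4 : 0 < kap * (k0 * 4 * c1).
  have k0p : 0 < k0 := lt_le_trans ltr01 k1; have c10 : 0 < c1 := c_gt0 M.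
  by rewrite mulr_gt0// mulr_gt0// mulr_gt0.
exists (C + 1), (kap * (k0 * 4 * c1))^-1; split; first by rewrite ltr_wpDl.
  by rewrite invr_gt0.
move=> T delta T0 delta0 f u fC uL small s ss ms t p /andP[t0 tT] hp exps.
have rho0 : 0 <= 3 * delta by rewrite mulr_ge0// ltW.
have size_s : size s = size s0.
  apply: perm_size; apply: uniq_perm; [exact: uniq_s hB ss ms|exact: uniq_s hB ss0 ms0|].
  by move=> b; rewrite ms ms0.
have ui i : integK T (u i) := L1_integK (uL i).
have uit i : integK t (u i) := integK_le tT (ui i).
have [a [a' [N [Q [/andP[a0 aM] [aa' a'E] [N0 Q0] F_regular [F_large F_lie]]]]]] :=
  field_bounds hK hd hM rho0 fC.
have n20 := normCks_ge0 hK hd rho0 fC (leqnn _).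
have vT0 : 0 <= variation u T by apply: (variation_ge0 hK ui); rewrite lexx ltW.
have vt0 : 0 <= variation u t by apply: (variation_ge0 hK ui); rewrite t0.
have vtT : variation u t <= variation u T by apply: (variation_mono hK ui).
pose sg r := k0 * (4 * variation u r * a).
(* The horizon is [T] for the existence of [x], and [t] for the estimate, in which only the
  controls on [(0, t)] appear. *)
have sgT : kap * sg T <= Num.min 1 delta.
  have := ler_wpM2l (ltW K4) small; rewrite normL1E// mulVKf ?lt0r_neq0//.
  apply: le_trans.
  have -> : kap * sg T = kap * (k0 * 4) * variation u T * a by rewrite /sg; ring.
  have -> : kap * (k0 * 4 * c1) * (variation u T * normCks M (3 * delta) f) =
    kap * (k0 * 4) * variation u T * (c1 * normCks M (3 * delta) f) by ring.
  by apply: ler_wpM2l aM; apply: mulr_ge0 => //; apply: mulr_ge0; [exact: ltW|exact: mulr_ge0].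
have sgt : kap * sg t <= Num.min 1 delta.
  apply: le_trans sgT; apply: ler_wpM2l; first exact: ltW.
  by apply: ler_wpM2l => //; apply: ler_wpM2r => //; apply: ler_wpM2l.
have sgT0 : 0 <= sg T by nonneg.
have sgt0 : 0 <= sg t by nonneg.
have [_ dT _ _ stT] := marginP sgT0 sgT.
have [st2 dt It stay dt'] := marginP sgt0 sgt.
have th1 : 4 * variation u t * a <= 1.
  apply: (@le_trans _ _ (sg t)); first by rewrite ler_peMl//; nonneg.
  by apply: (le_trans st2); rewrite invf_le1// ler1n.
have pd : norm2 p <= delta by [].
rewrite -size_s in stay.
split.
- apply: (control_exists hK hM (ltW T0) ui a0 k1 F_regular dT).
  apply: (le_trans (lerD pd stT)); lra.
- apply: (prod_exists hK t0 uit a0 k1 F_regular ms th1 _ _ dt) => //; first by rewrite t0 lexx.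
  have : 0 <= M.+1%:R * ((size s)%:R * (2 * sg t)) by nonneg.
  move: pd stay; rewrite -/(sg t); clear; lra.
move=> x q xs hq.
have := solution_prod_dist hK hM t0 uit a0 aa' k1 N0 Q0 F_regular F_large F_lie hB ss ms th1 st2
  _ dt It (solution_restrict tT xs) hq.
rewrite -/(sg t) -addrA; have room : norm2 p + ((size s)%:R * (d%:R * (2 * sg t)) +
    M.+1%:R * ((size s)%:R * (2 * sg t))) <= 3 * delta.
  by apply: (le_trans (lerD pd stay)); lra.
move=> /(_ room) /le_trans; apply.
rewrite normL1E// size_s; set v := variation u t in vt0 *.
set n2 := normCks (2 * M) _ _ in n20 a'E *.
have e : 2 * (4 ^+ size s0 * (M%:R * ((size s0)%:R * (2 * k0)) * ((4 * v * a) ^+ M * a')) * v) <=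
    C * v ^+ M.+1 * n2 ^+ M.+1.
  have -> : C * v ^+ M.+1 * n2 ^+ M.+1 = 2 * (4 ^+ size s0 *
      (M%:R * ((size s0)%:R * (2 * k0)) * ((4 * v * (c2 * n2)) ^+ M * (c2 * n2))) * v).
    by rewrite /C !exprMn !(exprS _ M); ring.
  rewrite a'E -c2E in aa' *; have c2n : 0 <= c2 * n2 := le_trans a0 aa'.
  have v4 : 0 <= 4 * v by rewrite mulr_ge0.
  apply: ler_wpM2l => //; apply: ler_wpM2r => //; apply: ler_wpM2l; first exact: exprn_ge0.
  apply: ler_wpM2l; first by apply: mulr_ge0 => //; apply: mulr_ge0 => //; apply: mulr_ge0.
  apply: ler_wpM2r => //; apply: lerXn2r; rewrite ?nnegrE ?mulr_ge0//.
  exact: ler_wpM2l.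
apply: (le_trans e); set w := n2 ^+ M.-1; have w0 : 0 <= w by exact: exprn_ge0.
have y0 : 0 <= v ^+ M.+1 * n2 ^+ M.+1 by rewrite mulr_ge0// exprn_ge0.
rewrite -mulrA -[(C + 1) * _ * _]mulrA -[C * _]mulr1.
apply: ler_pM => //; first exact: mulr_ge0.
  by apply: ler_wpM2r => //; rewrite lerDl.
by rewrite lerDl.
Qed.
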